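(* Let $n\ge 2$ be an integer and let $p=p_0(n)$ be the positive root of $(n-1)p^2-(n+1)p-2=0$. Let $f,g\in C_0^\infty(\mathbb{R}^n)$ satisfy $\operatorname{supp} f,\ \operatorname{supp} g\subset\{x\in\mathbb{R}^n : |x|\le 1\}$, $f(x)\ge 0$ and $g(x)\ge 0$ for all $x\in\mathbb{R}^n$, and $g\not\equiv 0$. For $\varepsilon>0$ consider the Cauchy problem $$\partial_t^2u-\sum_{i=1}^n\partial_{x_i}^2u=|u|^p,\qquad u(0,x)=\varepsilon f(x),\quad u_t(0,x)=\varepsilon g(x),\quad x\in\mathbb{R}^n.$$ Then there exist constants $\varepsilon_0>0$ and $B>0$, with $B$ independent of $\varepsilon$, such that for every $0<\varepsilon\le\varepsilon_0$ the following holds: if the Cauchy problem has a solution $u$ on $[0,T)\times\mathbb{R}^n$ satisfying $$u\in C([0,T),H^1(\mathbb{R}^n))\cap C^1([0,T),L^2(\mathbb{R}^n))\cap C([0,T),L^p(\mathbb{R}^n)),\qquad \operatorname{supp}u\subset\{(x,t): |x|\le t+1\},$$ then $T<\infty$, and the lifespan $T(\varepsilon)$ (the largest $T$ for which such a solution exists) satisfies $$T(\varepsilon)\le\exp\left(B\varepsilon^{-p(p-1)}\right).$$ In particular, when $n=4$, so that $p=p_0(4)=2$, one has $T(\varepsilon)\le\exp(B\varepsilon^{-2})$.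
   Context: The lifespan $T(\varepsilon)$ is the largest value such that a solution of the Cauchy problem (in the stated regularity class and with the stated support property) exists for $x\in\mathbb{R}^n$, $0\le t<T(\varepsilon)$, i.e. the supremum of all $T$ for which such a solution exists on $[0,T)$. A solution in the stated class satisfies the equation in the sense of distributions on $(0,T)\times\mathbb{R}^n$ and attains the initial data at $t=0$. *)

(* Defs.v *)
From HB Require Import structures.
From mathcomp Require Import all_boot all_order all_algebra.
From mathcomp Require Import all_classical all_reals all_analysis.
Set Implicit Arguments.
Unset Strict Implicit.
Unset Printing Implicit Defensive.
Import Order.TTheory GRing.Theory Num.Def Num.Theory.
Import numFieldNormedType.Exports.
Local Open Scope classical_set_scope.
Local Open Scope ring_scope.

(* The sigma-algebra on R^n is generated by the coordinates, so it is the Borel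
   one. *)
Section measurable_rV.
Context (R : realType) (n : nat).

Let coord (i : 'I_n) (x : 'rV[R]_n) : measurableTypeR R := x ord0 i.

HB.instance Definition _ := @isMeasurable.Build default_measure_display
  'rV[R]_n (g_sigma_preimage coord) (@sigma_algebra0 _ setT _)
  (fun A => @sigma_algebraC _ _ A) (fun F => @sigma_algebra_bigcup _ setT _ F).

Lemma measurable_rV_coord (i : 'I_n) :
  measurable_fun [set: 'rV[R]_n] (coord i).
Proof.
move=> _ Y mY; rewrite setTI; apply: sub_sigma_algebra => /=.
rewrite -bigcup_seq/=; exists i => /=; first by rewrite mem_index_enum.
by exists Y => //; rewrite setTI.
Qed.

Lemma measurable_fun_rVP d (T : measurableType d) (f : T -> 'rV[R]_n) :
  (forall i, measurable_fun [set: T] (coord i \o f)) ->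
  measurable_fun [set: T] f.
Proof.
move=> mf _ Y mY; rewrite setTI.
have : preimage_set_system [set: T] f (g_sigma_preimage coord) (f @^-1` Y).
  by exists Y => //; rewrite setTI.
rewrite -g_sigma_preimage_comp; apply: smallest_sub.
  exact: sigma_algebra_measurable.
rewrite -bigcup_seq; apply: bigcup_sub => i _ A [B mB <-]; exact: mf.
Qed.

End measurable_rV.

Section lebesgue_rV.
Context (R : realType).

Definition rV_cons n (z : measurableTypeR R * 'rV[R]_n) : 'rV[R]_n.+1 :=
  \row_i oapp (z.2 ord0) z.1 (unlift ord0 i).

Definition rV_uncons n (x : 'rV[R]_n.+1) : measurableTypeR R * 'rV[R]_n :=
  (x ord0 ord0, \row_i x ord0 (lift ord0 i)).

Lemma rV_consK n : cancel (@rV_cons n) (@rV_uncons n).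
Proof.
move=> [x v]; rewrite /rV_uncons mxE unlift_none/=; congr pair.
by apply/rowP => i; rewrite !mxE liftK.
Qed.

Lemma measurable_rV_cons n : measurable_fun setT (@rV_cons n).
Proof.
apply: measurable_fun_rVP => i /=.
rewrite (_ : _ \o _ = fun z : measurableTypeR R * 'rV[R]_n =>
    oapp (z.2 ord0) z.1 (unlift ord0 i)); last first.
  by apply/funext => z /=; rewrite mxE.
case: (unlift ord0 i) => [j|] /=; last exact: measurable_fst.
by apply: measurableT_comp (measurable_rV_coord j) _; exact: measurable_snd.
Qed.

Lemma measurable_rV_uncons n : measurable_fun setT (@rV_uncons n).
Proof.
apply/measurable_fun_pairP; split; first exact: measurable_rV_coord.
apply: measurable_fun_rVP => i /=.
rewrite (_ : _ \o _ = fun x : 'rV_n.+1 => x ord0 (lift ord0 i)); last first.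
  by apply/funext => x /=; rewrite mxE.
exact: measurable_rV_coord.
Qed.

Section step.
Context (n : nat) (m1 : {sigma_finite_measure set (measurableTypeR R) -> \bar R}).
Context (m : {sigma_finite_measure set 'rV[R]_n -> \bar R}).

Definition rV_product : set 'rV[R]_n.+1 -> \bar R :=
  pushforward (m1 \x m)%E (@rV_cons n).

Let step0 : rV_product set0 = 0%E.
Proof. by rewrite /rV_product /pushforward preimage_set0 measure0. Qed.

Let mstep A : measurable A -> measurable (@rV_cons n @^-1` A).
Proof.
by move=> mA; rewrite -[X in measurable X]setTI; exact: measurable_rV_cons.
Qed.

Let step_ge0 A : (0 <= rV_product A)%E.
Proof. by rewrite /rV_product /pushforward measure_ge0. Qed.

Let step_sigma_additive : semi_sigma_additive rV_product.
Proof.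
move=> F mF tF mUF; rewrite /rV_product /pushforward preimage_bigcup.
apply: measure_semi_sigma_additive.
- by move=> k; exact: mstep.
- apply/trivIsetP => /= i j _ _ ij; rewrite -preimage_setI.
  by move/trivIsetP : tF => /(_ _ _ _ _ ij) ->//; rewrite preimage_set0.
- by rewrite -preimage_bigcup; exact: mstep.
Qed.

HB.instance Definition _ := isMeasure.Build _ _ _ rV_product
  step0 step_ge0 step_sigma_additive.

Let step_sigma_finite : sigma_finite setT rV_product.
Proof.
have /sigma_finiteP[F [TF ndF Foo]] := sigma_finiteT m1.
have /sigma_finiteP[G [TG ndG Goo]] := sigma_finiteT m.
exists (fun k => @rV_uncons n @^-1` (F k `*` G k)).
  rewrite -preimage_bigcup -(@preimage_setT _ _ (@rV_uncons n)); congr (_ @^-1` _).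
  rewrite -setXTT TF TG predeqE => -[x y]; split.
    move=> [/= [j _ Fjx] [k _ Gky]]; exists (maxn j k) => //; split.
    - by move: x Fjx; exact/subsetPset/ndF/leq_maxl.
    - by move: y Gky; exact/subsetPset/ndG/leq_maxr.
  by move=> [k _ []/= ? ?]; split; exists k.
move=> k; have [mF Fk] := Foo k; have [mG Gk] := Goo k; split.
  rewrite -[X in measurable X]setTI; apply: measurable_rV_uncons => //.
  exact: measurableX.
rewrite /rV_product /pushforward -comp_preimage.
rewrite (_ : _ \o _ = id); last by apply/funext => z; exact: rV_consK.
by rewrite preimage_id product_measure1E// lte_mul_pinfty// ge0_fin_numE.
Qed.

HB.instance Definition _ := Measure_isSigmaFinite.Build _ _ _ rV_product
  step_sigma_finite.

End step.

Fixpoint lebesgue_rV n : {sigma_finite_measure set 'rV[R]_n -> \bar R} :=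
  if n is k.+1 then rV_product lebesgue_measure (lebesgue_rV k) else \d_(0 : 'rV[R]_0).

Lemma lebesgue_rV_box n (A : 'I_n -> set (measurableTypeR R)) :
  (forall i, measurable (A i)) ->
  lebesgue_rV n [set x | forall i, A i (x ord0 i)] =
  (\prod_(i < n) lebesgue_measure (A i))%E.
Proof.
elim: n A => [|n IHn] A mA /=.
  rewrite big_ord0 diracE mem_set//= => -[] //.
rewrite big_ord_recl -IHn // /rV_product /pushforward.
have mB : measurable [set v : 'rV[R]_n | forall i, A (lift ord0 i) (v ord0 i)].
  rewrite (_ : [set _ | _] = \big[setI/setT]_(i < n)
      ((fun v : 'rV[R]_n => v ord0 i) @^-1` A (lift ord0 i))).
    apply: bigsetI_measurable => i _; rewrite -[X in measurable X]setTI.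
    exact: measurable_rV_coord.
  rewrite -bigcap_seq; apply/seteqP; split => v /= Av i; first by move=> _; exact: Av.
  by apply: Av; rewrite /= mem_index_enum.
rewrite -product_measure1E//; congr ((_ \x _)%E _).
apply/seteqP; split => -[x v] /=.
  move=> xA; split; first by have := xA ord0; rewrite mxE unlift_none.
  by move=> i; have := xA (lift ord0 i); rewrite mxE liftK.
by move=> [Ax Av] i; rewrite mxE; case: unliftP => [j ->|->] /=.
Qed.

End lebesgue_rV.

Section smooth_functions.
Context (R : realType) (V : normedModType R).
Implicit Types (f : V -> R) (k : nat).

(* Iterated directional derivatives: on a finite-dimensional V, this is the
   usual class C^k. *)
Fixpoint Ck k f : Prop :=
  continuous f /\
  if k is j.+1 then
    forall v : V, (forall x, derivable f x v) /\ Ck j ('D_v f)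
  else True.

Definition smooth f := forall k, Ck k f.

Definition fsupport f : set V := closure [set x | f x != 0].

Definition smooth_compact f := smooth f /\ compact (fsupport f).

End smooth_functions.

Section wave_equation.
Context (R : realType) (n : nat).
Notation space := 'rV[R]_n.
Notation spacetime := (R * 'rV[R]_n)%type.
Notation mu := (lebesgue_rV R n).
Implicit Types (T : \bar R) (t s : R) (x y : space).
(* A function of time and space is given by its time slices. *)
Implicit Types u w : R -> space -> R.

(* The norm carried by 'rV[R]_n is the maximum norm. *)
Definition enorm x : R := Num.sqrt (\sum_i x ord0 i ^+ 2).

Definition dvec (i : 'I_n) : space := delta_mx ord0 i.

Definition Lp_norm (q : R) (f : space -> R) : \bar R :=
  ('N[mu]_q%:E[EFin \o f])%E.

Definition weak_partial (i : 'I_n) (f h : space -> R) :=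
  forall phi : space -> R, smooth_compact phi ->
  \int[mu]_x (f x * 'D_(dvec i) phi x) = - \int[mu]_x (h x * phi x).

(* f belongs to H^1(R^n) and has the weak gradient G. *)
Definition H1_gradient (f : space -> R) (G : 'I_n -> space -> R) :=
  f \in Lfun mu 2%:E /\
  forall i, G i \in Lfun mu 2%:E /\ weak_partial i f (G i).

Definition H1_norm (f : space -> R) (G : 'I_n -> space -> R) : \bar R :=
  ((Lp_norm 2 f ^+ 2 +
    \sum_(i < n) Lp_norm 2 (G i) ^+ 2) `^ 2^-1)%E.

(* [0, T) and (0, T), where T may be +oo *)
Definition time_co T : set R := [set t | 0 <= t /\ (t%:E < T)%E].
Definition time_oo T : set R := [set t | 0 < t /\ (t%:E < T)%E].

Definition continuous_Lp T (q : R) u :=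
  forall t, time_co T t ->
  u t \in Lfun mu q%:E /\
  Lp_norm q (u s \- u t) @[s --> within (time_co T) (nbhs t)] --> 0%E.

Definition continuous_H1 T u :=
  exists G : R -> 'I_n -> space -> R, forall t, time_co T t ->
  H1_gradient (u t) (G t) /\
  H1_norm (u s \- u t) (fun i => G s i \- G t i)
    @[s --> within (time_co T) (nbhs t)] --> 0%E.

(* u is in C^1([0, T), L^2(R^n)), with derivative w. *)
Definition C1_L2 T u w :=
  [/\ continuous_Lp T 2 u, continuous_Lp T 2 w &
      forall t, time_co T t ->
      Lp_norm 2 (fun x => (s - t)^-1 * (u s x - u t x) - w t x)
        @[s --> within (time_co T) t^'] --> 0%E].

(* Complement in [0, T) x R^n of the largest relatively open subset on which u
   vanishes; u(s, .) being an L^2 class, it vanishes almost everywhere. *)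
Definition ssupport T u : set spacetime :=
  [set z | time_co T z.1 /\ forall U, nbhs z U ->
    ~ (forall s, time_co T s -> {ae mu, forall y, U (s, y) -> u s y = 0})].

Definition light_cone : set spacetime := [set z | enorm z.2 <= z.1 + 1].

Definition test_function T (phi : spacetime -> R) :=
  smooth_compact phi /\ fsupport phi `<=` [set z | time_oo T z.1].

Definition dtt (phi : spacetime -> R) : spacetime -> R :=
  'D_(1, 0) ('D_(1, 0) phi).

Definition laplacian (phi : spacetime -> R) (z : spacetime) : R :=
  \sum_(i < n) 'D_(0, dvec i) ('D_(0, dvec i) phi) z.

(* Iterated integrals are used since u is only measurable slice by slice; for u
   continuous in time with values in L^2 and L^p, the inner integrals are
   continuous and compactly supported in t. *)
Definition weak_wave_equation (p : R) T u :=
  forall phi : spacetime -> R, test_function T phi ->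
  \int[lebesgue_measure]_(t in time_oo T)
    (\int[mu]_x (u t x * (dtt phi (t, x) - laplacian phi (t, x)))) =
  \int[lebesgue_measure]_(t in time_oo T)
    (\int[mu]_x (`|u t x| `^ p * phi (t, x))).

Definition solution (p : R) (f g : space -> R) (eps : R) T u :=
  [/\ (0 < T)%E,
      continuous_H1 T u,
      continuous_Lp T p u,
      ssupport T u `<=` light_cone &
      weak_wave_equation p T u] /\
  {ae mu, forall x, u 0 x = eps * f x} /\
  exists w, C1_L2 T u w /\ {ae mu, forall x, w 0 x = eps * g x}.

Definition lifespan (p : R) (f g : space -> R) (eps : R) : \bar R :=
  ereal_sup [set T | exists u, solution p f g eps T u].

End wave_equation.

(* Main.v *)
Require Import Defs.
From mathcomp Require Import all_boot all_order all_algebra.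
From mathcomp Require Import all_classical all_reals all_analysis.
From mathcomp Require Import measurable_realfun.
From mathcomp Require Import ring lra zify.
Set Implicit Arguments.
Unset Strict Implicit.
Unset Printing Implicit Defensive.
Import Order.TTheory GRing.Theory Num.Def Num.Theory.
Import numFieldNormedType.Exports.
Local Open Scope classical_set_scope.
Local Open Scope ring_scope.

(** The proof uses test functions built from explicit solutions of the linear
    wave equation. Put a = (n - 1)/2, tau = t + 2 and, for s >= 0,
    W_s(t, x) = ((t + 2 + s)^2 - |x|^2)^(- a). This function is positive near the
    cone |x| <= t + 1 that carries u, and a is the exponent for which it solves
    the wave equation ([dalembertian_cut_wavef]). Let psi be a nonnegative
    combination of such functions, and eta a function of time equal to 1 up to
    time r/2 and to 0 after time r. Testing the equation with eta psi leaves, on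
    the linear side, derivatives of eta and the initial data:

      int_0^r eta int |u|^p psi + eps int (g psi - f psi_t)(0, x) dx
        = int_{r/2}^r int u (eta'' psi + 2 eta' psi_t).

    The data terms are nonnegative because psi_t <= 0 and f, g, psi >= 0. With Hoelder's inequality
    in x and in t, the right-hand side is at most a factor depending on
    r times (int_{r/2}^r eta |u|_p^p)^(1/p), where |u|_p is the norm in L^p(R^n)
    ([weighted_inequality]). If the mass is measured with the weight tau^(- beta),
    beta = a - 1/p, the power of r disappears; this is the equation for p
    ([critical_exponent]).

    The inequality is used twice. For psi = W_0, the data term shows that the
    weighted mass of each dyadic interval [2^(k-1), 2^k] is at least c eps^p
    ([late_mass_lower_bound]). For the superposition
    psi = sum_(j <= k+1) 2^(j (a + 1/p)) W_{2^j} and r = 2^k, one has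
    psi >= c tau^(- beta) on the whole cone up to time r, so that the left-hand
    side controls the total mass B_k up to time r/2, while the right-hand side
    contains an integral of (tau - |x|)^(-1) over a ball, that is a factor k. The
    mass a_k of the k-th dyadic interval therefore satisfies
    B_k^p <= C k^(p-1) a_k ([dyadic_growth], [self_improvement]). Since
    B_(k+1) = B_k + a_k and a_k >= c eps^p, this is a discrete form of
    B' >= B^p / (C k^(p-1)), which cannot last beyond k = C eps^(- p (p - 1))
    ([discrete_blow_up]). As k is the logarithm of time, this is the bound on the
    lifespan.

    Two points need care. The weak equation admits only test functions supported
    in positive times, so the initial data are recovered from a thin layer after
    time 0, using that u is differentiable in time with values in L^2
    ([initial_slope], [time_inequality]). And W_s is singular on a light cone; it
    is modified away from the cone |x| <= t + 1 into a smooth function with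
    compact support in x ([reg_powN]). *)

(** * Calculus of functions of class C^k *)

Lemma is_derive_cast (R : realType) (V : normedModType R) (f : V -> R) z v
  (a b : R) : is_derive z v f a -> a = b -> is_derive z v f b.
Proof. by move=> ? <-. Qed.

Lemma is_derive_affine (R : realType) (c d x : R) :
  is_derive x (1 : R) (fun s : R => s * c + d) c.
Proof.
have h1 := @is_deriveZ _ _ _ id c x (1 : R) 1 (is_derive_id x 1).
have h2 := is_derive_cst d x (1 : R).
have h3 := is_deriveD h1 h2.
rewrite (_ : (fun s => _) = (c \*: id + cst d)%R).
  by apply: (is_derive_cast h3); rewrite addr0 [_ *: _]mulr1.
by apply/funext => s; rewrite mulrC.
Qed.

Section Ck_calculus.
Context (R : realType) (V : normedModType R).
Implicit Types (f g : V -> R) (k : nat).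

(** Reduces directional derivatives on a normed space to derivatives on the line,
    where the one-variable theorems apply. *)
Lemma is_derive1_line f z v (df : R) :
  is_derive z v f df <->
  is_derive (0 : R) (1 : R) (fun s : R => f (s *: v + z)) df.
Proof.
have E : 'D_v f z = 'D_1 (fun s : R => f (s *: v + z)) 0.
  rewrite /derive; set g1 := fun h => h^-1 *: _; set g2 := fun h => h^-1 *: _.
  suff -> : g1 = g2 by [].
  apply/funext => h; rewrite /g1 /g2 /=.
  by rewrite addr0 scale0r add0r [_%:A]mulr1.
split => -[fd <-].
  by split; [exact: (derivable1P f z v).1|rewrite E].
by split; [exact: (derivable1P f z v).2|rewrite E].
Qed.

Lemma is_derive_comp_real (F g : R -> R) (x df dg : R) :
  is_derive x (1 : R) F df -> is_derive (F x) (1 : R) g dg ->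
  is_derive x (1 : R) (g \o F) (dg * df).
Proof.
move=> [dF EF] [dG EG].
have hd : derivable (g \o F) x 1.
  apply/derivable1_diffP; apply: differentiable_comp; exact/derivable1_diffP.
have E := derive1_comp dF dG.
rewrite !derive1E in E.
split; first exact: hd.
by rewrite E EF EG.
Qed.

Lemma is_derive_comp1 f (g : R -> R) z v (df dg : R) :
  is_derive z v f df -> is_derive (f z) (1 : R) g dg ->
  is_derive z v (g \o f) (dg * df).
Proof.
move=> /is_derive1_line hf hg; apply/is_derive1_line.
have hg' : is_derive (f ((0 : R) *: v + z)) (1 : R) g dg.
  by rewrite scale0r add0r.
exact: (is_derive_comp_real hf hg').
Qed.

Lemma Ck0 f : continuous f -> Ck 0 f.
Proof. by move=> cf; exact: conj. Qed.

(** It suffices to exhibit the directional derivatives pointwise, without first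
    identifying the functions ['D_v f]. *)
Lemma CkS k f (cf : continuous f) :
  (forall v, exists df : V -> R, (forall x, is_derive x v f (df x)) /\ Ck k df) ->
  Ck k.+1 f.
Proof.
move=> H; split => // v; have [df [hdf kdf]] := H v; split.
  by move=> x; have [] := hdf x.
by rewrite (_ : 'D_v f = df)//; apply/funext => x; have [] := hdf x.
Qed.

Lemma Ck_cont k f : Ck k f -> continuous f.
Proof. by case: k => [|k] []. Qed.

Lemma Ck_pred k f : Ck k.+1 f -> Ck k f.
Proof.
elim: k f => [|k IH] f; first by case.
move=> [cf H]; split => // v; have [d c] := H v; split => //.
exact: IH.
Qed.

Lemma Ck_is_derive k f v x : Ck k.+1 f -> is_derive x v f ('D_v f x).
Proof. by move=> [_ /(_ v)[d _]]; exact: derivableP. Qed.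

Lemma Ck_derive k f v : Ck k.+1 f -> Ck k ('D_v f).
Proof. by move=> [_ /(_ v)[]]. Qed.

Lemma Ck_cst k (c : R) : Ck k (fun=> c : R) (V := V).
Proof.
elim: k c => [|k IH] c; first by apply: Ck0 => x; exact: cvg_cst.
apply: CkS => [x|v]; first exact: cvg_cst.
by exists (fun=> 0); split => // x; exact: is_derive_cst.
Qed.

Lemma Ck_add k f g : Ck k f -> Ck k g -> Ck k (fun x => f x + g x).
Proof.
elim: k f g => [|k IH] f g kf kg.
  apply: Ck0 => x; apply: continuousD; [exact: (Ck_cont kf)|exact: (Ck_cont kg)].
apply: CkS => [x|v].
  by apply: continuousD; [exact: (Ck_cont kf)|exact: (Ck_cont kg)].
exists (fun x => 'D_v f x + 'D_v g x); split.
  move=> x; have hf := Ck_is_derive v x kf; have hg := Ck_is_derive v x kg.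
  exact: is_deriveD.
by apply: IH; exact: Ck_derive.
Qed.

Lemma Ck_mul k f g : Ck k f -> Ck k g -> Ck k (fun x => f x * g x).
Proof.
elim: k f g => [|k IH] f g kf kg.
  apply: Ck0 => x; apply: continuousM; [exact: (Ck_cont kf)|exact: (Ck_cont kg)].
apply: CkS => [x|v].
  by apply: continuousM; [exact: (Ck_cont kf)|exact: (Ck_cont kg)].
exists (fun x => f x * 'D_v g x + g x * 'D_v f x); split.
  move=> x; have hf := Ck_is_derive v x kf; have hg := Ck_is_derive v x kg.
  exact: is_deriveM.
by apply: Ck_add; apply: IH; [exact: Ck_pred|exact: Ck_derive|
  exact: Ck_pred|exact: Ck_derive].
Qed.

Lemma Ck_sum k (I : Type) (r : seq I) (F : I -> V -> R) :
  (forall i, Ck k (F i)) -> Ck k (fun x => \sum_(i <- r) F i x).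
Proof.
move=> H; elim: r => [|i r IH].
  by under eq_fun do rewrite big_nil; exact: Ck_cst.
by under eq_fun do rewrite big_cons; exact: Ck_add.
Qed.

Lemma Ck_exp k m f : Ck k f -> Ck k (fun x => f x ^+ m).
Proof.
move=> kf; elim: m => [|m IH].
  by under eq_fun do rewrite expr0; exact: Ck_cst.
by under eq_fun do rewrite exprS; exact: Ck_mul.
Qed.

Lemma is_derive_lin (l : V -> R) x v :
  (forall s u w, l (s *: u + w) = s * l u + l w) -> is_derive x v l (l v).
Proof.
move=> hl; apply/is_derive1_line.
rewrite (_ : (fun s : R => l (s *: v + x)) = (fun s : R => s * l v + l x)).
  exact: is_derive_affine.
by apply/funext.
Qed.

Lemma Ck_lin k (l : V -> R) : continuous l ->
  (forall s u w, l (s *: u + w) = s * l u + l w) -> Ck k l.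
Proof.
move=> cl hl; case: k => [|k]; first exact: Ck0.
apply: CkS => // v; exists (fun=> l v); split; last exact: Ck_cst.
by move=> x; exact: is_derive_lin.
Qed.

End Ck_calculus.

Section Ck_composition.
Context (R : realType) (V : normedModType R).
Implicit Types (f : V -> R) (k : nat).

Lemma Ck_comp k f (g : R -> R) : Ck k g -> Ck k f -> Ck k (g \o f).
Proof.
elim: k f g => [|k IH] f g kg kf.
  by apply: Ck0 => x; apply: continuous_comp; [exact: (Ck_cont kf)|exact: (Ck_cont kg)].
apply: CkS => [x|v].
  by apply: continuous_comp; [exact: (Ck_cont kf)|exact: (Ck_cont kg)].
exists (fun x => ('D_1 g \o f) x * 'D_v f x); split.
  by move=> x; exact: (is_derive_comp1 (Ck_is_derive v x kf) (Ck_is_derive _ _ kg)).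
apply: Ck_mul; last exact: Ck_derive.
apply: IH; last exact: Ck_pred.
by case: kg => _ /(_ 1)[].
Qed.

Lemma Ck_powR k f c : (forall x, 0 < f x) -> Ck k f ->
  Ck k (fun x => f x `^ c).
Proof.
move=> f0.
have cp m c' : Ck m f -> continuous (fun x => f x `^ c').
  move=> kf x.
  have hg : {for f x, continuous (fun y : R => y `^ c')}.
    apply: differentiable_continuous; apply/derivable1_diffP.
    by have [] := is_derive1_powR c' (f0 x).
  exact: (@continuous_comp _ _ _ f (fun y : R => y `^ c') x (@Ck_cont _ _ _ _ kf x) hg).
elim: k c => [|k IH] c kf; first by apply: Ck0; exact: cp kf.
apply: CkS => [|v]; first exact: cp kf.
exists (fun x => (c * f x `^ (c - 1)) * 'D_v f x); split.
  move=> x; have hf := Ck_is_derive v x kf.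
  exact: (is_derive_comp1 hf (is_derive1_powR c (f0 x))).
apply: Ck_mul; last exact: Ck_derive.
apply: Ck_mul; first exact: Ck_cst.
apply: IH; exact: Ck_pred.
Qed.

End Ck_composition.

Section Ck_real.
Context (R : realType).
Implicit Types (f g : R -> R) (k : nat).

Lemma Ck1S k f (df : R -> R) : (forall x : R, is_derive x (1 : R) f (df x)) -> Ck k df -> Ck k.+1 f.
Proof.
move=> hdf kdf; apply: CkS => [x|v].
  by apply: differentiable_continuous; apply/derivable1_diffP; have [] := hdf x.
exists (fun x => v * df x); split; last by apply: Ck_mul => //; exact: Ck_cst.
move=> x; apply/is_derive1_line.
have hl := is_derive_affine v x 0.
have hx : is_derive (0 * v + x) (1 : R) f (df x) by rewrite mul0r add0r.
have := @is_derive_comp1 _ _ (fun s : R => s * v + x) f 0 1 v (df x) hl hx.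
by rewrite mulrC.
Qed.

Lemma Ck_id k : Ck k (fun x : R => x).
Proof.
case: k => [|k]; first by apply: Ck0 => x; exact: cvg_id.
by apply: (@Ck1S _ _ (fun=> 1)) => //; exact: Ck_cst.
Qed.

(** The family is closed under differentiation up to linear combinations and
    contains the function exp (-1/z), which is why all its members are smooth. *)
Definition flat_exp (j : nat) (z : R) : R :=
  if 0 < z then z^-1 ^+ j * expR (- z^-1) else 0.

Lemma flat_exp_ge0 j (z : R) : 0 <= flat_exp j z.
Proof.
rewrite /flat_exp; case: ltP => // z0.
by rewrite mulr_ge0 ?expR_ge0// exprn_ge0// invr_ge0 ltW.
Qed.

(** The exponential dominates every power of 1/z, here through its Taylor
    polynomial; this is what makes the derivative at 0 exist and vanish. *)
Lemma flat_exp_le j z : 0 <= z -> flat_exp j z <= (j.+1)`!%:R * z.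
Proof.
move=> z0; rewrite /flat_exp; case: ltP => [z1|_]; last by rewrite mulr_ge0.
rewrite -ler_pdivrMr// mulrAC -exprSr expRN.
rewrite ler_pdivrMr ?expR_gt0// -ler_pdivrMl ?ltr0n ?fact_gt0//.
apply: le_trans (@expR_ge1Dxn _ z^-1 j _); last by rewrite invr_ge0.
by rewrite mulrC lerDr.
Qed.

Lemma flat_expS_mulz j z : flat_exp j z = z * flat_exp j.+1 z.
Proof.
rewrite /flat_exp; case: ltP => z0; last by rewrite mulr0.
by rewrite exprS !mulrA divff ?mul1r// gt_eqF.
Qed.

Lemma is_derive_flat_exp j (z : R) :
  is_derive z (1 : R) (flat_exp j) (flat_exp j.+2 z - j%:R * flat_exp j.+1 z).
Proof.
have [z0|z0|->] := ltgtP z 0.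
- apply: (@near_eq_is_derive R R R (cst 0)).
    near=> y; rewrite /flat_exp ltNge.
    by rewrite (_ : y <= 0)//; apply: ltW; near: y; exact: lt_nbhsl.
  rewrite /flat_exp !ltNge (ltW z0)/= mulr0 subr0.
  exact: is_derive_cst.
- apply: (@near_eq_is_derive R R R (fun y : R => y^-1 ^+ j * expR (- y^-1))).
    by near=> y; rewrite /flat_exp (_ : 0 < y)//; near: y; exact: lt_nbhsr.
  have zn : z != 0 by rewrite gt_eqF.
  have hi : is_derive z 1 (fun y : R => y^-1) (- z^-1 ^+ 2).
    have hd : derivable (id : R -> R) z (1 : R) by exact: derivable_id.
    apply: DeriveDef; first exact: (derivableV zn hd).
    by rewrite (deriveV zn hd) derive_id [_ *: _]mulr1 exprVn.
  rewrite /flat_exp z0.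
  have he : is_derive z 1 (fun y : R => expR (- y^-1)) (expR (- z^-1) * - - z^-1 ^+ 2).
    exact: (@is_derive_comp1 _ _ (fun y : R => - y^-1) expR _ _ _ _
      (is_deriveN hi) (is_derive_expR _)).
  have hx := @is_deriveX _ _ _ j _ _ _ hi.
  have hm := is_deriveM hx he.
  rewrite exprfctE in hm; apply: (is_derive_cast hm).
  rewrite -![_ *: _]/(_ * _); case: j hx hm => [|j] hx hm.
    by rewrite /= ?mulr0n; ring.
  by rewrite /= !exprS -mulr_natr; ring.
- have F0 m : flat_exp m 0 = 0 by rewrite /flat_exp ltxx.
  rewrite !F0 mulr0 subr0.
  suff H : h^-1 *: ((flat_exp j \o shift 0) (h *: (1 : R)) - flat_exp j 0)
             @[h --> 0^'] --> (0:R).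
    by apply: DeriveDef; [apply/cvg_ex; exists 0|apply/cvg_lim].
  apply/cvgr0Pnorm_le => e e0.
  near=> h.
  have h0 : h != 0 by near: h; exact: nbhs_dnbhs_neq.
  rewrite F0 subr0 /= addr0 [_%:A]mulr1 flat_expS_mulz.
  rewrite [_ *: _]mulrA mulVf// mul1r ger0_norm ?flat_exp_ge0//.
  have [hp|hn] := lerP 0 h; last first.
    by rewrite /flat_exp ltNge (ltW hn)/= ltW.
  apply: (le_trans (flat_exp_le _ hp)).
  rewrite -ler_pdivlMl ?ltr0n ?fact_gt0//.
  apply: le_trans (ler_norm _) _.
  near: h; apply: dnbhs0_le.
  by rewrite mulr_gt0// invr_gt0 ltr0n fact_gt0.
Unshelve. all: by end_near. Qed.

Lemma Ck_flat_exp k j : Ck k (flat_exp j).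
Proof.
elim: k j => [|k IH] j.
  apply: Ck0 => z; apply: differentiable_continuous; apply/derivable1_diffP.
  by have [] := is_derive_flat_exp j z.
apply: (@Ck1S _ _ _ (is_derive_flat_exp j)).
apply: Ck_add => //.
rewrite (_ : (fun x => _) = (fun x => - j%:R * flat_exp j.+1 x)).
  by apply: Ck_mul => //; exact: Ck_cst.
by apply/funext => x; rewrite mulNr.
Qed.

End Ck_real.

Lemma continuous_bounded_on (R : realType) (V : topologicalType)
    (K : set V) (Q : V -> R) : compact K ->
  continuous Q -> exists2 C : R, 0 <= C & forall z, K z -> `|Q z| <= C.
Proof.
move=> cK cQ.
have cQK : compact (Q @` K).
  by apply: continuous_compact => //; exact: continuous_subspaceT.
have [M [_ HM]] := compact_bounded cQK.
exists (`|M| + 1) => [|z Kz]; first by rewrite addr_ge0.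
apply: (HM (`|M| + 1)); last by exists z.
by rewrite (le_lt_trans (ler_norm M))// ltrDl.
Qed.

(** * Smooth cutoffs and regularized powers *)

Section cutoff.
Context (R : realType).
Implicit Types (z : R) (k : nat).

Lemma flat_exp0_gt0 z : 0 < z -> 0 < flat_exp 0 z.
Proof. by move=> z0; rewrite /flat_exp z0 expr0 mul1r expR_gt0. Qed.

Lemma flat_exp0_le z y : z <= y -> flat_exp 0 z <= flat_exp 0 y.
Proof.
move=> zy; have [z0|z0] := ltP 0 z; last first.
  by rewrite {1}/flat_exp ltNge z0/= flat_exp_ge0.
have y0 := lt_le_trans z0 zy.
by rewrite /flat_exp z0 y0 !expr0 !mul1r ler_expR lerN2 lef_pV2.
Qed.

(** The flat function composed with itself: the inner quotient is at least 1 as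
    soon as [1 <= z], and this is where the outer function vanishes. *)
Definition cutoff z : R :=
  flat_exp 0 (1 - flat_exp 0 z / flat_exp 0 1) / flat_exp 0 1.

Lemma cutoff_ge0 z : 0 <= cutoff z.
Proof. by rewrite divr_ge0 ?flat_exp_ge0. Qed.

Lemma cutoff_le1 z : cutoff z <= 1.
Proof.
rewrite ler_pdivrMr ?flat_exp0_gt0// mul1r flat_exp0_le// lerBlDr lerDl.
by rewrite divr_ge0 ?flat_exp_ge0.
Qed.

Lemma cutoff1 z : z <= 0 -> cutoff z = 1.
Proof.
move=> z0; have fz : flat_exp 0 z = 0 by rewrite /flat_exp ltNge z0.
by rewrite /cutoff fz mul0r subr0 divff// gt_eqF ?flat_exp0_gt0.
Qed.

Lemma cutoff0 z : 1 <= z -> cutoff z = 0.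
Proof.
move=> z1; rewrite /cutoff [X in X / _](_ : _ = 0) ?mul0r//.
rewrite /flat_exp ltNge subr_le0 ler_pdivlMr ?flat_exp0_gt0// mul1r.
by rewrite flat_exp0_le.
Qed.

Lemma smooth_cutoff : smooth (cutoff : R -> R).
Proof.
move=> k; apply: Ck_mul; last exact: Ck_cst.
apply: (@Ck_comp _ _ _ (fun z => 1 - flat_exp 0 z / flat_exp 0 1) (flat_exp 0)).
  exact: Ck_flat_exp.
apply: Ck_add; first exact: Ck_cst.
rewrite (_ : (fun _ => _) = (fun z => flat_exp 0 z * (- (flat_exp 0 1)^-1))).
  by apply: Ck_mul; [exact: Ck_flat_exp|exact: Ck_cst].
by apply/funext => z; rewrite mulrN.
Qed.

(** A smooth positive function that is the identity on [1 <= z], so that its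
    real powers are smooth. *)
Definition pos_id z : R := z * (1 - cutoff z) + cutoff z.

Lemma pos_id_gt0 z : 0 < pos_id z.
Proof.
rewrite /pos_id; have [z0|z0] := lerP z 0; first by rewrite cutoff1// subrr mulr0 add0r.
have [c1|c1] := ltP (cutoff z) 1.
  apply: ltr_wpDr; first exact: cutoff_ge0.
  by rewrite mulr_gt0// subr_gt0.
apply: ltr_wpDl; last by rewrite (lt_le_trans ltr01).
by rewrite mulr_ge0 ?(ltW z0)// subr_ge0 cutoff_le1.
Qed.

(** The power [z `^ (- a)], modified on [z < 1]. Vanishing for [z <= 0] makes
    the wave functions below compactly supported in space at each time. *)
Definition reg_powN (a z : R) : R := (1 - cutoff z) * pos_id z `^ (- a).

Lemma smooth_reg_powN a : smooth (reg_powN a).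
Proof.
move=> k.
have Cs : Ck k (fun z => 1 - cutoff z).
  apply: Ck_add; first exact: Ck_cst.
  rewrite (_ : (fun _ => _) = (fun z => (-1) * cutoff z)).
    by apply: Ck_mul; [exact: Ck_cst|exact: smooth_cutoff].
  by apply/funext => z; rewrite mulN1r.
apply: Ck_mul => //; apply: Ck_powR; first exact: pos_id_gt0.
apply: Ck_add; last exact: smooth_cutoff.
by apply: Ck_mul => //; exact: Ck_id.
Qed.

Lemma reg_powN_ge0 a z : 0 <= reg_powN a z.
Proof. by rewrite mulr_ge0 ?powR_ge0// subr_ge0 cutoff_le1. Qed.

Lemma reg_powN0 a z : z <= 0 -> reg_powN a z = 0.
Proof. by move=> z0; rewrite /reg_powN cutoff1// subrr mul0r. Qed.

Lemma reg_powNE a z : 1 <= z -> reg_powN a z = z `^ (- a).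
Proof. by move=> z0; rewrite /reg_powN /pos_id cutoff0// subr0 mul1r mulr1 addr0. Qed.

Lemma derive_reg_powN a z : 1 < z ->
  'D_1 (reg_powN a) z = - a * z `^ (- a - 1).
Proof.
move=> z1.
have h : is_derive z (1 : R) (reg_powN a) (- a * z `^ (- a - 1)).
  apply: (@near_eq_is_derive R R R (fun y => y `^ (- a))).
    near=> y; rewrite reg_powNE//; apply: ltW; near: y; exact: lt_nbhsr.
  by apply: is_derive1_powR; rewrite (lt_trans ltr01).
by have [] := h.
Unshelve. all: by end_near. Qed.

Lemma derive2_reg_powN a z : 1 < z ->
  'D_1 ('D_1 (reg_powN a)) z = a * (a + 1) * z `^ (- a - 2).
Proof.
move=> z1.
have h : is_derive z (1 : R) ('D_1 (reg_powN a))
    (- a * ((- a - 1) * z `^ (- a - 1 - 1))).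
  apply: (@near_eq_is_derive R R R (fun y => - a * y `^ (- a - 1))).
    near=> y; rewrite derive_reg_powN//; near: y; exact: lt_nbhsr.
  apply: is_deriveZ; apply: is_derive1_powR; exact: lt_trans ltr01 z1.
have [_ ->] := h; rewrite (_ : - a - 1 - 1 = - a - 2); last by ring.
by ring.
Unshelve. all: by end_near. Qed.

End cutoff.

(** * Explicit solutions of the wave equation as test functions *)

Section wave_test_functions.
Context (R : realType) (n : nat).
Notation V := (R * 'rV[R]_n)%type.
Implicit Types (z v : V) (k : nat).

Lemma is_derive_fsum (U : normedModType R) (I : Type) (r : seq I)
    (F : I -> U -> R) (dF : I -> R) (z v : U) :
  (forall i, is_derive z v (F i) (dF i)) ->
  is_derive z v (fun x => \sum_(i <- r) F i x) (\sum_(i <- r) dF i).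
Proof.
move=> H; elim: r => [|i r IH].
  under eq_fun do rewrite big_nil.
  by rewrite big_nil; exact: is_derive_cst.
under eq_fun do rewrite big_cons.
by rewrite big_cons; exact: is_deriveD.
Qed.

Lemma is_derive_Mfun (U : normedModType R) (f g : U -> R) (z v : U)
    (df dg : R) : is_derive z v f df -> is_derive z v g dg ->
  is_derive z v (fun x => f x * g x) (f z * dg + g z * df).
Proof. exact: is_deriveM. Qed.

Lemma is_derive_Dfun (U : normedModType R) (f g : U -> R) (z v : U)
    (df dg : R) : is_derive z v f df -> is_derive z v g dg ->
  is_derive z v (fun x => f x + g x) (df + dg).
Proof. exact: is_deriveD. Qed.

Lemma is_derive_Zfun (U : normedModType R) (c : R) (f : U -> R) (z v : U)
    (df : R) : is_derive z v f df ->
  is_derive z v (fun x => c * f x) (c * df).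
Proof. exact: is_deriveZ. Qed.

Lemma is_derive_cstfun (U : normedModType R) (c : R) (z v : U) :
  is_derive z v (fun=> c) (0 : R).
Proof. exact: is_derive_cst. Qed.

Lemma is_derive_time z v : is_derive z v (fun z : V => z.1) v.1.
Proof. exact: is_derive_lin. Qed.

Lemma is_derive_coord i z v :
  is_derive z v (fun z : V => z.2 ord0 i) (v.2 ord0 i).
Proof. by apply: is_derive_lin => s u w /=; rewrite !mxE. Qed.

Lemma Ck_time k : Ck k (fun z : V => z.1).
Proof. by apply: Ck_lin => // z; exact: cvg_fst. Qed.

Lemma Ck_coord k i : Ck k (fun z : V => z.2 ord0 i).
Proof.
apply: Ck_lin => [z|s u w]; last by rewrite /= !mxE.
apply: (@continuous_comp _ _ _ snd (fun x : 'rV[R]_n => x ord0 i)).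
  exact: cvg_snd.
exact: coord_continuous.
Qed.

(** Squared Lorentzian distance to the point of time [- (2 + s)] on the time axis;
    the shift by 2 keeps it above 1 on the cone that carries the solution. *)
Definition sqdist (s : R) (z : V) : R :=
  (z.1 + 2 + s) ^+ 2 - \sum_i z.2 ord0 i ^+ 2.

Definition dsqdist (v : V) (s : R) (z : V) : R :=
  2 * (v.1 * (z.1 + 2 + s) - \sum_i v.2 ord0 i * z.2 ord0 i).

Definition ddsqdist (v : V) : R := 2 * (v.1 ^+ 2 - \sum_i v.2 ord0 i ^+ 2).

Lemma is_derive_sqdist s z v : is_derive z v (sqdist s) (dsqdist v s z).
Proof.
have h1 : is_derive z v (fun z => z.1 + (2 + s)) (v.1 + 0).
  exact: (is_derive_Dfun (is_derive_time z v) (is_derive_cstfun _ z v)).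
have h2 := is_derive_Mfun h1 h1.
have h3 : is_derive z v (fun z : V => \sum_i z.2 ord0 i * z.2 ord0 i)
    (\sum_i (z.2 ord0 i * v.2 ord0 i + z.2 ord0 i * v.2 ord0 i)).
  by apply: is_derive_fsum => i; exact: (is_derive_Mfun (is_derive_coord i z v) (is_derive_coord i z v)).
have h := is_derive_Dfun h2 (is_derive_Zfun (-1) h3).
rewrite (_ : sqdist s = (fun x : V => (x.1 + (2 + s)) * (x.1 + (2 + s)) +
    -1 * \sum_i x.2 ord0 i * x.2 ord0 i)).
  apply: (is_derive_cast h); rewrite /dsqdist.
  rewrite (eq_bigr (fun i => 2 * (v.2 ord0 i * z.2 ord0 i))) => [|i _]; last by ring.
  by rewrite -mulr_sumr; ring.
apply/funext => x; rewrite /sqdist.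
by under eq_bigr do rewrite expr2; ring.
Qed.

Lemma is_derive_dsqdist s z v : is_derive z v (dsqdist v s) (ddsqdist v).
Proof.
have h1 : is_derive z v (fun z => v.1 * (z.1 + (2 + s))) (v.1 * (v.1 + 0)).
  exact: (is_derive_Zfun _ (is_derive_Dfun (is_derive_time z v) (is_derive_cstfun _ z v))).
have h3 : is_derive z v (fun z : V => \sum_i v.2 ord0 i * z.2 ord0 i)
    (\sum_i v.2 ord0 i * v.2 ord0 i).
  by apply: is_derive_fsum => i; exact: (is_derive_Zfun _ (is_derive_coord i z v)).
have h := is_derive_Zfun 2 (is_derive_Dfun h1 (is_derive_Zfun (-1) h3)).
rewrite (_ : dsqdist v s = (fun x : V => 2 * (v.1 * (x.1 + (2 + s)) +
    -1 * \sum_i v.2 ord0 i * x.2 ord0 i))).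
  apply: (is_derive_cast h); rewrite /ddsqdist.
  by under [in RHS]eq_bigr do rewrite expr2; ring.
by apply/funext => x; rewrite /dsqdist; ring.
Qed.

Lemma Ck_sqdist k s : Ck k (sqdist s).
Proof.
rewrite (_ : sqdist s = (fun x : V => (x.1 + (2 + s)) ^+ 2 +
    -1 * \sum_i x.2 ord0 i ^+ 2)); last first.
  by apply/funext => x; rewrite /sqdist; ring.
apply: Ck_add.
  by apply: Ck_exp; apply: Ck_add; [exact: Ck_time|exact: Ck_cst].
apply: Ck_mul; first exact: Ck_cst.
by apply: Ck_sum => i; apply: Ck_exp; exact: Ck_coord.
Qed.

Context (a : R) (J : nat) (c s : nat -> R).
Let G : R -> R := reg_powN a.
Let G1 : R -> R := 'D_1 G.
Let G2 : R -> R := 'D_1 G1.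

(** Combination of time translates of ((t + 2)^2 - |x|^2) ^ (- a), regularized
    where the base is less than 1. *)
Definition wavef (z : V) : R := \sum_(j < J) c j * reg_powN a (sqdist (s j) z).

Definition wavef_t (z : V) : R :=
  \sum_(j < J) c j * ('D_1 (reg_powN a) (sqdist (s j) z) * (2 * (z.1 + 2 + s j))).

Let dwavef v z := \sum_(j < J) c j * (G1 (sqdist (s j) z) * dsqdist v (s j) z).
Let ddwavef v z := \sum_(j < J) c j *
  (G2 (sqdist (s j) z) * dsqdist v (s j) z ^+ 2 +
   G1 (sqdist (s j) z) * ddsqdist v).

Let sG : smooth G. Proof. exact: smooth_reg_powN. Qed.
Let sG1 : smooth G1. Proof. by move=> k; apply: Ck_derive. Qed.

Lemma is_derive_wavef z v : is_derive z v wavef (dwavef v z).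
Proof.
apply: is_derive_fsum => j; apply: is_derive_Zfun.
exact: (is_derive_comp1 (is_derive_sqdist _ _ _) (Ck_is_derive _ _ (sG 1))).
Qed.

Let is_derive_dwavef z v : is_derive z v (dwavef v) (ddwavef v z).
Proof.
apply: is_derive_fsum => j; apply: is_derive_Zfun.
have h := is_derive_comp1 (is_derive_sqdist (s j) z v) (Ck_is_derive (1 : R) _ (sG1 1)).
apply: (is_derive_cast (is_derive_Mfun h (is_derive_dsqdist (s j) z v))).
by rewrite /ddwavef /G2 /=; ring.
Qed.

Lemma Ck_wavef k : Ck k wavef.
Proof.
apply: Ck_sum => j; apply: Ck_mul; first exact: Ck_cst.
apply: (@Ck_comp _ _ _ (sqdist (s j)) G) => //; exact: Ck_sqdist.
Qed.

Lemma Ck_wavef_t k : Ck k wavef_t.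
Proof.
apply: Ck_sum => j; apply: Ck_mul; first exact: Ck_cst.
apply: Ck_mul; last first.
  apply: Ck_mul; first exact: Ck_cst.
  apply: Ck_add; last exact: Ck_cst.
  by apply: Ck_add; [exact: Ck_time|exact: Ck_cst].
apply: (@Ck_comp _ _ _ (sqdist (s j)) G1) => //; exact: Ck_sqdist.
Qed.

Lemma is_derive_wavef_time z : is_derive z (1, 0) wavef (wavef_t z).
Proof.
apply: (is_derive_cast (is_derive_wavef z (1, 0))).
apply: eq_bigr => j _; rewrite /dsqdist /=.
rewrite [X in _ - X]big1 => [|i _]; last by rewrite mxE mul0r.
by rewrite subr0 mul1r.
Qed.

Context (zeta : R -> R).
Hypothesis szeta : smooth zeta.

Let phi z := zeta z.1 * wavef z.

Let dphi v z := zeta z.1 * dwavef v z + wavef z * ('D_1 zeta z.1 * v.1).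

Let is_derive_phi z v : is_derive z v phi (dphi v z).
Proof.
have hz := is_derive_comp1 (is_derive_time z v) (Ck_is_derive (1 : R) _ (szeta 1)).
exact: (is_derive_Mfun hz (is_derive_wavef z v)).
Qed.

Let ddphi v z := 'D_1 ('D_1 zeta) z.1 * v.1 ^+ 2 * wavef z +
  2 * ('D_1 zeta z.1 * v.1 * dwavef v z) + zeta z.1 * ddwavef v z.

Let is_derive_dphi z v : is_derive z v (dphi v) (ddphi v z).
Proof.
have hz := is_derive_comp1 (is_derive_time z v) (Ck_is_derive (1 : R) _ (szeta 1)).
have szeta1 : Ck 1 ('D_1 zeta) by apply: Ck_derive; exact: szeta 2.
have hz1 := is_derive_comp1 (is_derive_time z v) (Ck_is_derive (1 : R) _ szeta1).
have h1 := is_derive_Mfun hz (is_derive_dwavef z v).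
have h2 := is_derive_Mfun (is_derive_wavef z v)
  (is_derive_Mfun hz1 (is_derive_cstfun v.1 z v)).
apply: (is_derive_cast (is_derive_Dfun h1 h2)).
by rewrite /ddphi /=; ring.
Qed.

Let derive2_phi z v : 'D_v ('D_v phi) z = ddphi v z.
Proof.
rewrite (_ : 'D_v phi = dphi v); first by have [] := is_derive_dphi z v.
by apply/funext => y; have [] := is_derive_phi y v.
Qed.

Lemma smooth_cut_wavef : smooth phi.
Proof.
move=> k; apply: Ck_mul; last exact: Ck_wavef.
by apply: (@Ck_comp _ _ _ (fun z : V => z.1) zeta) => //; exact: Ck_time.
Qed.

(** On a region where no regularization takes place, the d'Alembertian of the
    power [- a] of [sqdist] is a multiple of (2 a - n + 1), so that [wavef] solves
    the wave equation and only derivatives of the time factor survive. *)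
Lemma dalembertian_cut_wavef z : a = (n%:R - 1) / 2 ->
  (forall j : 'I_J, 1 < sqdist (s j) z) ->
  dtt phi z - laplacian phi z =
  'D_1 ('D_1 zeta) z.1 * wavef z + 2 * ('D_1 zeta z.1 * wavef_t z).
Proof.
move=> aE sig1.
have -> : dtt phi z = ddphi (1, 0) z by exact: (derive2_phi z (1, 0)).
have -> : laplacian phi z = \sum_i ddphi (0, dvec R i) z.
  by apply: eq_bigr => i _; exact: (derive2_phi z (0, dvec R i)).
have dE : dwavef (1, 0) z = wavef_t z.
  have [_ <-] := is_derive_wavef z (1, 0).
  by have [_ <-] := is_derive_wavef_time z.
suff H : zeta z.1 * ddwavef (1, 0) z = \sum_i ddphi (0, dvec R i) z.
  by rewrite -H /ddphi /= dE; ring.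
rewrite (eq_bigr (fun i => zeta z.1 * ddwavef (0, dvec R i) z)); last first.
  by move=> i _; rewrite /ddphi /= !(mulr0, mul0r, expr0n, add0r, addr0)/=.
rewrite -mulr_sumr; congr (_ * _).
rewrite /ddwavef exchange_big/=; apply: eq_bigr => j _.
rewrite -mulr_sumr; congr (_ * _).
have dE0 i : dsqdist (0, dvec R i) (s j) z = - 2 * z.2 ord0 i.
  rewrite /dsqdist /= mul0r sub0r (bigD1 i)//= big1 => [|k ki].
    by rewrite /dvec mxE !eqxx/= mul1r addr0; ring.
  by rewrite /dvec mxE eqxx/= (negbTE ki) mul0r.
have ddE0 i : ddsqdist (0, dvec R i) = - 2.
  rewrite /ddsqdist /= expr0n/= sub0r (bigD1 i)//= big1 => [|k ki].
    by rewrite /dvec mxE !eqxx/= expr1n addr0; ring.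
  by rewrite /dvec mxE eqxx/= (negbTE ki) expr0n.
have -> : dsqdist (1, 0) (s j) z = 2 * (z.1 + 2 + s j).
  rewrite /dsqdist /= [X in _ - X]big1 => [|i _]; last by rewrite mxE mul0r.
  by rewrite subr0 mul1r.
have -> : ddsqdist (1, 0) = 2.
  rewrite /ddsqdist /= [X in _ - X]big1 => [|i _].
    by rewrite subr0 expr1n mulr1.
  by rewrite mxE expr0n.
under eq_bigr do rewrite dE0 ddE0.
rewrite big_split/= -!mulr_sumr sumr_const card_ord.
under eq_bigr do rewrite exprMn.
rewrite -mulr_sumr.
have := sig1 j; set sg := sqdist (s j) z => sg1.
have sg0 : 0 < sg := lt_trans ltr01 sg1.
rewrite /G1 /G2 /G1 /G derive2_reg_powN// derive_reg_powN//.
have -> : sg `^ (- a - 1) = sg * sg `^ (- a - 2).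
  rewrite -[X in X * _]powRr1 ?ltW// -powRD; last by rewrite (gt_eqF sg0) implybT.
  by congr (_ `^ _); ring.
set S := (X in (- 2) ^+ 2 * X).
have -> : S = (z.1 + 2 + s j) ^+ 2 - sg.
  by rewrite /sg /sqdist opprB addrCA subrr addr0.
by rewrite -[- 2 *+ n]mulr_natr aE; field.
Qed.

(** The time factor bounds the support in time, and then the vanishing of the
    regularized powers on negative numbers bounds it in space. *)
Lemma test_function_cut_wavef (T : \bar R) (d r : R) :
  0 < d -> (r%:E < T)%E -> (forall j : 'I_J, 0 <= s j) ->
  (forall t, t < d -> zeta t = 0) -> (forall t, r < t -> zeta t = 0) ->
  test_function T phi.
Proof.
move=> d0 rT s0 zd zr.
(* a point where some summand is nonzero has |x| < t + 2 + s j *)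
pose M := `|r| + 2 + \sum_(j < J) s j.
pose K := `[d, r]%classic `*` [set x : 'rV[R]_n | forall i, `[- M, M]%classic (x ord0 i)].
have sK : [set z | phi z != 0] `<=` K.
  move=> [t x] /=; rewrite /phi mulf_eq0 negb_or /= => /andP[zt wt].
  have dt : d <= t by rewrite leNgt; apply/negP => /zd zt0; rewrite zt0 eqxx in zt.
  have tr : t <= r by rewrite leNgt; apply/negP => /zr zt0; rewrite zt0 eqxx in zt.
  split => /=; first by rewrite in_itv/= dt.
  move=> i; rewrite in_itv/= -ler_norml.
  have [j gj] : exists j : 'I_J, reg_powN a (sqdist (s j) (t, x)) != 0.
    apply/existsP; rewrite -negb_forall; apply: contra wt => /forallP H.
    by apply/eqP; apply: big1 => j _; move/eqP: (H j) => ->; rewrite mulr0.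
  have sg0 : 0 < sqdist (s j) (t, x).
    by rewrite ltNge; apply: contra gj => /(reg_powN0 a) ->.
  have t0 : 0 <= t + 2 + s j by have := s0 j; lra.
  have xt : `|x ord0 i| <= t + 2 + s j.
    rewrite -(@ler_pXn2r _ 2)// ?nnegrE// real_normK ?num_real//.
    move: sg0; rewrite /sqdist /= subr_gt0 => /ltW; apply: le_trans.
    by rewrite (bigD1 i)//= lerDl sumr_ge0// => k _; exact: sqr_ge0.
  apply: (le_trans xt); rewrite /M; apply: lerD.
    by rewrite lerD2r (le_trans tr)// ler_norm.
  by rewrite (bigD1 j)//= lerDl sumr_ge0.
have cK : compact K.
  apply: compact_setX; first exact: segment_compact.
  apply: (@rV_compact R n (fun=> `[- M, M]%classic)) => i.
  exact: segment_compact.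
have clK : closed K by apply: compact_closed => //; exact: norm_hausdorff.
have fK : fsupport phi `<=` K.
  by rewrite /fsupport [K](closure_id K).1//; exact: closure_subset.
split; first split.
- exact: smooth_cut_wavef.
- by apply: subclosed_compact fK => //; exact: closed_closure.
- move=> z /fK [/=]; rewrite in_itv/= => /andP[dz zr'] _.
  split; first exact: lt_le_trans dz.
  by apply: le_lt_trans rT; rewrite lee_fin.
Qed.

End wave_test_functions.

(** * Borel structure of the space and supports of the time slices *)

Section borel_rV.
Context (R : realType) (n : nat).
Notation mu := (lebesgue_rV R n).

Lemma measurable_box (A : 'I_n -> set (measurableTypeR R)) :
  (forall i, measurable (A i)) ->
  measurable [set x : 'rV[R]_n | forall i, A i (x ord0 i)].
Proof.
move=> mA; rewrite (_ : [set _ | _] =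
    \big[setI/setT]_(i < n) ((fun v : 'rV[R]_n => v ord0 i) @^-1` A i)).
  apply: bigsetI_measurable => i _; rewrite -[X in measurable X]setTI.
  exact: measurable_rV_coord.
rewrite -bigcap_seq; apply/seteqP; split => v /= Av i; first by move=> _; exact: Av.
by apply: Av; rewrite /= mem_index_enum.
Qed.

(** A countable base of the topology of product form: it serves both to compare
    open sets with the product sigma-algebra and as a Lindelof argument. *)
Definition rat_cube (i : 'rV[rat]_n * nat) : set 'rV[R]_n :=
  [set y | forall j, `|y ord0 j - ratr (i.1 ord0 j)| < i.2.+1%:R^-1].

Lemma measurable_rat_cube i : measurable (rat_cube i).
Proof.
rewrite /rat_cube; apply: (@measurable_box
  (fun j => [set r | `|r - ratr (i.1 ord0 j)| < i.2.+1%:R^-1])) => j.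
apply: open_measurable.
rewrite (_ : [set _ | _] = ball (ratr (i.1 ord0 j) : R) i.2.+1%:R^-1).
  exact: ball_open.
by apply/seteqP; split => r /=; rewrite -ball_normE /= distrC.
Qed.

Lemma rat_cube_basis (x : 'rV[R]_n) (U : set 'rV[R]_n) : nbhs x U ->
  exists i, rat_cube i x /\ rat_cube i `<=` U.
Proof.
move=> /nbhs_ballP[e /= e0 eU].
have [k ke] : exists k, k.+1%:R^-1 < e / 2.
  have [k] := @ltr_add_invr R 0 (e / 2) (divr_gt0 e0 (ltr0n _ 2)).
  by rewrite add0r; exists k.
have hq j : exists q : rat, `|x ord0 j - ratr q| < k.+1%:R^-1.
  have k0 : (0 : R) < k.+1%:R^-1 by rewrite invr_gt0.
  move: k0; set d := k.+1%:R^-1 => k0.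
  have [|q] := @rat_in_itvoo R (x ord0 j - d) (x ord0 j + d).
    by rewrite ltrBlDr -addrA ltrDl addr_gt0.
  rewrite in_itv/= => /andP[q1 q2]; exists q; rewrite ltr_norml.
  by apply/andP; split; move: q1 q2; set y := ratr q; lra.
pose q : 'rV[rat]_n := \row_j sval (cid (hq j)).
exists (q, k); split => /=.
  by move=> j /=; rewrite mxE; exact: (svalP (cid (hq j))).
move=> y /= hy; apply: eU; split => // i j.
have -> : i = ord0 by exact: ord1.
rewrite -ball_normE /=.
have := hy j; rewrite mxE; have := svalP (cid (hq j)) => /= h1 h2.
rewrite -(subrKA (ratr (sval (cid (hq j))))) (le_lt_trans (ler_normD _ _))//.
rewrite [X in _ + X]distrC [e]splitr.
by apply: ltrD; [exact: lt_trans h1 ke|exact: lt_trans h2 ke].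
Qed.

Lemma open_rV_measurable (U : set 'rV[R]_n) : open U -> measurable U.
Proof.
move=> oU; pose D := [set i | rat_cube i `<=` U].
rewrite (_ : U = \bigcup_i (if `[< D i >] then rat_cube i else set0)).
  apply: countable_bigcupT_measurable => [|i]; first exact: countableP.
  by case: ifP => // _; exact: measurable_rat_cube.
apply/seteqP; split => [x Ux|x [i _]].
  have [i [ix iU]] := rat_cube_basis (open_nbhs_nbhs (conj oU Ux)).
  by exists i => //; rewrite asboolT.
by case: asboolP => // Di; exact: Di.
Qed.

Lemma continuous_rV_measurable (f : 'rV[R]_n -> R) : continuous f ->
  measurable_fun setT (f : 'rV[R]_n -> measurableTypeR R).
Proof.
move=> /continuousP cf; apply: (measurability _ (RGenOpens.measurableE R)).
move=> _ [_ [a [b ->] <-]]; rewrite setTI.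
apply: open_rV_measurable; apply: cf; exact: interval_open.
Qed.

(** Countably many cubes cover [O], and each of them meets [N] in a null set. *)
Lemma negligible_locally (O N : set 'rV[R]_n) :
  (forall x, O x -> exists U, nbhs x U /\ mu.-negligible (U `&` N)) ->
  mu.-negligible (O `&` N).
Proof.
move=> H; pose D := [set i | mu.-negligible (rat_cube i `&` N)].
pose F k := if unpickle k is Some i then
  (if `[< D i >] then rat_cube i `&` N else set0) else set0.
apply: (@negligibleS _ _ _ _ (\bigcup_k F k)).
  move=> x [Ox Nx]; have [U [xU negU]] := H _ Ox.
  have [i [ix iU]] := rat_cube_basis xU.
  exists (pickle i) => //; rewrite /F pickleK asboolT//.
  by apply: negligibleS negU => y [iy Ny]; split => //; exact: iU.
apply: negligible_bigcup => k; rewrite /F.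
case: unpickle => [i|]; last exact: negligible_set0.
by case: asboolP => // _; exact: negligible_set0.
Qed.

End borel_rV.

Section light_cone_support.
Context (R : realType) (n : nat).
Notation mu := (lebesgue_rV R n).

(** The support condition on space-time sets gives a statement about each single
    time slice: every point outside the cone has a neighbourhood on whose slice
    [u t] vanishes almost everywhere, and these neighbourhoods are glued
    together by [negligible_locally]. *)
Lemma ssupport_slice (T : \bar R) (u : R -> 'rV[R]_n -> R) t :
  ssupport T u `<=` light_cone (R := R) (n := n) -> time_co T t ->
  {ae mu, forall x, t + 1 < enorm x -> u t x = 0}.
Proof.
move=> su tT.
pose O := [set x : 'rV[R]_n | t + 1 < enorm x].
pose N := [set x : 'rV[R]_n | u t x != 0].
suff : mu.-negligible (O `&` N).
  apply: negligibleS => x /= /not_implyP[Ox ux].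
  by split => //; apply/eqP.
apply: negligible_locally => x Ox.
have nx : ~ ssupport T u (t, x).
  by move=> /su; rewrite /light_cone /= leNgt Ox.
have [U [nU HU]] : exists U, nbhs (t, x) U /\
    forall s, time_co T s -> {ae mu, forall y, U (s, y) -> u s y = 0}.
  apply/not_existsP => H; apply: nx; split => // U nU HU.
  by apply: (H U).
exists [set y | U (t, y)]; split.
  case: nU => -[A B] /= [nA nB] AB.
  by apply: filterS nB => y By; apply: AB; split => //=; exact: nbhs_singleton.
apply: negligibleS (HU t tT) => y /= [Uy Ny] H.
by move/eqP: Ny; apply; exact: H.
Qed.

End light_cone_support.

(** * Scaling of Lebesgue measure *)

Section scaling.
Context (R : realType).

Lemma lebesgue_measure_scale (c : R) (A : set (measurableTypeR R)) : 0 < c ->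
  measurable A ->
  lebesgue_measure [set t : measurableTypeR R | A (c * t)] =
  (c^-1%:E * lebesgue_measure A)%E.
Proof.
move=> c0 mA.
have mc : measurable_fun setT (fun t : measurableTypeR R => c * t : measurableTypeR R).
  exact: mulrl_measurable.
have -> : lebesgue_measure A =
    pushforward (mscale (NngNum (ltW c0)) lebesgue_measure)
      (fun t : measurableTypeR R => c * t : measurableTypeR R) A.
  apply: lebesgue_measure_unique => //= _ [[a b]] _ <-.
  rewrite /mscale /pushforward /=.
  rewrite (_ : _ @^-1` _ = `](a / c), (b / c)]%classic); last first.
    apply/seteqP; split => t /=; rewrite !in_itv/=;
    by rewrite ltr_pdivrMr// ler_pdivlMr// [t * c]mulrC.
  rewrite !lebesgue_measure_itv/= !lte_fin ltr_pM2r ?invr_gt0//.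
  case: ifP => _; last by rewrite mule0.
  by rewrite -!EFinB -EFinM -mulrBl mulrC divfK// gt_eqF.
by rewrite /pushforward /mscale /= muleA -EFinM mulVf ?gt_eqF// mul1e.
Qed.

Lemma integral_scale (c : R) (F : measurableTypeR R -> \bar R) : 0 < c ->
  measurable_fun setT F -> (forall t, 0 <= F t)%E ->
  (\int[lebesgue_measure]_t F (c * t)%R =
  c^-1%:E * \int[lebesgue_measure]_t F t)%E.
Proof.
move=> c0 mF F0.
have mc : measurable_fun setT (fun t : measurableTypeR R => c * t : measurableTypeR R).
  exact: mulrl_measurable.
have ci0 : 0 <= c^-1 by rewrite invr_ge0 ltW.
rewrite -[X in _ = (X * _)%E]/((NngNum ci0)%:num%:E).
rewrite -ge0_integral_mscale//.
rewrite -(@ge0_integral_pushforward _ _ _ _ _ _ mc _ setT F)//.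
apply: eq_measure_integral => A mA _.
by rewrite /pushforward /= /mscale /= -lebesgue_measure_scale.
Qed.

(** Induction on the dimension: the slices of the dilated set are dilated slices,
    and the one-dimensional change of variables accounts for the last factor. *)
Lemma lebesgue_rV_scale n (c : R) (A : set 'rV[R]_n) : 0 < c -> measurable A ->
  lebesgue_rV R n [set x | A (c *: x)] = ((c ^- n)%:E * lebesgue_rV R n A)%E.
Proof.
move=> c0; elim: n A => [|n IH] A mA.
  rewrite expr0 invr1 mul1e; congr (_ _).
  by apply/seteqP; split => x /=; rewrite (_ : c *: x = x)//; apply/rowP => -[].
have mB : measurable (@rV_cons R n @^-1` A).
  by rewrite -[X in measurable X]setTI; exact: measurable_rV_cons.
rewrite /= /rV_product /pushforward /product_measure1.
set B := @rV_cons R n @^-1` A.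
have E t : lebesgue_rV R n (xsection (@rV_cons R n @^-1` [set x | A (c *: x)]) t) =
   ((c ^- n)%:E * lebesgue_rV R n (xsection B (c * t)%R))%E.
  rewrite -IH; last exact: measurable_xsection.
  congr (_ _); apply/seteqP.
  have cons_scale v : c *: rV_cons (t, v) = rV_cons (c * t, c *: v).
    by apply/rowP => i; rewrite !mxE; case: unliftP => [j _|_] /=; rewrite ?mxE.
  by split => v; rewrite /xsection /= !inE /B /= cons_scale.
under eq_integral => t _ do rewrite /= E.
have mX := @measurable_fun_xsection _ _ _ _ R (lebesgue_rV R n) _ mB.
rewrite ge0_integralZl//.
- rewrite (@integral_scale c (lebesgue_rV R n \o xsection B))//.
  by rewrite muleA -EFinM exprS invfM mulrC.
- by apply: (measurableT_comp mX); exact: mulrl_measurable.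
- by rewrite lee_fin invr_ge0 exprn_ge0 ?ltW.
Qed.

End scaling.

(** * Euclidean balls and integrals of powers of the distance to the cone *)

Section euclidean_balls.
Context (R : realType) (n : nat).
Notation mu := (lebesgue_rV R n).
Implicit Types x : 'rV[R]_n.

Lemma enorm_ge0 x : 0 <= enorm x.
Proof. exact: sqrtr_ge0. Qed.

Lemma sqr_enorm x : enorm x ^+ 2 = \sum_i x ord0 i ^+ 2.
Proof. by rewrite sqr_sqrtr// sumr_ge0// => i _; exact: sqr_ge0. Qed.

Lemma enorm_scale (c : R) x : 0 <= c -> enorm (c *: x) = c * enorm x.
Proof.
move=> c0; rewrite /enorm; under eq_bigr do rewrite mxE exprMn.
by rewrite -mulr_sumr sqrtrM ?sqr_ge0// sqrtr_sqr ger0_norm.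
Qed.

Lemma coord_le_enorm x i : `|x ord0 i| <= enorm x.
Proof.
rewrite -(@ler_pXn2r _ 2)// ?nnegrE ?enorm_ge0// real_normK ?num_real//.
rewrite sqr_enorm (bigD1 i)//= lerDl sumr_ge0// => k _; exact: sqr_ge0.
Qed.

Lemma continuous_enorm : continuous (@enorm R n).
Proof.
have c : continuous (fun x : 'rV[R]_n => \sum_i x ord0 i ^+ 2).
  apply: (@Ck_cont _ _ 0); apply: Ck_sum => i; apply: Ck_exp.
  by apply: Ck_lin => [|s u w]; [exact: coord_continuous|rewrite !mxE].
by move=> x; apply: continuous_comp; [exact: c|exact: sqrt_continuous].
Qed.

Definition eball (r : R) : set 'rV[R]_n := [set x | enorm x <= r].

Lemma measurable_enorm :
  measurable_fun setT (@enorm R n : 'rV[R]_n -> measurableTypeR R).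
Proof. by apply: continuous_rV_measurable; exact: continuous_enorm. Qed.

Lemma measurable_eball r : measurable (eball r).
Proof.
rewrite (_ : eball r = (@enorm R n) @^-1` `]-oo, r]%classic); last first.
  by apply/seteqP; split => x /=; rewrite in_itv.
rewrite -[X in measurable X]setTI; apply: measurable_enorm => //.
Qed.

Definition eball_vol : R := fine (mu (eball 1)).

Lemma mu_eball1 : mu (eball 1) = eball_vol%:E.
Proof.
rewrite fineK// ge0_fin_numE//.
pose A (i : 'I_n) : set (measurableTypeR R) := `[-1, 1]%classic.
have mA i : measurable (A i) by exact: measurable_itv.
apply: (@le_lt_trans _ _ (mu [set x | forall i, A i (x ord0 i)])).
  apply: le_measure; rewrite ?inE; [exact: measurable_eball|exact: measurable_box|].
  move=> x /= x1 i; rewrite /A /= in_itv/= -ler_norml.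
  exact: le_trans (coord_le_enorm x i) x1.
rewrite lebesgue_rV_box//.
suff : (\prod_(i < n) @lebesgue_measure R (A i))%E \is a fin_num.
  by rewrite ltey_eq => ->.
elim/big_ind : _ => // [a b|i _]; first exact: fin_numM.
by rewrite /A lebesgue_measure_itv/=; case: ifP.
Qed.

Lemma eball_vol_ge0 : 0 <= eball_vol.
Proof. by rewrite fine_ge0. Qed.

Lemma mu_eball r : 0 < r -> mu (eball r) = (r ^+ n * eball_vol)%:E.
Proof.
move=> r0; have ri : 0 < r^-1 by rewrite invr_gt0.
rewrite (_ : eball r = [set x | eball 1 (r^-1 *: x)]).
  by rewrite lebesgue_rV_scale ?mu_eball1//; [rewrite EFinM exprVn invrK|exact: measurable_eball].
apply/seteqP; split => x; rewrite /eball /= (enorm_scale _ (ltW ri)) mulrC.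
  by rewrite ler_pdivrMr// mul1r.
by rewrite ler_pdivrMr// mul1r.
Qed.

Lemma exprB_le m (b c : R) : 0 <= b <= c ->
  c ^+ m - b ^+ m <= m%:R * c ^+ m.-1 * (c - b).
Proof.
move=> /andP[b0 bc]; have c0 := le_trans b0 bc.
rewrite subrXX mulrC ler_wpM2r ?subr_ge0//.
case: m => [|m]; first by rewrite big_ord0 mul0r.
apply: (@le_trans _ _ (\sum_(i < m.+1) c ^+ m)); last first.
  by rewrite sumr_const card_ord mulr_natl.
apply: ler_sum => i _ /=.
have im : (i <= m)%N by rewrite -ltnS ltn_ord.
rewrite -[in leRHS](subnK im) exprD.
by rewrite ler_wpM2l ?exprn_ge0// lerXn2r.
Qed.

Lemma dyadic_bracket (y : R) : 1 <= y -> exists i : nat, 2 ^+ i <= y < 2 ^+ i.+1.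
Proof.
move=> y1; have [I yI] : exists I : nat, y < 2 ^+ I.
  exists (Num.bound y); apply: lt_trans (archi_boundP _) _; first by lra.
  by rewrite -natrX ltr_nat ltn_expl.
elim: I yI => [|I IH]; first by rewrite expr0 ltNge y1.
have [/IH //|yI yI1] := ltP y (2 ^+ I).
by exists I; rewrite yI.
Qed.

(** The part of the ball of radius [t + 1] within [h] of the boundary of the
    ball of radius [t + 2] *)
Definition eshell (t h : R) : set 'rV[R]_n :=
  [set x | enorm x <= t + 1 /\ t + 2 - h < enorm x].

Lemma eshellE t h : eshell t h = eball (t + 1) `\` eball (t + 2 - h).
Proof.
apply/seteqP; split => x /= [x1 x2]; split => //.
  by apply/negP; rewrite -ltNge.
by rewrite ltNge; apply/negP.
Qed.

Lemma measurable_eshell t h : measurable (eshell t h).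
Proof. by rewrite eshellE; apply: measurableD; exact: measurable_eball. Qed.

Lemma mu_eshell_le t h : 0 <= t -> 1 <= h ->
  (mu (eshell t h) <= (eball_vol * n.+1%:R * (t + 2) ^+ n.-1 * h)%:E)%E.
Proof.
move=> t0 h1; have V0 := eball_vol_ge0.
have t2 : 0 <= t + 2 by lra.
have [th|th] := ltP h (t + 2); last first.
  apply: (@le_trans _ _ (mu (eball (t + 1)))).
    apply: le_measure; rewrite ?inE; [exact: measurable_eshell|exact: measurable_eball|].
    by move=> x [].
  rewrite mu_eball; last by lra.
  rewrite lee_fin mulrC -!mulrA ler_wpM2l//.
  apply: (@le_trans _ _ ((t + 2) ^+ n)); first by rewrite lerXn2r ?nnegrE//; lra.
  rewrite -[leLHS]mul1r; apply: ler_pM => //; first by rewrite exprn_ge0.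
    by rewrite ler1n.
  case: (n) => [|m]; first by rewrite /= !expr0 mul1r.
  by rewrite /= exprS mulrC ler_wpM2l// exprn_ge0.
have hb : 0 < t + 2 - h by lra.
rewrite eshellE measureD; [|exact: measurable_eball|exact: measurable_eball|].
  rewrite setIidr; last by move=> x; rewrite /eball /= => ?; lra.
  rewrite [X in (X - _)%E](_ : _ = ((t + 1) ^+ n * eball_vol)%:E); last first.
    by apply: mu_eball; lra.
  rewrite [X in (_ - X)%E](_ : _ = ((t + 2 - h) ^+ n * eball_vol)%:E); last first.
    exact: mu_eball.
  rewrite -EFinB lee_fin -mulrBl mulrC -!mulrA ler_wpM2l//.
  apply: (@le_trans _ _ (n%:R * (t + 1) ^+ n.-1 * (t + 1 - (t + 2 - h)))).
    by apply: exprB_le; apply/andP; split; lra.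
  rewrite -mulrA; apply: ler_pM => //; first by rewrite mulr_ge0 ?exprn_ge0//; lra.
    by rewrite ler_nat.
  apply: ler_pM; [by rewrite exprn_ge0//; lra|by lra|..]; last by lra.
  by rewrite lerXn2r ?nnegrE//; lra.
by apply: (@le_lt_trans _ _ ((t + 1) ^+ n * eball_vol)%:E);
  [rewrite -mu_eball//; lra|exact: ltry].
Qed.

(** On the ball the distance t + 2 - |x| lies between 1 and [2 ^+ I], and this
    range is split dyadically: the shell where it is about [2 ^+ i] has measure of
    order (t + 2)^(n-1) 2^i. For q > 1 the resulting sum is bounded, and for
    q = 1 it equals [I]: this is the logarithm in the lifespan. *)
Lemma powR_dist_integral_le t q (I : nat) : 0 <= t -> 0 <= q ->
  t + 2 < 2 ^+ I ->
  (\int[mu]_(x in eball (t + 1)) ((t + 2 - enorm x) `^ (- q))%:E <=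
   (2 * eball_vol * n.+1%:R * (t + 2) ^+ n.-1 *
     \sum_(i < I) (2 `^ (1 - q)) ^+ i)%:E)%E.
Proof.
move=> t0 q0 tI; have V0 := eball_vol_ge0.
pose w (i : 'I_I) : R := (2 ^+ i) `^ (- q).
pose F (i : 'I_I) x := ((w i)%:E * (\1_(eshell t (2 ^+ i.+1)) x)%:E)%E.
have F0 i x : (0 <= F i x)%E by rewrite mule_ge0// lee_fin ?powR_ge0.
have mF i : measurable_fun setT (F i).
  apply: measurable_funeM; apply/measurable_EFinP.
  by apply: measurable_indic; exact: measurable_eshell.
have mpow : measurable_fun setT (fun x : 'rV[R]_n => ((t + 2 - enorm x) `^ (- q))%:E).
  apply/measurable_EFinP.
  apply: (@measurableT_comp _ _ _ _ _ _ (fun r : R => r `^ (- q))).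
    exact: measurable_powR.
  by apply: measurable_funB => //; exact: measurable_enorm.
apply: (@le_trans _ _ (\int[mu]_x \sum_(i < I) F i x)%E).
  rewrite integral_mkcond; apply: ge0_le_integral => //=.
  - by move=> x _; rewrite patchE; case: ifPn => // _; rewrite lee_fin powR_ge0.
  - apply/(measurable_restrictT _ (measurable_eball _)); exact: measurable_funTS.
  - exact: emeasurable_sum.
  move=> x _; rewrite patchE; case: ifPn => [|_]; last by apply: sume_ge0 => j _; exact: F0.
  rewrite inE /eball /= => xt.
  set y := t + 2 - enorm x; have y1 : 1 <= y by rewrite /y; lra.
  have yI : y < 2 ^+ I by apply: le_lt_trans tI; rewrite gerBl enorm_ge0.
  have [i /andP[yi yi1]] := dyadic_bracket y1.
  have iI : (i < I)%N.
    rewrite ltnNge; apply/negP => Ii; have := le_lt_trans yi yI.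
    by rewrite ltNge ler_weXn2l ?ler1n.
  rewrite (bigD1 (Ordinal iI))//= -[leLHS]adde0; apply: leeD; last by apply: sume_ge0 => j _; exact: F0.
  rewrite /F indicE mem_set ?mule1; last first.
    by split => //; move: yi1; rewrite /y; lra.
  have y0 : 0 < y by lra.
  have p0 : 0 < 2 ^+ i :> R by rewrite exprn_gt0.
  rewrite lee_fin /w !powRN lef_pV2 ?posrE ?powR_gt0//.
  by apply: ge0_ler_powR => //; rewrite nnegrE ?exprn_ge0//; lra.
rewrite ge0_integral_sum//.
rewrite mulr_sumr -sumEFin; apply: lee_sum => i _.
rewrite ge0_integralZl//=; last 2 first.
  apply/measurable_EFinP; by apply: measurable_indic; exact: measurable_eshell.
  by rewrite lee_fin powR_ge0.
rewrite integral_indic ?setIT//; last exact: measurable_eshell.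
apply: (@le_trans _ _ ((w i)%:E *
    (eball_vol * n.+1%:R * (t + 2) ^+ n.-1 * 2 ^+ i.+1)%:E)%E).
  apply: lee_wpmul2l; first by rewrite lee_fin powR_ge0.
  by apply: mu_eshell_le => //; rewrite exprn_ege1// ler1n.
rewrite -EFinM lee_fin /w le_eqVlt; apply/orP; left; apply/eqP.
have -> : (2 `^ (1 - q)) ^+ i = (2 ^+ i) `^ (- q) * 2 ^+ i :> R.
  rewrite -[LHS]powR_mulrn ?powR_ge0// -powRrM mulrC powRrM powR_mulrn//.
  rewrite powRD ?powRr1 ?exprn_ge0//; first by rewrite mulrC.
  by rewrite expf_eq0 pnatr_eq0 andbF implybT.
by rewrite exprS; ring.
Qed.

End euclidean_balls.

(** * Real-valued Lebesgue norms *)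

Section Lebesgue_norms.
Context d (X : measurableType d) (R : realType).
Variable mu : {measure set X -> \bar R}.
Implicit Types (f g h : X -> R) (q : R).

Definition lnorm q f : R := fine ('N[mu]_q%:E[EFin \o f])%E.

Lemma lnorm_ge0 q f : 0 <= lnorm q f.
Proof. by rewrite fine_ge0// Lnorm_ge0. Qed.

Lemma Lfun_measurable q f : f \in Lfun mu q%:E -> measurable_fun setT f.
Proof. by rewrite inE => /andP[/[!inE]]. Qed.

Lemma Lfun_LnormE q f : f \in Lfun mu q%:E ->
  'N[mu]_q%:E[EFin \o f]%E = (lnorm q f)%:E.
Proof.
move=> fq; rewrite fineK// ge0_fin_numE ?Lnorm_ge0//.
by move: fq; rewrite inE => /andP[_ /[!inE]].
Qed.

Lemma LfunI q f : measurable_fun setT f ->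
  ('N[mu]_q%:E[EFin \o f] < +oo)%E -> f \in Lfun mu q%:E.
Proof. by move=> mf fy; rewrite inE; apply/andP; split; rewrite inE. Qed.

Lemma lnorm_powRE q f : 0 < q -> f \in Lfun mu q%:E ->
  (\int[mu]_x (`|f x| `^ q)%:E)%E = (lnorm q f `^ q)%:E.
Proof.
move=> q0 fq; rewrite -poweR_EFin -Lfun_LnormE// powR_Lnorm ?gt_eqF//.
Qed.

(** Also proves membership in L^q, which a bound on the real-valued norm alone
    cannot. *)
Lemma lnorm_le_root q f (M : R) : 0 < q -> measurable_fun setT f -> 0 <= M ->
  (\int[mu]_x (`|f x| `^ q)%:E <= (M `^ q)%:E)%E ->
  f \in Lfun mu q%:E /\ lnorm q f <= M.
Proof.
move=> q0 mf M0 fM.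
have H : ('N[mu]_q%:E[EFin \o f] <= M%:E)%E.
  rewrite unlock; under eq_integral do rewrite abse_EFin poweR_EFin.
  have -> : M%:E = ((M `^ q)%:E `^ q^-1)%E.
    by rewrite poweR_EFin -powRrM divff ?gt_eqF// powRr1.
  apply: gt0_ler_poweR; rewrite ?invr_gt0 ?in_itv/= ?leey ?andbT//.
  - by rewrite invr_ge0 ltW.
  - by apply: integral_ge0 => x _; rewrite lee_fin powR_ge0.
  - by rewrite lee_fin powR_ge0.
have fL : f \in Lfun mu q%:E by apply: LfunI => //; exact: le_lt_trans H (ltry _).
by split => //; rewrite -lee_fin -Lfun_LnormE.
Qed.

Lemma lnorm_bounded q f (D : set X) (C v : R) : 1 <= q -> measurable_fun setT f ->
  measurable D -> mu D = v%:E -> 0 <= C ->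
  (forall x, D x -> `|f x| <= C) -> (forall x, ~ D x -> f x = 0) ->
  f \in Lfun mu q%:E /\ lnorm q f <= C * v `^ q^-1.
Proof.
move=> q1 mf mD Dv C0 fC f0.
have q0 : 0 < q := lt_le_trans ltr01 q1.
have v0 : 0 <= v by rewrite -lee_fin -Dv.
have If : (\int[mu]_x (`|f x| `^ q)%:E <= (C `^ q * v)%:E)%E.
  apply: (@le_trans _ _ (\int[mu]_x ((C `^ q)%:E * (\1_D x)%:E))%E).
    apply: ge0_le_integral => //=.
    - apply/measurable_EFinP; apply: (measurableT_comp (measurable_powR _)).
      exact: measurableT_comp.
    - apply: measurable_funeM; apply/measurable_EFinP; exact: measurable_indic.
    - move=> x _; rewrite indicE; case: (boolP (x \in D)) => xD /=.
      + rewrite inE in xD.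
        by rewrite mule1 lee_fin ge0_ler_powR ?nnegrE//; [exact: ltW|exact: fC].
      + rewrite notin_setE in xD.
        by rewrite f0// normr0 powR0 ?gt_eqF// mule0.
  rewrite ge0_integralZl//=.
  - by rewrite integral_indic ?setIT// Dv EFinM.
  - apply/measurable_EFinP; exact: measurable_indic.
  - by rewrite lee_fin powR_ge0.
apply: lnorm_le_root => //; first by rewrite mulr_ge0 ?powR_ge0.
by rewrite powRM ?powR_ge0// -powRrM mulVf ?gt_eqF// powRr1.
Qed.

(** The integrability that comes with the inequality is used to split the
    integrals of products. *)
Lemma hoelder_Rintegral q q' f g : 0 < q -> 0 < q' -> q^-1 + q'^-1 = 1 ->
  f \in Lfun mu q%:E -> g \in Lfun mu q'%:E ->
  mu.-integrable setT (EFin \o (fun x => f x * g x)) /\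
  `|\int[mu]_x (f x * g x)| <= lnorm q f * lnorm q' g.
Proof.
move=> q0 q'0 qq fq gq.
have mf := Lfun_measurable fq; have mg := Lfun_measurable gq.
have H := @hoelder _ _ _ mu f g q q' mf mg q0 q'0 qq.
rewrite (Lfun_LnormE fq) (Lfun_LnormE gq) Lnorm1 in H.
have I : mu.-integrable setT (EFin \o (fun x => f x * g x)).
  apply/integrableP; split; first by apply/measurable_EFinP; exact: measurable_funM.
  exact: le_lt_trans H (ltry _).
split => //.
have := le_normr_Rintegral measurableT I => /le_trans; apply.
rewrite -lee_fin EFinM; apply: le_trans H.
rewrite /Rintegral fineK//.
rewrite ge0_fin_numE; last by apply: integral_ge0.
by case/integrableP : I.
Qed.

Lemma lnormD_le q f g : 1 <= q -> f \in Lfun mu q%:E -> g \in Lfun mu q%:E ->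
  f \+ g \in Lfun mu q%:E /\ lnorm q (f \+ g) <= lnorm q f + lnorm q g.
Proof.
move=> q1 fq gq.
have mf := Lfun_measurable fq; have mg := Lfun_measurable gq.
have H := minkowski_EFin mu mf mg q1.
rewrite (Lfun_LnormE fq) (Lfun_LnormE gq) -EFinD in H.
have fL : f \+ g \in Lfun mu q%:E.
  apply: LfunI; first exact: measurable_funD.
  exact: le_lt_trans H (ltry _).
by split => //; rewrite -lee_fin -Lfun_LnormE.
Qed.

Lemma lnormN q f : lnorm q (fun x => - f x) = lnorm q f.
Proof. by rewrite /lnorm -[in RHS]oppe_Lnorm. Qed.

Lemma LfunN q f : f \in Lfun mu q%:E -> (fun x => - f x) \in Lfun mu q%:E.
Proof.
move=> fq; apply: LfunI; first exact: measurableT_comp (Lfun_measurable fq).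
rewrite (_ : EFin \o _ = (\- (EFin \o f))%E)// oppe_Lnorm Lfun_LnormE//.
exact: ltry.
Qed.

Lemma LfunB q f g : 1 <= q -> f \in Lfun mu q%:E -> g \in Lfun mu q%:E ->
  f \- g \in Lfun mu q%:E.
Proof. by move=> q1 fq gq; have [] := lnormD_le q1 fq (LfunN gq). Qed.

Lemma lnormB_dist q f g : 1 <= q -> f \in Lfun mu q%:E -> g \in Lfun mu q%:E ->
  `|lnorm q f - lnorm q g| <= lnorm q (f \- g).
Proof.
move=> q1 fq gq; have fgq := LfunB q1 fq gq; have gfq := LfunB q1 gq fq.
have [_ h1] := lnormD_le q1 fgq gq; have [_ h2] := lnormD_le q1 gfq fq.
rewrite (_ : (f \- g) \+ g = f) in h1; last by apply/funext => x /=; rewrite subrK.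
rewrite (_ : (g \- f) \+ f = g) in h2; last by apply/funext => x /=; rewrite subrK.
rewrite (_ : lnorm q (g \- f) = lnorm q (f \- g)) in h2; last first.
  by rewrite -lnormN; congr lnorm; apply/funext => x /=; rewrite opprB.
by rewrite ler_norml; apply/andP; split; lra.
Qed.

Lemma eq_Rintegral_ae f g : measurable_fun setT f -> measurable_fun setT g ->
  {ae mu, forall x, f x = g x} -> \int[mu]_x f x = \int[mu]_x g x.
Proof.
move=> mf mg fg; congr fine; apply: ae_eq_integral => //; try exact/measurable_EFinP.
by apply: filterS fg => x -> _.
Qed.

End Lebesgue_norms.

(** * Families of test functions that are Lipschitz in time *)

Section tame_functions.
Context (R : realType) (n : nat).
Notation V := (R * 'rV[R]_n)%type.

(** What the pairing with an L^2-continuous function of time requires of the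
    test function: at bounded times it is bounded, supported in a fixed ball,
    and Lipschitz in time, uniformly in space. *)
Definition tame (q : R -> 'rV[R]_n -> R) := forall r : R, exists C L rho : R,
  [/\ 0 <= C, 0 <= L, 0 < rho & forall s : R, 0 <= s <= r ->
    [/\ continuous (q s), forall x, `|q s x| <= C,
        forall x, rho < enorm x -> q s x = 0 &
        forall (s' : R) x, 0 <= s' <= r -> `|q s x - q s' x| <= L * `|s - s'|]].

Lemma is_derive_slice (Q : V -> R) (s : R) x (d : R) :
  is_derive ((s, x) : V) (1, 0) Q d ->
  is_derive s (1 : R) (fun t => Q (t, x)) d.
Proof.
move=> /is_derive1_line h.
have hs := is_derive_affine 1 (- s) s.
have h' : is_derive (s * 1 + - s) (1 : R) (fun h : R => Q (h *: (1, 0) + (s, x))) d.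
  by rewrite mulr1 subrr.
have := is_derive_comp_real hs h'; rewrite mulr1.
rewrite (_ : _ \o _ = (fun t => Q (t, x)))//; apply/funext => t /=; congr Q.
have -> : (t * 1 - s) *: ((1, 0) : V) = ((t * 1 - s) * 1, (t * 1 - s) *: 0) by [].
by rewrite scaler0; congr pair; rewrite /= ?add0r//; ring.
Qed.

Lemma tame_Ck (Q : V -> R) : Ck 1 Q ->
  (forall r : R, exists2 rho : R, 0 < rho & forall (s : R) x, 0 <= s <= r ->
    rho < enorm x -> Q (s, x) = 0) ->
  tame (fun s x => Q (s, x)).
Proof.
move=> kQ HQ r; have [rho rho0 HR] := HQ r.
pose K := `[0, r]%classic `*`
  [set x : 'rV[R]_n | forall i, `[- rho, rho]%classic (x ord0 i)].
have cK : compact K.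
  apply: compact_setX; first exact: segment_compact.
  apply: (@rV_compact R n (fun=> `[- rho, rho]%classic)) => i.
  exact: segment_compact.
have [C C0 HC] := continuous_bounded_on cK (Ck_cont kQ).
have [L L0 HL] := continuous_bounded_on cK (Ck_cont (Ck_derive ((1, 0) : V) kQ)).
have inK (s : R) x : 0 <= s <= r -> ~ rho < enorm x -> K (s, x).
  move=> sr /negP; rewrite -leNgt => xr; split => /=; first by rewrite in_itv.
  by move=> i; rewrite in_itv/= -ler_norml (le_trans (coord_le_enorm x i)).
exists C, L, rho; split => // s sr; split.
- move=> x.
  have c1 : {for x, continuous (fun y : 'rV[R]_n => (s, y) : V)}.
    move=> A [[B D] /= [sB xD] BD]; apply: filterS xD => y Dy; apply: BD.
    by split => //=; exact: nbhs_singleton.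
  exact: (@continuous_comp _ _ _ _ Q x c1 (@Ck_cont _ _ _ _ kQ (s, x))).
- move=> x; have [/(HR _ _ sr) ->|xr] := pselect (rho < enorm x).
    by rewrite normr0.
  exact: HC (inK _ _ sr xr).
- by move=> x; exact: HR.
- move=> s' x sr'.
  have [xr|xr] := pselect (rho < enorm x).
    by rewrite (HR _ _ sr xr) (HR _ _ sr' xr) subrr normr0 mulr_ge0.
  have hd (t : R) : is_derive t (1 : R) (fun t => Q (t, x)) ('D_(1, 0) Q (t, x)).
    exact: is_derive_slice (Ck_is_derive _ _ kQ).
  have lip (a b : R) : 0 <= a <= r -> 0 <= b <= r -> a <= b ->
      `|Q (b, x) - Q (a, x)| <= L * (b - a).
    move=> /andP[a0 ar] /andP[b0 br] ab.
    have [|c] := @MVT_segment R (fun t => Q (t, x))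
      (fun t => 'D_(1, 0) Q (t, x)) a b ab (fun t _ => hd t).
      apply: continuous_subspaceT => t.
      by apply: differentiable_continuous; apply/derivable1_diffP; have [] := hd t.
    rewrite in_itv/= => /andP[ac cb] ->.
    rewrite normrM [`|b - a|]ger0_norm ?subr_ge0// ler_wpM2r ?subr_ge0//.
    by apply: HL; apply: inK => //; rewrite (le_trans a0 ac) (le_trans cb br).
  have [ss'|s's] := leP s s'.
    have := lip s s' sr sr' ss'.
    by rewrite distrC [`|s - s'|]distrC [`|s' - s|]ger0_norm ?subr_ge0.
  have := lip s' s sr' sr (ltW s's).
  by rewrite [`|s - s'|]ger0_norm ?subr_ge0 ?(ltW s's).
Qed.

Section wavef_tame.
Context (a : R) (J : nat) (c s : nat -> R).
Hypothesis s0 : forall j : 'I_J, 0 <= s j.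

Lemma sqdist_lt0 r t (x : 'rV[R]_n) (j : 'I_J) : 0 <= t <= r ->
  `|r| + 3 + \sum_(j < J) s j < enorm x -> sqdist (s j) (t, x) < 0.
Proof.
move=> /andP[t0 tr] xr.
have tx : t + 2 + s j < enorm x.
  apply: le_lt_trans xr; apply: lerD.
    by have := le_trans tr (ler_norm r); lra.
  by rewrite (bigD1 j)//= lerDl sumr_ge0.
have ts : 0 <= t + 2 + s j by have := s0 j; lra.
rewrite /sqdist /= subr_lt0 -sqr_enorm.
by rewrite ltrXn2r// ?nnegrE ?enorm_ge0.
Qed.

Let rho_gt0 (r : R) : 0 < `|r| + 3 + \sum_(j < J) s j :> R.
Proof.
by rewrite ltr_wpDr ?sumr_ge0// ltr_wpDl.
Qed.

Lemma derive_reg_powN_lt0 (z : R) : z < 0 -> 'D_1 (reg_powN a) z = 0 :> R.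
Proof.
move=> z0; have h : is_derive z (1 : R) (reg_powN a) (0 : R).
  apply: (@near_eq_is_derive R R R (cst 0)).
  near=> y; rewrite reg_powN0//; apply: ltW; near: y; exact: lt_nbhsl.
by have [] := h.
Unshelve. all: by end_near. Qed.

Lemma tame_wavef : tame (fun t x => wavef a J c s (t, x)).
Proof.
apply: tame_Ck => [|r]; first exact: Ck_wavef.
exists (`|r| + 3 + \sum_(j < J) s j) => // t x tr xr.
apply: big1 => j _; rewrite reg_powN0 ?mulr0//.
exact: ltW (sqdist_lt0 _ tr xr).
Qed.

Lemma tame_wavef_t : tame (fun t x => wavef_t a J c s (t, x)).
Proof.
apply: tame_Ck => [|r]; first exact: Ck_wavef_t.
exists (`|r| + 3 + \sum_(j < J) s j) => // t x tr xr.
apply: big1 => j _; rewrite derive_reg_powN_lt0 ?mul0r ?mulr0//.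
exact: sqdist_lt0 tr xr.
Qed.

End wavef_tame.
End tame_functions.

(** * Pairings of the solution with test functions *)

Section solution_pairings.
Context (R : realType) (n : nat) (T : \bar R) (u : R -> 'rV[R]_n -> R).
Notation mu := (lebesgue_rV R n).
Implicit Types (t s r q : R).

Lemma lnormB_cvg q t : continuous_Lp T q u -> time_co T t ->
  lnorm mu q (u s \- u t) @[s --> within (time_co T) (nbhs t)] --> (0 : R).
Proof. by move=> cu /cu[_] /fine_cvgP[_]. Qed.

Lemma lnorm_cvg q t : 1 <= q -> continuous_Lp T q u -> time_co T t ->
  lnorm mu q (u s) @[s --> within (time_co T) (nbhs t)] --> lnorm mu q (u t).
Proof.
move=> q1 cu tT; apply/cvgrPdist_le => e e0.
have /cvgr0Pnorm_le /(_ e e0) H := lnormB_cvg cu tT.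
near=> s.
have sT : time_co T s by near: s; exact: withinT.
have h : `|lnorm mu q (u s \- u t)| <= e by near: s.
have [us _] := cu _ sT; have [ut _] := cu _ tT.
rewrite distrC (le_trans (lnormB_dist q1 us ut))//.
by rewrite (le_trans (ler_norm _)).
Unshelve. all: by end_near. Qed.

Lemma tame_Lfun (h : R -> 'rV[R]_n -> R) r s q : tame h -> 0 <= s <= r ->
  1 <= q -> h s \in Lfun mu q%:E.
Proof.
move=> /(_ r)[C [L [rho [C0 L0 rho0 H]]]] sr q1.
have [ch hC h0 _] := H s sr.
have [] // := @lnorm_bounded _ _ _ mu q (h s) (eball rho) C _ q1 _ _ (mu_eball n rho0) C0.
- exact: continuous_rV_measurable.
- exact: measurable_eball.
- by move=> x /negP; rewrite -ltNge => /h0.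
Qed.

Lemma inv2D : 2^-1 + 2^-1 = 1 :> R.
Proof. by rewrite [RHS]splitr !div1r. Qed.

Lemma pairing_integrable (h : R -> 'rV[R]_n -> R) t : continuous_Lp T 2 u ->
  tame h -> time_co T t ->
  mu.-integrable setT (EFin \o (fun x => u t x * h t x)).
Proof.
move=> cu th tT; have [ut _] := cu _ tT; have [t0 _] := tT.
have ht : h t \in Lfun mu 2%:E.
  by apply: (@tame_Lfun h t) => //; rewrite ?t0 ?lexx ?ler1n.
by have [] := hoelder_Rintegral (ltr0n _ 2) (ltr0n _ 2) inv2D ut ht.
Qed.

Lemma pairing_cvg (h : R -> 'rV[R]_n -> R) t : continuous_Lp T 2 u ->
  tame h -> time_co T t ->
  \int[mu]_x (u s x * h s x) @[s --> within (time_co T) (nbhs t)] -->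
  \int[mu]_x (u t x * h t x).
Proof.
move=> cu th tT; have [ut _] := cu _ tT; have [t0 _] := tT.
have [C [L [rho [C0 L0 rho0 H]]]] := th (t + 1).
pose v := (rho ^+ n * eball_vol R n) `^ 2^-1.
have t1 : 0 <= t <= t + 1 by rewrite t0/= lerDl.
pose g s := lnorm mu 2 (u s \- u t) * (C * v) +
  lnorm mu 2 (u t) * (L * `|s - t| * v).
have g0 : g s @[s --> within (time_co T) (nbhs t)] --> (0 : R).
  rewrite (_ : 0 = 0 * (C * v) + lnorm mu 2 (u t) * (L * `|t - t| * v)).
    apply: cvgD.
      by apply: cvgM; [exact: lnormB_cvg|exact: cvg_cst].
    apply: cvgM; first exact: cvg_cst.
    apply: cvgM; last exact: cvg_cst.
    apply: cvgM; first exact: cvg_cst.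
    apply: cvg_within_filter; apply: cvg_norm.
    by apply: cvgB; [exact: cvg_id|exact: cvg_cst].
  by rewrite subrr normr0 !(mul0r, mulr0) addr0.
apply/cvgrPdist_le => e e0.
have /cvgr0Pnorm_le /(_ e e0) {}g0 := g0.
near=> s.
have sT : time_co T s by near: s; exact: withinT.
have gs : `|g s| <= e by near: s.
have st : `|t - s| <= 1.
  near: s; apply: cvg_within => /=.
  by exists 1 => //= y; exact: ltW.
have [us _] := cu _ sT; have [s0 _] := sT.
have s1 : 0 <= s <= t + 1.
  by rewrite s0/=; move: st; rewrite ler_norml => /andP[? _]; lra.
have [chs hC h0 hL] := H s s1; have [cht _ ht0 _] := H t t1.
have hsL : h s \in Lfun mu 2%:E by apply: (tame_Lfun th s1); rewrite ler1n.
have htL : h t \in Lfun mu 2%:E by apply: (tame_Lfun th t1); rewrite ler1n.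
have [hs2 hsle] : h s \in Lfun mu 2%:E /\ lnorm mu 2 (h s) <= C * v.
  apply: (@lnorm_bounded _ _ _ mu 2 (h s) (eball rho) C _ _ _ _ (mu_eball n rho0)) => //.
  - by rewrite ler1n.
  - exact: continuous_rV_measurable.
  - exact: measurable_eball.
  - by move=> x /negP; rewrite -ltNge => /h0.
have [dh2 dhle] : h s \- h t \in Lfun mu 2%:E /\
    lnorm mu 2 (h s \- h t) <= L * `|s - t| * v.
  apply: (@lnorm_bounded _ _ _ mu 2 _ (eball rho) _ _ _ _ _ (mu_eball n rho0)) => //.
  - by rewrite ler1n.
  - by apply: measurable_funB; exact: continuous_rV_measurable.
  - exact: measurable_eball.
  - by rewrite mulr_ge0.
  - by move=> x _ /=; exact: hL.
  - by move=> x /negP; rewrite -ltNge => xr /=; rewrite h0// ht0// subrr.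
have usut : u s \- u t \in Lfun mu 2%:E by apply: LfunB => //; rewrite ler1n.
have [i1 b1] := hoelder_Rintegral (ltr0n _ 2) (ltr0n _ 2) inv2D usut hs2.
have [i2 b2] := hoelder_Rintegral (ltr0n _ 2) (ltr0n _ 2) inv2D ut dh2.
have [i3 _] := hoelder_Rintegral (ltr0n _ 2) (ltr0n _ 2) inv2D us hsL.
have [i4 _] := hoelder_Rintegral (ltr0n _ 2) (ltr0n _ 2) inv2D ut htL.
have -> : \int[mu]_x (u t x * h t x) - \int[mu]_x (u s x * h s x) =
    - (\int[mu]_x ((u s \- u t) x * h s x) + \int[mu]_x (u t x * (h s \- h t) x)).
  rewrite -RintegralD// -[LHS]opprB -RintegralB//; congr (- _).
  by apply: eq_Rintegral => x _ /=; ring.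
rewrite normrN (le_trans (ler_normD _ _))//.
apply: le_trans gs; apply: le_trans (ler_norm _).
by apply: lerD; [apply: (le_trans b1)|apply: (le_trans b2)];
  rewrite ler_wpM2l ?lnorm_ge0.
Unshelve. all: by end_near. Qed.

Lemma eq_Rintegral_slice (h k : 'rV[R]_n -> R) t :
  ssupport T u `<=` light_cone (R := R) (n := n) -> time_co T t ->
  u t \in Lfun mu 2%:E -> measurable_fun setT h -> measurable_fun setT k ->
  (forall x, enorm x <= t + 1 -> h x = k x) ->
  \int[mu]_x (u t x * h x) = \int[mu]_x (u t x * k x).
Proof.
move=> su tT ut mh mk hk; have mu_ := Lfun_measurable ut.
apply: eq_Rintegral_ae; [exact: measurable_funM|exact: measurable_funM|].
apply: filterS (ssupport_slice su tT) => x ux.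
by have [/hk ->//|/ux ->] := leP (enorm x) (t + 1); rewrite !mul0r.
Qed.

(** Hoelder's inequality on the ball of radius [t + 1], outside which [u t]
    vanishes; the test function decays like a power of the distance to the
    cone. *)
Lemma pairing_le p p' (h : 'rV[R]_n -> R) t (C g K : R) :
  1 < p -> 1 < p' -> p^-1 + p'^-1 = 1 ->
  ssupport T u `<=` light_cone (R := R) (n := n) -> time_co T t ->
  u t \in Lfun mu 2%:E -> u t \in Lfun mu p%:E ->
  measurable_fun setT h -> 0 <= C -> 0 <= K ->
  (forall x, enorm x <= t + 1 -> `|h x| <= C * (t + 2 - enorm x) `^ (- g)) ->
  (\int[mu]_(x in eball (t + 1)) ((t + 2 - enorm x) `^ (- (g * p')))%:E <=
    K%:E)%E ->
  `|\int[mu]_x (u t x * h x)| <= lnorm mu p (u t) * (C * K `^ p'^-1).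
Proof.
move=> p1 p'1 pp su tT ut2 utp mh C0 K0 hC IK.
have p'0 : 0 < p' by lra.
pose h1 x := h x * \1_(eball (t + 1)) x.
have mh1 : measurable_fun setT h1.
  by apply: measurable_funM => //; apply: measurable_indic; exact: measurable_eball.
rewrite (@eq_Rintegral_slice h h1)//; last first.
  by move=> x xt; rewrite /h1 indicE mem_set ?mulr1.
have mpow : measurable_fun setT (fun x : 'rV[R]_n => (t + 2 - enorm x) `^ (- (g * p'))).
  apply: (@measurableT_comp _ _ _ _ _ _ (fun r : R => r `^ (- (g * p')))).
    exact: measurable_powR.
  by apply: measurable_funB => //; exact: measurable_enorm.
have I : (\int[mu]_x (`|h1 x| `^ p')%:E <= (C `^ p' * K)%:E)%E.
  apply: (@le_trans _ _ (\int[mu]_(x in eball (t + 1))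
    ((C `^ p')%:E * ((t + 2 - enorm x) `^ (- (g * p')))%:E))%E).
    rewrite [leRHS]integral_mkcond; apply: ge0_le_integral => //=.
    - apply/measurable_EFinP; apply: (measurableT_comp (measurable_powR _)).
      exact: measurableT_comp.
    - apply/(measurable_restrictT _ (measurable_eball _)).
      apply: measurable_funTS; apply: measurable_funeM; exact/measurable_EFinP.
    - move=> x _; rewrite patchE /h1 indicE; case: ifPn => xt /=.
        rewrite inE in xt.
        rewrite mulr1 -EFinM lee_fin -mulNr powRrM -powRM ?powR_ge0//.
        apply: ge0_ler_powR; rewrite ?nnegrE ?mulr_ge0 ?powR_ge0//; first exact: ltW.
        exact: hC.
      by rewrite mulr0 normr0 powR0 ?gt_eqF.
  rewrite ge0_integralZl//=; last 4 first.
    - exact: measurable_eball.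
    - by apply: measurable_funTS; exact/measurable_EFinP.
    - by move=> x _; rewrite lee_fin powR_ge0.
    - by rewrite lee_fin powR_ge0.
  by rewrite EFinM; apply: lee_wpmul2l; rewrite ?lee_fin ?powR_ge0.
have [h1L h1le] : h1 \in Lfun mu p'%:E /\ lnorm mu p' h1 <= C * K `^ p'^-1.
  apply: lnorm_le_root => //; first by rewrite mulr_ge0 ?powR_ge0.
  by rewrite powRM ?powR_ge0// -powRrM mulVf ?gt_eqF// powRr1.
have [_ b] := hoelder_Rintegral (lt_trans ltr01 p1) p'0 pp utp h1L.
by apply: (le_trans b); rewrite ler_wpM2l ?lnorm_ge0.
Qed.

End solution_pairings.

(** * The weak equation tested with products of a function of time and a wave *)

Section integral_of_nonmeasurable.
Context d (X : measurableType d) (R : realType).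
Variable mu : {measure set X -> \bar R}.
Import HBNNSimple.

(** The integral of a nonnegative function is a supremum over simple functions
    below it, hence monotone without measurability. The spatial integral of
    |u|^p against the test function is a function of time for which
    measurability would require an argument of its own; comparison with a
    continuous upper bound avoids it. *)
Lemma ge0_le_integral_nonmeasurable (D : set X) (f g : X -> \bar R) :
  (forall x, D x -> (0 <= f x)%E) -> (forall x, D x -> (f x <= g x)%E) ->
  (\int[mu]_(x in D) f x <= \int[mu]_(x in D) g x)%E.
Proof.
move=> f0 fg; rewrite [leLHS]integral_mkcond [leRHS]integral_mkcond.
have f0' x : (0 <= (f \_ D) x)%E by rewrite patchE; case: ifPn => // /[!inE]; exact: f0.
have fg' x : ((f \_ D) x <= (g \_ D) x)%E.
  by rewrite !patchE; case: ifPn => // /[!inE]; exact: fg.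
have g0' x : (0 <= (g \_ D) x)%E by exact: le_trans (fg' x).
rewrite !ge0_integralTE//.
apply: ereal_sup_le => _ [h hf <-].
by exists h => // x; exact: le_trans (hf x) (fg' x).
Qed.

Lemma le_Rintegral_nonmeasurable (D : set X) (f g h : X -> R) :
  (forall x, D x -> 0 <= f x) -> (forall x, D x -> f x <= g x) ->
  (forall x, D x -> g x <= h x) -> measurable D ->
  mu.-integrable D (EFin \o h) ->
  \int[mu]_(x in D) f x <= \int[mu]_(x in D) g x.
Proof.
move=> f0 fg gh mD ih.
have fgi : (\int[mu]_(x in D) (f x)%:E <= \int[mu]_(x in D) (g x)%:E)%E.
  by apply: ge0_le_integral_nonmeasurable => x Dx; rewrite lee_fin; [exact: f0|exact: fg].
have ghi : (\int[mu]_(x in D) (g x)%:E <= \int[mu]_(x in D) (h x)%:E)%E.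
  apply: ge0_le_integral_nonmeasurable => x Dx; rewrite lee_fin; last exact: gh.
  exact: le_trans (f0 x Dx) (fg x Dx).
have hfin : (\int[mu]_(x in D) (h x)%:E < +oo)%E.
  by have /fin_numPlt/andP[] := integrable_fin_num mD ih.
have i0 : (0 <= \int[mu]_(x in D) (f x)%:E)%E.
  by apply: integral_ge0 => x Dx; rewrite lee_fin f0.
have gfin := le_lt_trans ghi hfin.
apply: fine_le => //; rewrite ge0_fin_numE//; first exact: le_lt_trans fgi gfin.
exact: le_trans i0 fgi.
Qed.

End integral_of_nonmeasurable.

Section weak_identity.
Context (R : realType) (n : nat) (T : \bar R) (u : R -> 'rV[R]_n -> R).
Notation mu := (lebesgue_rV R n).
Notation leb := (@lebesgue_measure R).
Context (p : R).
Hypotheses (p1 : 1 < p) (cu2 : continuous_Lp T 2 u) (cup : continuous_Lp T p u).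
Hypothesis su : ssupport T u `<=` light_cone (R := R) (n := n).
Hypothesis wu : weak_wave_equation p T u.
Context (a : R) (J : nat) (c s : nat -> R).
Hypotheses (aE : a = (n%:R - 1) / 2) (s0 : forall j : 'I_J, 0 <= s j).
Hypothesis c0 : forall j : 'I_J, 0 <= c j.

Definition psi (t : R) (x : 'rV[R]_n) := wavef a J c s (t, x) : R.
Definition psi_t (t : R) (x : 'rV[R]_n) := wavef_t a J c s (t, x) : R.

Let tpsi : tame psi. Proof. exact: tame_wavef. Qed.
Let tpsi_t : tame psi_t. Proof. exact: tame_wavef_t. Qed.

(** Factor the difference of squares: t + 2 + b + |x| >= t + 2 + b and
    t + 2 + b - |x| >= 1 on the cone. *)
Lemma sqdist_cone t (x : 'rV[R]_n) (b : R) : 0 <= b -> 0 <= t ->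
  enorm x <= t + 1 -> (t + 2 + b - enorm x) * (t + 2 + b) <= sqdist b (t, x) /\
  1 < sqdist b (t, x).
Proof.
move=> b0 t0 xt; rewrite /sqdist /= -sqr_enorm; have := enorm_ge0 x.
set e := enorm x in xt * => e0; split; nra.
Qed.

Lemma time_oo_co t : time_oo T t -> time_co T t.
Proof. by move=> [t0 tT]; split => //; exact: ltW. Qed.

Lemma tame_continuous (h : R -> 'rV[R]_n -> R) t : tame h -> 0 <= t ->
  continuous (h t).
Proof.
move=> /(_ t)[C [L [rho [_ _ _ H]]]] t0.
by have [] := H t; rewrite ?t0 ?lexx.
Qed.

Lemma tame_measurable (h : R -> 'rV[R]_n -> R) t : tame h -> 0 <= t ->
  measurable_fun setT (h t).
Proof. by move=> th t0; apply: continuous_rV_measurable; exact: tame_continuous. Qed.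

Lemma psi_ge0 t x : 0 <= psi t x.
Proof. by apply: sumr_ge0 => j _; rewrite mulr_ge0 ?c0 ?reg_powN_ge0. Qed.

Lemma mass_psi_integrable t : time_co T t ->
  mu.-integrable setT (EFin \o (fun x => `|u t x| `^ p * psi t x)).
Proof.
move=> tT; have [ut _] := cup tT; have [t0 _] := tT.
have [C [L [rho [C0 _ _ H]]]] := tpsi t.
have t1 : 0 <= t <= t by rewrite t0 lexx.
have [_ hC _ _] := H t t1.
have := Lfun_integrable (ltW p1) ut.
move=> /(integrableZl measurableT C); apply: le_integrable => //.
  apply/measurable_EFinP; apply: measurable_funM; last exact: tame_measurable.
  apply: (measurableT_comp (measurable_powR _)).
  by apply: measurableT_comp => //; exact: Lfun_measurable ut.
move=> x _ /=; rewrite lee_fin normrM mulrC normrM ler_pM//.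
exact: le_trans (hC x) (ler_norm C).
Qed.

(** By [dalembertian_cut_wavef] the test function [zeta] times [psi] leaves only
    derivatives of [zeta], on the cone and hence almost everywhere where [u]
    does not vanish. *)
Lemma weak_separated (zeta : R -> R) (b r : R) : smooth zeta -> 0 < b ->
  (r%:E < T)%E -> (forall t, t < b -> zeta t = 0) ->
  (forall t, r < t -> zeta t = 0) ->
  \int[leb]_(t in `[b, r])
    (\int[mu]_x (u t x *
      ('D_1 ('D_1 zeta) t * psi t x + 2 * ('D_1 zeta t * psi_t t x)))) =
  \int[leb]_(t in `[b, r]) (zeta t * \int[mu]_x (`|u t x| `^ p * psi t x)).
Proof.
move=> sz b0 rT zb zr.
pose phi (z : R * 'rV[R]_n) := zeta z.1 * wavef a J c s z.
have tphi : test_function T phi by exact: (@test_function_cut_wavef _ _ _ _ _ _ _ sz _ b r).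
pose F1 t := \int[mu]_x (u t x *
      ('D_1 ('D_1 zeta) t * psi t x + 2 * ('D_1 zeta t * psi_t t x))).
pose F2 t := zeta t * \int[mu]_x (`|u t x| `^ p * psi t x).
have E1 t : time_oo T t ->
  \int[mu]_x (u t x * (dtt phi (t, x) - laplacian phi (t, x))) = F1 t.
  move=> tT; have tT' := time_oo_co tT; have [ut _] := cu2 tT'; have [t0 _] := tT'.
  have sphi : smooth phi by exact: smooth_cut_wavef.
  have cD (v : R * 'rV[R]_n) :
      measurable_fun setT (fun x => 'D_v ('D_v phi) (t, x)).
    apply: continuous_rV_measurable => x.
    have c1 : {for x, continuous (fun y : 'rV[R]_n => (t, y) : R * 'rV[R]_n)}.
      move=> A [[B D] /= [sB xD] BD]; apply: filterS xD => y Dy; apply: BD.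
      by split => //=; exact: nbhs_singleton.
    have k0 : Ck 0 ('D_v ('D_v phi)).
      by apply: Ck_derive; apply: Ck_derive; exact: (sphi 2).
    exact: (@continuous_comp _ _ _ _ ('D_v ('D_v phi)) x c1 (@Ck_cont _ _ _ _ k0 (t, x))).
  apply: (eq_Rintegral_slice su tT' ut).
  - apply: measurable_funB; first exact: cD.
    by apply: measurable_sum => i; exact: cD.
  - apply: measurable_funD; apply: measurable_funM => //;
      last apply: measurable_funM => //; exact: tame_measurable.
  - move=> x xt; rewrite /phi dalembertian_cut_wavef// => j.
    by have [] := sqdist_cone (s0 j) t0 xt.
have E2 t : time_oo T t -> \int[mu]_x (`|u t x| `^ p * phi (t, x)) = F2 t.
  move=> tT; have tT' := time_oo_co tT.
  rewrite /F2 -RintegralZl//; last exact: mass_psi_integrable.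
  by apply: eq_Rintegral => x _; rewrite /phi /=; rewrite /psi; ring.
have z0 t : ~ `[b, r]%classic t -> zeta t = 0 /\
    'D_1 zeta t = 0 /\ 'D_1 ('D_1 zeta) t = 0.
  rewrite /= in_itv/= => /negP; rewrite negb_and -!ltNge => tbr.
  have nz : \forall t' \near t, cst 0 t' = zeta t'.
    case/orP: tbr => [tb|rt]; near=> t'; rewrite /=.
      by rewrite zb//; near: t'; exact: lt_nbhsl.
    by rewrite zr//; near: t'; exact: lt_nbhsr.
  have nD : \forall t' \near t, cst 0 t' = 'D_1 zeta t'.
    move/near_join: nz => nz; near=> t'.
    rewrite /=; rewrite -(@near_eq_derive _ _ _ (cst (0 : R)) zeta t' 1) ?derive_cst//.
    by near: t'.
  split; first by rewrite -(nbhs_singleton nz).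
  split; first by rewrite -(nbhs_singleton nD).
  by rewrite -(@near_eq_derive _ _ _ (cst (0 : R)) ('D_1 zeta) t 1) ?derive_cst.
have F10 t : ~ `[b, r]%classic t -> F1 t = 0.
  move=> /z0[_ [d1 d2]]; rewrite /F1 d1 d2.
  under eq_Rintegral do rewrite !mul0r mulr0 addr0 mulr0.
  by rewrite Rintegral_cst// mul0r.
have F20 t : ~ `[b, r]%classic t -> F2 t = 0.
  by move=> /z0[zt _]; rewrite /F2 zt mul0r.
have sub : `[b, r]%classic `<=` time_oo T.
  move=> t /=; rewrite in_itv/= => /andP[bt tr]; split; first exact: lt_le_trans bt.
  by apply: le_lt_trans rT; rewrite lee_fin.
have restr F : (forall t, ~ `[b, r]%classic t -> F t = 0) ->
    \int[leb]_(t in time_oo T) F t = \int[leb]_(t in `[b, r]) F t.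
  move=> F0; rewrite Rintegral_mkcond [RHS]Rintegral_mkcond.
  congr (Rintegral _ _ _); apply/funext => t; rewrite !patchE.
  have [bt|bt] := pselect (`[b, r]%classic t).
    by rewrite !mem_set//; exact: sub.
  by rewrite F0//; case: ifP; case: ifP.
rewrite -(restr F1 F10) -(restr F2 F20).
have e1 := eq_Rintegral leb (fun t tT => E1 t (set_mem tT)).
have e2 := eq_Rintegral leb (fun t tT => E2 t (set_mem tT)).
by rewrite -e1 -e2; exact: wu.
Unshelve. all: by end_near. Qed.

End weak_identity.

(** * Integrals on the real line and steps in time *)

Section real_line_integrals.
Context (R : realType).
Notation leb := (@lebesgue_measure R).
Implicit Types (f g F : R -> R) (a b x : R) (A : set R).

Lemma cc_integrable f a b : {within `[a, b], continuous f} ->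
  leb.-integrable `[a, b] (EFin \o f).
Proof. by apply: continuous_compact_integrable; exact: segment_compact. Qed.

Lemma within_continuousD A f g : {within A, continuous f} ->
  {within A, continuous g} -> {within A, continuous (fun t => f t + g t)}.
Proof.
move=> /subspace_continuousP cf /subspace_continuousP cg.
by apply/subspace_continuousP => t At; apply: cvgD; [exact: cf|exact: cg].
Qed.

Lemma within_continuousM A f g : {within A, continuous f} ->
  {within A, continuous g} -> {within A, continuous (fun t => f t * g t)}.
Proof.
move=> /subspace_continuousP cf /subspace_continuousP cg.
by apply/subspace_continuousP => t At; apply: cvgM; [exact: cf|exact: cg].
Qed.

Lemma within_continuousS A B f : A `<=` B -> {within B, continuous f} ->
  {within A, continuous f}.
Proof. by move=> AB; apply: continuous_subspaceW. Qed.

Lemma Rintegral_cc_split f a x b : a <= x <= b ->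
  leb.-integrable `[a, b] (EFin \o f) ->
  \int[leb]_(t in `[a, b]) f t =
  \int[leb]_(t in `[a, x]) f t + \int[leb]_(t in `[x, b]) f t.
Proof.
move=> /andP[ax xb] fi.
rewrite -(@Rintegral_itv_obnd_cbnd _ x (BRight b) f); last first.
  apply: integrableS fi => //; apply: subset_itv => //.
by rewrite -(@Rintegral_itvB _ f (BLeft a) (BRight b) x) ?bnd_simp// addrC subrK.
Qed.

Lemma Rintegral_FTC f F a b : a < b -> (forall x, is_derive x (1 : R) F (f x)) ->
  continuous f -> \int[leb]_(t in `[a, b]) f t = F b - F a.
Proof.
move=> ab dF cf.
have cF : continuous F.
  by move=> x; apply: differentiable_continuous; apply/derivable1_diffP; have [] := dF x.
rewrite /Rintegral (@continuous_FTC2 _ f F)//.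
- exact: continuous_subspaceT.
- split.
  + by move=> x _; have [] := dF x.
  + by apply: cvg_at_right_filter; exact: cF.
  + by apply: cvg_at_left_filter; exact: cF.
- by move=> x _; rewrite derive1E; have [] := dF x.
Qed.

Lemma Rintegral_cc_eq_sub f a x b : a <= x ->
  (forall t, a <= t < x -> f t = 0) ->
  \int[leb]_(t in `[a, b]) f t = \int[leb]_(t in `[x, b]) f t.
Proof.
move=> ax f0; rewrite Rintegral_mkcond [RHS]Rintegral_mkcond.
congr (Rintegral _ _ _); apply/funext => t; rewrite !patchE.
have [tx|tx] := ltP t x.
  rewrite [in RHS]memNset; last by rewrite /= in_itv/= leNgt tx.
  by case: ifPn => // /[!inE] /=; rewrite in_itv/= => /andP[at_ _]; rewrite f0 ?at_.
have E : (t \in `[a, b]%classic) = (t \in `[x, b]%classic).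
  by apply/idP/idP; rewrite !inE /= !in_itv/= => /andP[_ ->]; rewrite ?tx ?(le_trans ax tx).
by rewrite E.
Qed.

End real_line_integrals.

Section smooth_steps.
Context (R : realType).
Implicit Types (t d : R).

(** The derivatives are continuous and vanish outside the unit interval. *)
Lemma cutoff_derivative_bounds : exists M1 M2 : R, [/\ 0 <= M1, 0 <= M2,
  forall t, `|'D_1 (@cutoff R) t| <= M1 &
  forall t, `|'D_1 ('D_1 (@cutoff R)) t| <= M2].
Proof.
have s1 k : Ck k ('D_1 (@cutoff R)) by apply: Ck_derive; exact: smooth_cutoff.
have s2 k : Ck k ('D_1 ('D_1 (@cutoff R))) by apply: Ck_derive.
have cK : compact (`[0, 1]%classic : set R) by exact: segment_compact.
have bnd (f : R -> R) : continuous f -> (forall t, t < 0 -> f t = 0) ->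
    (forall t, 1 < t -> f t = 0) -> exists2 M, 0 <= M & forall t, `|f t| <= M.
  move=> cf f0 f1; have [M M0 HM] := continuous_bounded_on cK cf.
  exists M => // t.
  have [t0|t0] := ltP t 0; first by rewrite f0// normr0.
  have [t1|t1] := ltP 1 t; first by rewrite f1// normr0.
  by apply: HM; rewrite /= in_itv/= t0.
have d0 t : t < 0 -> 'D_1 (@cutoff R) t = 0.
  move=> t0; rewrite -(@near_eq_derive R R R (cst 1) (@cutoff R) t 1) ?derive_cst//.
  near=> y; rewrite /= cutoff1//; apply: ltW; near: y; exact: lt_nbhsl.
have d1 t : 1 < t -> 'D_1 (@cutoff R) t = 0.
  move=> t1; rewrite -(@near_eq_derive R R R (cst 0) (@cutoff R) t 1) ?derive_cst//.
  near=> y; rewrite /= cutoff0//; apply: ltW; near: y; exact: lt_nbhsr.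
have dd0 t : t < 0 -> 'D_1 ('D_1 (@cutoff R)) t = 0.
  move=> t0; rewrite -(@near_eq_derive R R R (cst 0) ('D_1 (@cutoff R)) t 1) ?derive_cst//.
  near=> y; rewrite /= d0//; near: y; exact: lt_nbhsl.
have dd1 t : 1 < t -> 'D_1 ('D_1 (@cutoff R)) t = 0.
  move=> t0; rewrite -(@near_eq_derive R R R (cst 0) ('D_1 (@cutoff R)) t 1) ?derive_cst//.
  near=> y; rewrite /= d1//; near: y; exact: lt_nbhsr.
have [M1 M10 H1] := bnd _ (Ck_cont (s1 0)) d0 d1.
have [M2 M20 H2] := bnd _ (Ck_cont (s2 0)) dd0 dd1.
by exists M1, M2.
Unshelve. all: by end_near. Qed.

(** Rises from 0 to 1 on the interval from [d] to [2 * d]; it keeps the test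
    functions away from the initial time. *)
Definition smooth_step d t : R := 1 - cutoff (t * d^-1 - 1).

Lemma is_derive_smooth_step d t : is_derive t (1 : R) (smooth_step d)
  (- (d^-1 * 'D_1 (@cutoff R) (t * d^-1 - 1))).
Proof.
have h := is_derive_comp_real (is_derive_affine d^-1 (- 1) t)
  (Ck_is_derive (1 : R) _ (@smooth_cutoff R 1)).
have h2 := is_derive_Dfun (is_derive_cstfun 1 t (1 : R)) (is_derive_Zfun (-1) h).
rewrite (_ : smooth_step d = (fun x => 1 + -1 * (@cutoff R \o (fun s => s * d^-1 + -1)) x)).
  by apply: (is_derive_cast h2); ring.
by apply/funext => x; rewrite /smooth_step /= mulN1r.
Qed.

Lemma is_derive2_smooth_step d t : is_derive t (1 : R)
  (fun t => - (d^-1 * 'D_1 (@cutoff R) (t * d^-1 - 1)))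
  (- (d^-1 ^+ 2 * 'D_1 ('D_1 (@cutoff R)) (t * d^-1 - 1))).
Proof.
have s1 : Ck 1 ('D_1 (@cutoff R)) by apply: Ck_derive; exact: (@smooth_cutoff R 2).
have h := is_derive_comp_real (is_derive_affine d^-1 (- 1) t)
  (Ck_is_derive (1 : R) _ s1).
have h2 := is_derive_Zfun (- d^-1) h.
rewrite (_ : (fun t => _) = (fun x => - d^-1 * ('D_1 (@cutoff R) \o (fun s => s * d^-1 + -1)) x)).
  by apply: (is_derive_cast h2); ring.
by apply/funext => x; rewrite /= mulNr.
Qed.

Lemma smooth_smooth_step d : smooth (smooth_step d).
Proof.
move=> k; rewrite (_ : smooth_step d =
  (fun x => 1 + -1 * (@cutoff R \o (fun s => s * d^-1 + -1)) x)); last first.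
  by apply/funext => x; rewrite /smooth_step /= mulN1r.
apply: Ck_add; first exact: Ck_cst.
apply: Ck_mul; first exact: Ck_cst.
apply: Ck_comp; first exact: smooth_cutoff.
apply: Ck_add; last exact: Ck_cst.
by apply: Ck_mul; [exact: Ck_id|exact: Ck_cst].
Qed.

Lemma smooth_step_le1 d t : smooth_step d t <= 1.
Proof. by rewrite gerBl cutoff_ge0. Qed.

Lemma smooth_step_ge0 d t : 0 <= smooth_step d t.
Proof. by rewrite subr_ge0 cutoff_le1. Qed.

Lemma smooth_step0 d t : 0 < d -> t <= d -> smooth_step d t = 0.
Proof.
by move=> d0 td; rewrite /smooth_step cutoff1 ?subrr// subr_le0 ler_pdivrMr// mul1r.
Qed.

Lemma smooth_step1 d t : 0 < d -> 2 * d <= t -> smooth_step d t = 1.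
Proof.
move=> d0 td; rewrite /smooth_step cutoff0 ?subr0// lerBrDr ler_pdivlMr//.
Qed.

End smooth_steps.

(** * First-order expansion of the pairings at the initial time *)

Section initial_slope.
Context (R : realType) (n : nat) (T : \bar R) (u w : R -> 'rV[R]_n -> R).
Notation mu := (lebesgue_rV R n).
Hypotheses (T0 : (0 < T)%E) (cuw : C1_L2 T u w).
Context (q qt : R -> 'rV[R]_n -> R).
Hypotheses (tq : tame q) (tqt : tame qt).
Hypothesis dq : forall (t : R) x, is_derive t (1 : R) (q ^~ x) (qt t x).

Lemma time_expansion (L t : R) x : 0 <= t ->
  (forall s, 0 <= s <= t -> `|qt s x - qt 0 x| <= L * s) ->
  0 <= L -> `|q t x - q 0 x - t * qt 0 x| <= L * t ^+ 2.
Proof.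
move=> t0 HL L0.
have [|c] := @MVT_segment R (q ^~ x) (qt ^~ x) 0 t t0 (fun s _ => dq s x).
  apply: continuous_subspaceT => s.
  by apply: differentiable_continuous; apply/derivable1_diffP; have [] := dq s x.
rewrite in_itv/= => /andP[c0 ct] ->; rewrite subr0.
rewrite (_ : _ - _ = (qt c x - qt 0 x) * t); last by ring.
rewrite normrM [`|t|]ger0_norm// expr2 mulrA ler_wpM2r//.
by apply: le_trans (HL c _) _; rewrite ?c0// ler_wpM2l.
Qed.

(** Expand both factors of the pairing at time 0. With z the error of the
    difference quotient of [u], which tends to 0 in L^2, the remainder is t times
    the integral of z q, plus t times that of w(0) (q(t) - q(0)), plus the
    integral of u(0) against the second-order remainder of q; all are o(t). *)
Lemma initial_slope (kappa : R) : 0 < kappa -> exists2 d0 : R, 0 < d0 &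
  forall t, time_co T t -> 0 < t < d0 ->
  `|\int[mu]_x (u t x * q t x) - \int[mu]_x (u 0 x * q 0 x) -
     t * (\int[mu]_x (w 0 x * q 0 x) + \int[mu]_x (u 0 x * qt 0 x))| <= kappa * t.
Proof.
move=> k0; have [cu cw dw] := cuw.
have T00 : time_co T 0 by split.
have [C [L [rho [C0 L0 rho0 H]]]] := tq 1.
have [C' [L' [rho' [C'0 L'0 rho'0 H']]]] := tqt 1.
pose rr := rho + rho'; have rr0 : 0 < rr by rewrite addr_gt0.
pose v := (rr ^+ n * eball_vol R n) `^ 2^-1.
have v0 : 0 <= v by exact: powR_ge0.
have muB := mu_eball n rr0.
have mB : measurable (eball (n := n) rr) by exact: measurable_eball.
pose z t x := (t - 0)^-1 * (u t x - u 0 x) - w 0 x.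
pose g t := lnorm mu 2 (z t) * (C * v) +
  t * ((lnorm mu 2 (w 0) * L + lnorm mu 2 (u 0) * L') * v).
have g0 : g t @[t --> within (time_co T) 0^'] --> (0 : R).
  have e0 : 0 * (C * v) +
      0 * ((lnorm mu 2 (w 0) * L + lnorm mu 2 (u 0) * L') * v) = 0 :> R.
    by rewrite !mul0r addr0.
  rewrite -[X in _ --> X]e0; apply: cvgD; apply: cvgM; try exact: cvg_cst.
    by have /fine_cvgP[_ h] := dw 0 T00; exact: h.
  apply: cvg_within_filter; apply: cvg_within_filter; exact: cvg_id.
have /cvgr0Pnorm_le /(_ kappa k0) := g0.
rewrite near_withinE near_withinE => /nbhs_ballP[e /= e0 He].
exists (Num.min e 1); first by rewrite lt_min e0 ltr01.
move=> t tT /andP[t0]; rewrite lt_min => /andP[te t1].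
have gt : g t <= kappa.
  apply: le_trans (ler_norm _) _; apply: He => //.
    by rewrite -ball_normE /= sub0r normrN gtr0_norm.
  by rewrite gt_eqF.
have t01 : 0 <= t <= 1 by rewrite !ltW.
have z01 : (0 : R) <= 0 <= (1 : R) by rewrite lexx ler01.
have [ct qC q0 qL] := H t t01; have [c0t _ q00 _] := H 0 z01.
have [ct' qC' q0' qL'] := H' t t01; have [c0t' _ q00' _] := H' 0 z01.
have out rho1 (x : 'rV[R]_n) : rho1 <= rr -> ~ eball rr x -> rho1 < enorm x.
  by move=> r1 /negP; rewrite -ltNge; exact: le_lt_trans.
have rr1 : rho <= rr by rewrite lerDl ltW.
have rr2 : rho' <= rr by rewrite lerDr ltW.
have mq s : 0 <= s -> measurable_fun setT (q s) by exact: tame_measurable.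
have mqt s : 0 <= s -> measurable_fun setT (qt s) by exact: tame_measurable.
have [qt2 qtle] : q t \in Lfun mu 2%:E /\ lnorm mu 2 (q t) <= C * v.
  apply: (@lnorm_bounded _ _ _ mu 2 (q t) (eball rr) C _ _ _ _ muB) => //.
  - by rewrite ler1n.
  - by apply: mq; exact: ltW.
  - by move=> x /(out _ _ rr1) /q0.
pose d1 := q t \- q 0.
have [d12 d1le] : d1 \in Lfun mu 2%:E /\ lnorm mu 2 d1 <= L * t * v.
  apply: (@lnorm_bounded _ _ _ mu 2 _ (eball rr) _ _ _ _ _ muB) => //.
  - by rewrite ler1n.
  - by apply: measurable_funB; apply: mq => //; exact: ltW.
  - by rewrite mulr_ge0// ltW.
  - move=> x _ /=; have := qL 0 x z01; rewrite subr0 [`|t|]gtr0_norm//.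
  - by move=> x /(out _ _ rr1) xr; rewrite /d1 /= q0// q00// subrr.
pose d2 x := q t x - q 0 x - t * qt 0 x.
have [d22 d2le] : d2 \in Lfun mu 2%:E /\ lnorm mu 2 d2 <= L' * t ^+ 2 * v.
  apply: (@lnorm_bounded _ _ _ mu 2 _ (eball rr) _ _ _ _ _ muB) => //.
  - by rewrite ler1n.
  - apply: measurable_funB.
      by apply: measurable_funB; apply: mq => //; exact: ltW.
    by apply: measurable_funM => //; exact: mqt.
  - by rewrite mulr_ge0// exprn_ge0// ltW.
  - move=> x _; apply: time_expansion => //; first exact: ltW.
    move=> s /andP[s0 st]; have s1 : 0 <= s <= 1 by rewrite s0 (le_trans st (ltW t1)).
    have [_ _ _ HL'] := H' s s1.
    by have := HL' 0 x z01; rewrite subr0 [`|s|]ger0_norm.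
  - move=> x xr; have x1 := out _ _ rr1 xr; have x2 := out _ _ rr2 xr.
    by rewrite /d2 q0// q00// q00'// subrr mulr0 subr0.
have [ut _] := cu _ tT; have [u0 _] := cu _ T00; have [w0 _] := cw _ T00.
have one2 : 1 <= 2 :> R by rewrite ler1n.
have z2 : z t \in Lfun mu 2%:E.
  apply: (LfunB one2 _ w0).
  have := Lfun_scale (t - 0)^-1 one2 (LfunB one2 ut u0).
  rewrite (_ : (_ \o* _)%R = (fun x => (t - 0)^-1 * (u t x - u 0 x)))//.
  by apply/funext => x /=; rewrite mulrC.
have q02 : q 0 \in Lfun mu 2%:E by apply: (tame_Lfun tq z01).
have qt02 : qt 0 \in Lfun mu 2%:E by apply: (tame_Lfun tqt z01).
have HR := hoelder_Rintegral (ltr0n R 2) (ltr0n R 2) (@inv2D R).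
have [i1 b1] := HR _ _ _ _ _ z2 qt2.
have [i2 b2] := HR _ _ _ _ _ w0 d12.
have [i3 b3] := HR _ _ _ _ _ u0 d22.
have [j1 _] := HR _ _ _ _ _ ut qt2.
have [j2 _] := HR _ _ _ _ _ u0 q02.
have [j3 _] := HR _ _ _ _ _ w0 q02.
have [j4 _] := HR _ _ _ _ _ u0 qt02.
have E : \int[mu]_x (u t x * q t x) - \int[mu]_x (u 0 x * q 0 x) -
     t * (\int[mu]_x (w 0 x * q 0 x) + \int[mu]_x (u 0 x * qt 0 x)) =
   t * \int[mu]_x (z t x * q t x) + t * \int[mu]_x (w 0 x * d1 x) +
   \int[mu]_x (u 0 x * d2 x).
  rewrite -(RintegralD _ j3 j4)// -(RintegralB _ j1 j2)// -!RintegralZl//; last first.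
    exact: (integrableD measurableT j3 j4).
  have k1 := integrableB measurableT j1 j2.
  have k2 := integrableZl measurableT t (integrableD measurableT j3 j4).
  have k3 := integrableZl measurableT t i1.
  have k4 := integrableZl measurableT t i2.
  rewrite -(RintegralB _ k1 k2)// -(RintegralD _ k3 k4)//.
  have k5 := integrableD measurableT k3 k4.
  rewrite -(RintegralD _ k5 i3)//; apply: eq_Rintegral => x _.
  rewrite /z /d1 /d2 /= subr0; field; exact: lt0r_neq0.
rewrite E; apply: le_trans (ler_normD _ _) _.
apply: (@le_trans _ _ (t * (lnorm mu 2 (z t) * (C * v)) +
  t * (lnorm mu 2 (w 0) * (L * t * v)) + lnorm mu 2 (u 0) * (L' * t ^+ 2 * v))).
  apply: lerD.
    apply: le_trans (ler_normD _ _) _.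
    apply: lerD; rewrite normrM gtr0_norm// ler_wpM2l ?(ltW t0)//.
      by apply: (le_trans b1); rewrite ler_wpM2l ?lnorm_ge0.
    by apply: (le_trans b2); rewrite ler_wpM2l ?lnorm_ge0.
  by apply: (le_trans b3); rewrite ler_wpM2l ?lnorm_ge0.
rewrite (_ : _ + _ = t * g t); last by rewrite /g; ring.
by rewrite mulrC ler_wpM2r// ltW.
Qed.

End initial_slope.

(** * From the weak equation to an inequality with initial data *)

Section time_inequality.
Context (R : realType).
Notation leb := (@lebesgue_measure R).
Implicit Types (t d : R).

Lemma half_bound (c m : R) : m <= c / 2 -> - c + m <= - (c / 2).
Proof. by lra. Qed.

Lemma absorb_layer (I1 I2 W K c : R) : I1 + I2 = W -> I1 <= - (c / 2) ->
  K <= W -> K + c / 2 <= I2.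
Proof. by lra. Qed.

Lemma near_eq_derive12 (f g : R -> R) t : (\forall y \near t, f y = g y) ->
  'D_1 f t = 'D_1 g t /\ 'D_1 ('D_1 f) t = 'D_1 ('D_1 g) t.
Proof.
move=> fg; split; first exact: (@near_eq_derive R R R).
apply: (@near_eq_derive R R R).
move/near_join: fg => fg; near=> y.
by apply: (@near_eq_derive R R R); near: y.
Unshelve. all: by end_near. Qed.

Context (U V P k Q eta : R -> R) (r U0 U1 V0 : R).
Hypothesis r2 : 2 <= r.
Hypotheses (cU : {within `[0, r], continuous U})
  (cV : {within `[0, r], continuous V}).
Hypothesis slopeU : forall kappa : R, 0 < kappa -> exists2 d0 : R, 0 < d0 &
  forall t, t <= r -> 0 < t < d0 -> `|U t - U0 - t * U1| <= kappa * t.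
Hypothesis limV : forall kappa : R, 0 < kappa -> exists2 d0 : R, 0 < d0 &
  forall t, t <= r -> 0 < t < d0 -> `|V t - V0| <= kappa.
Hypotheses (seta : smooth eta) (eta1 : forall t, t <= r / 2 -> eta t = 1)
  (eta0 : forall t, r < t -> eta t = 0) (eta01 : forall t, 0 <= eta t <= 1).
Hypothesis weak : forall (zeta : R -> R) (b : R), smooth zeta -> 0 < b ->
  (forall t, t < b -> zeta t = 0) -> (forall t, r < t -> zeta t = 0) ->
  \int[leb]_(t in `[b, r])
    ('D_1 ('D_1 zeta) t * U t + 2 * ('D_1 zeta t * V t)) =
  \int[leb]_(t in `[b, r]) (zeta t * P t).
Hypotheses (PQ : forall t, 0 <= t <= r -> 0 <= P t <= Q t)
  (cQ : {within `[0, r], continuous Q})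
  (kP : forall t, 1 <= t <= r -> 0 <= k t <= P t).

Let G (zeta : R -> R) t := 'D_1 ('D_1 zeta) t * U t + 2 * ('D_1 zeta t * V t).

Let G_integrable (zeta : R -> R) a b : smooth zeta -> 0 <= a -> b <= r ->
  leb.-integrable `[a, b] (EFin \o G zeta).
Proof.
move=> sz a0 br; apply: cc_integrable.
have sub : `[a, b]%classic `<=` `[0, r]%classic.
  move=> t /=; rewrite !in_itv/= => /andP[at_ tb].
  by rewrite (le_trans a0 at_) (le_trans tb br).
have s1 j : Ck j ('D_1 zeta) by apply: Ck_derive; exact: sz.
have s2 : Ck 0 ('D_1 ('D_1 zeta)) by apply: Ck_derive; exact: s1.
apply: within_continuousD.
  apply: within_continuousM; last exact: within_continuousS cU.
  by apply: continuous_subspaceT; exact: Ck_cont s2.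
apply: within_continuousM.
  by apply: continuous_subspaceT => ?; exact: cvg_cst.
apply: within_continuousM; last exact: within_continuousS cV.
by apply: continuous_subspaceT; exact: Ck_cont (s1 0).
Qed.

Let G_near (f g : R -> R) t : (\forall y \near t, f y = g y) -> G f t = G g t.
Proof. by move=> /near_eq_derive12[e1 e2]; rewrite /G /= e1 e2. Qed.

Let near_eta t : t < r / 2 -> \forall y \near t, (cst 1 : R -> R) y = eta y.
Proof.
move=> tr; near=> y; rewrite eta1//; apply: ltW; near: y; exact: lt_nbhsl.
Unshelve. all: by end_near. Qed.

Let near_step d t : t < r / 2 ->
  \forall y \near t, smooth_step d y * eta y = smooth_step d y.
Proof.
move=> tr; near=> y; rewrite eta1 ?mulr1//; apply: ltW; near: y; exact: lt_nbhsl.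
Unshelve. all: by end_near. Qed.

Let near_step_eta d t : 0 < d -> 2 * d < t ->
  \forall y \near t, smooth_step d y * eta y = eta y.
Proof.
move=> d0 td; near=> y; rewrite smooth_step1 ?mul1r//; apply: ltW; near: y.
exact: lt_nbhsr.
Unshelve. all: by end_near. Qed.

Let step_eta01 d t : 0 <= smooth_step d t * eta t <= 1.
Proof.
have /andP[e0 e1] := eta01 t.
rewrite mulr_ge0 ?smooth_step_ge0//=.
by rewrite mulr_ile1 ?smooth_step_ge0 ?smooth_step_le1.
Qed.

Let G_eta0 t : t < r / 2 -> G eta t = 0.
Proof.
move=> /near_eta ne; rewrite -(G_near ne) /G /= derive_cst.
have -> : 'D_1 (cst 1 : R -> R) = (cst 0 : R -> R).
  by apply/funext => y; rewrite derive_cst.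
by rewrite derive_cst !mul0r mulr0 addr0.
Qed.

(** Near time 0 the function U is U0 + t U1 + o(t) and V is V0 + o(1). The
    integrand is at most the derivative of the function F below, which collects
    the leading terms and a linear term for the errors. The leading part changes
    by - (U1 - 2 V0) across the layer, and half of this gap absorbs the errors
    once their relative size kappa is small. *)
Lemma initial_layer (c : R) : c = U1 - 2 * V0 -> 0 < c ->
  exists d, [/\ 0 < d, 4 * d <= 1 &
  \int[leb]_(t in `[(d / 2), (3 * d)]) G (smooth_step d) t <= - (c / 2)].
Proof.
move=> cE c0; have r2' := r2.
have [M1 [M2 [M10 M20 hM1 hM2]]] := @cutoff_derivative_bounds R.
pose K := 5 / 2 * (3 * M2 + 2 * M1).
have K0 : 0 <= K by rewrite /K; lra.
pose kappa := c / (2 * (K + 1)).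
have k0 : 0 < kappa by rewrite divr_gt0//; lra.
have kK : kappa * K <= c / 2.
  have e : kappa * (K + 1) = c / 2.
    by rewrite /kappa; field; apply: lt0r_neq0; lra.
  by move: e; rewrite mulrDr mulr1; lra.
have [dU dU0 HU] := slopeU k0; have [dV dV0 HV] := limV k0.
pose d := Num.min (Num.min dU dV) 1 / 4.
have m0 : 0 < Num.min (Num.min dU dV) 1 by rewrite !lt_min dU0 dV0 ltr01.
have d0 : 0 < d by rewrite divr_gt0.
have d1 : 4 * d <= 1 by rewrite /d mulrC divfK// ge_min lexx orbT.
have ddU : 4 * d <= dU by rewrite /d mulrC divfK// !ge_min lexx.
have ddV : 4 * d <= dV by rewrite /d mulrC divfK// !ge_min lexx !orbT.
clearbody d; clear m0; exists d; split => //.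
pose s1 t := - (d^-1 * 'D_1 (@cutoff R) (t * d^-1 - 1)).
pose s2 t := - (d^-1 ^+ 2 * 'D_1 ('D_1 (@cutoff R)) (t * d^-1 - 1)).
have D1 : 'D_1 (smooth_step d) = s1.
  by apply/funext => t; have [] := is_derive_smooth_step d t.
have D2 : 'D_1 ('D_1 (smooth_step d)) = s2.
  by rewrite D1; apply/funext => t; have [] := is_derive2_smooth_step d t.
have di0 : 0 < d^-1 by rewrite invr_gt0.
have s1le t : `|s1 t| <= d^-1 * M1.
  by rewrite normrN normrM gtr0_norm// ler_wpM2l// ltW.
have s2le t : `|s2 t| <= d^-1 ^+ 2 * M2.
  by rewrite normrN normrM ger0_norm ?exprn_ge0 ?(ltW di0)// ler_wpM2l// exprn_ge0// ltW.
pose E := kappa * (3 * M2 + 2 * M1) * d^-1.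
pose F t := s1 t * (U0 + t * U1) - U1 * smooth_step d t + 2 * V0 * smooth_step d t + E * t.
pose f t := s2 t * (U0 + t * U1) + 2 * V0 * s1 t + E.
have b3 : d / 2 < 3 * d by lra.
have dF t : is_derive t (1 : R) F (f t).
  have h0 := is_derive_smooth_step d t.
  have h1 := is_derive2_smooth_step d t.
  have h2 : is_derive t (1 : R) (fun t : R => U0 + t * U1) (0 + U1).
    have h := is_derive_affine U1 0 t.
    have ef : (fun x : R => U0 + (x * U1 + 0)) = (fun x : R => U0 + x * U1).
      by apply/funext => y; rewrite addr0.
    have h' := is_derive_Dfun (is_derive_cstfun U0 t (1 : R)) h.
    by rewrite ef in h'.
  have hE : is_derive t (1 : R) (fun t : R => E * t) (E * 1).
    exact: (is_derive_Zfun E (is_derive_id t (1 : R))).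
  have H := is_derive_Dfun (is_derive_Dfun (is_derive_Dfun
    (is_derive_Mfun h1 h2) (is_derive_Zfun (- U1) h0))
    (is_derive_Zfun (2 * V0) h0)) hE.
  have ef : F = (fun x : R => s1 x * (U0 + x * U1) + - U1 * smooth_step d x +
       2 * V0 * smooth_step d x + E * x).
    by apply/funext => y; rewrite /F; ring.
  rewrite ef; apply: (is_derive_cast H); rewrite /f -/(s1 t) -/(s2 t); ring.
have cf : continuous f.
  have k1 : Ck 0 s1 by rewrite -D1; apply: Ck_derive; exact: smooth_smooth_step.
  have k2 : Ck 0 s2.
    by rewrite -D2; apply: Ck_derive; apply: Ck_derive; exact: smooth_smooth_step.
  apply: (@Ck_cont _ _ 0); apply: Ck_add; last exact: Ck_cst.
  apply: Ck_add; last by apply: Ck_mul => //; exact: Ck_cst.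
  apply: Ck_mul => //; apply: Ck_add; first exact: Ck_cst.
  by apply: Ck_mul; [exact: Ck_id|exact: Ck_cst].
have sz := @smooth_smooth_step R d.
apply: (@le_trans _ _ (\int[leb]_(t in `[(d / 2), (3 * d)]) f t)).
  apply: le_Rintegral => //.
  - by apply: G_integrable => //; lra.
  - by apply: cc_integrable; exact: continuous_subspaceT.
  move=> t /=; rewrite in_itv/= => /andP[t1 t2].
  have -> : G (smooth_step d) t = s2 t * U t + 2 * (s1 t * V t) by rewrite -D2 -D1.
  rewrite /f.
  have tr : t <= r by lra.
  have hU : `|U t - U0 - t * U1| <= kappa * (3 * d).
    by apply: le_trans (HU t tr _) _; [apply/andP; split; lra|rewrite ler_wpM2l// ltW].
  have hV : `|V t - V0| <= kappa by apply: HV => //; apply/andP; split; lra.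
  have eU : s2 t * (U t - U0 - t * U1) <= (d^-1 ^+ 2 * M2) * (kappa * (3 * d)).
    apply: le_trans (ler_norm _) _; rewrite normrM; apply: ler_pM => //.
  have eV : s1 t * (V t - V0) <= (d^-1 * M1) * kappa.
    by apply: le_trans (ler_norm _) _; rewrite normrM; apply: ler_pM.
  have -> : E = (d^-1 ^+ 2 * M2) * (kappa * (3 * d)) + 2 * ((d^-1 * M1) * kappa).
    by rewrite /E; field; exact: lt0r_neq0.
  move: eU eV.
  set A := _ * (kappa * (3 * d)); set B := _ * kappa.
  nra.
rewrite (Rintegral_FTC b3 dF cf).
have hb : \forall y \near d / 2, (cst 0 : R -> R) y = smooth_step d y.
  near=> y; rewrite /= smooth_step0//; apply: ltW; near: y.
  by apply: lt_nbhsl; lra.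
have h3 : \forall y \near 3 * d, (cst 1 : R -> R) y = smooth_step d y.
  near=> y; rewrite /= smooth_step1//; apply: ltW; near: y.
  by apply: lt_nbhsr; lra.
have [sb _] := near_eq_derive12 hb; have [s3 _] := near_eq_derive12 h3.
have Fb : F (d / 2) = E * (d / 2).
  by rewrite /F -D1 -sb derive_cst -(nbhs_singleton hb)/= !mul0r !mulr0 subrr !add0r.
have F3 : F (3 * d) = - c + E * (3 * d).
  by rewrite /F -D1 -s3 derive_cst -(nbhs_singleton h3)/= cE; ring.
rewrite Fb F3.
have -> : - c + E * (3 * d) - E * (d / 2) = - c + kappa * K.
  by rewrite /E /K; field; exact: lt0r_neq0.
exact: half_bound.
Unshelve. all: by end_near. Qed.

Let lower_part d : 0 < d -> 4 * d <= 1 ->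
  \int[leb]_(t in `[1, r]) (eta t * k t) <=
  \int[leb]_(t in `[(d / 2), r]) (smooth_step d t * eta t * P t).
Proof.
move=> d0 d1.
have b1 : d / 2 <= 1 by lra.
have b2 : 0 <= d / 2 by lra.
have d21 : 2 * d <= 1 by lra.
pose k' t := if 1 <= t then eta t * k t else 0.
have -> : \int[leb]_(t in `[1, r]) (eta t * k t) =
    \int[leb]_(t in `[(d / 2), r]) k' t.
  rewrite (@Rintegral_cc_eq_sub R k' (d / 2) 1).
  - by apply: eq_Rintegral => t /[!inE] /=; rewrite in_itv/= /k' => /andP[-> _].
  - by [].
  - by move=> t /andP[_ t1]; rewrite /k' leNgt t1.
have inr t : `[(d / 2), r]%classic t -> 0 <= t <= r.
  by rewrite /= in_itv/= => /andP[t1 ->]; rewrite (le_trans b2 t1).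
pose zeta t := smooth_step d t * eta t.
have zeta01 t : 0 <= zeta t <= 1 by exact: step_eta01.
have mI : measurable (`[(d / 2), r]%classic : set R) by exact: measurable_itv.
apply: (@le_Rintegral_nonmeasurable _ _ R leb `[(d / 2), r]%classic k'
  (fun t => zeta t * P t) Q _ _ _ mI) => [t|t|t|].
- move=> /inr/andP[t0 tr]; rewrite /k'; case: ifPn => // t1.
  have /andP[e0 _] := eta01 t.
  by have /andP[kt _] := kP (introT andP (conj t1 tr)); rewrite mulr_ge0.
- move=> tr'; have /andP[t0 tr] := inr t tr'; rewrite /k'; case: ifPn => [t1|_].
    have /andP[_ kt] := kP (introT andP (conj t1 tr)).
    have /andP[e0 _] := eta01 t.
    by rewrite /zeta smooth_step1 ?mul1r ?ler_wpM2l// (le_trans d21 t1).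
  have /andP[zt _] := zeta01 t; have /andP[Pt _] := PQ (inr t tr').
  by rewrite mulr_ge0.
- move=> tr'; have /andP[Pt PQt] := PQ (inr t tr'); have /andP[zt zt1] := zeta01 t.
  by apply: le_trans PQt; rewrite -[leRHS]mul1r ler_wpM2r.
- apply: cc_integrable; apply: within_continuousS cQ => t tr'.
  by have := inr t tr'; rewrite /= in_itv.
Qed.

(** Test with eta times [smooth_step d]: by [initial_layer] the first layer
    contributes at most minus half of the gap. The product is between 0 and eta,
    and it equals eta after time [2 * d], which is less than 1. *)
Lemma time_inequality : 0 < U1 - 2 * V0 ->
  \int[leb]_(t in `[1, r]) (eta t * k t) + (U1 - 2 * V0) / 2 <=
  \int[leb]_(t in `[(r / 2), r]) G eta t.
Proof.
move=> c0; have r2' := r2; have [d [d0 d1 Hd]] := initial_layer erefl c0.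
have split3 : d / 2 <= 3 * d <= r by apply/andP; split; lra.
have b0 : 0 < d / 2 by lra.
have b1 : d / 2 <= 1 by lra.
have b2 : 0 <= d / 2 by lra.
have r0' : 3 * d < r / 2 by lra.
have r0 := ltW r0'.
have d23 : 2 * d < 3 * d by lra.
have d21 : 2 * d <= 1 by lra.
have d2d : d / 2 < d by lra.
pose zeta t := smooth_step d t * eta t.
have sz : smooth zeta by move=> j; apply: Ck_mul => //; exact: smooth_smooth_step.
have z1 t : r < t -> zeta t = 0 by move=> /eta0 rt; rewrite /zeta rt mulr0.
have z0 t : t < d / 2 -> zeta t = 0.
  by move=> td; rewrite /zeta smooth_step0 ?mul0r//; lra.
have W := weak sz b0 z0 z1; rewrite -/(G zeta) in W.
have Gi a b : 0 <= a -> b <= r -> leb.-integrable `[a, b] (EFin \o G zeta).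
  exact: G_integrable.
rewrite (@Rintegral_cc_split _ (G zeta) _ _ _ split3) in W; last exact: Gi.
have E1 : \int[leb]_(t in `[(d / 2), (3 * d)]) G zeta t =
    \int[leb]_(t in `[(d / 2), (3 * d)]) G (smooth_step d) t.
  apply: eq_Rintegral => t /[!inE] /=; rewrite in_itv/= => /andP[_ t3].
  have tr3 : t < r / 2 by exact: le_lt_trans t3 r0'.
  exact: (G_near (near_step d tr3)).
have E2 : \int[leb]_(t in `[(3 * d), r]) G zeta t =
    \int[leb]_(t in `[(3 * d), r]) G eta t.
  apply: eq_Rintegral => t /[!inE] /=; rewrite in_itv/= => /andP[t3 _].
  have t2 : 2 * d < t by exact: lt_le_trans d23 t3.
  exact: (G_near (near_step_eta d0 t2)).
have E3 : \int[leb]_(t in `[(3 * d), r]) G eta t =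
    \int[leb]_(t in `[(r / 2), r]) G eta t.
  apply: Rintegral_cc_eq_sub => [//|t /andP[_ tr]].
  exact: G_eta0.
have E4 := lower_part d0 d1.
by rewrite E1 E2 E3 in W; exact: absorb_layer W Hd E4.
Qed.

End time_inequality.

(** * Blow-up of a discrete differential inequality *)

Section discrete_blow_up.
Context (R : realType).

(** The slope q / (1 + Y) comes from ln (1 + y) >= y / (1 + y). *)
Lemma powR_1Dx_ge (q y Y : R) : 0 <= q -> 0 <= y <= Y ->
  1 + q / (1 + Y) * y <= (1 + y) `^ q.
Proof.
move=> q0 /andP[y0 yY].
have y1 : 0 < 1 + y by lra.
have Y1 : 0 < 1 + Y by lra.
have lnge : y / (1 + Y) <= ln (1 + y).
  apply: (@le_trans _ _ (y / (1 + y))).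
    by rewrite ler_wpM2l// lef_pV2 ?posrE// lerD2l.
  have := @le_ln1Dx R ((1 + y)^-1 - 1).
  have i0 : 0 < (1 + y)^-1 by rewrite invr_gt0.
  rewrite addrCA subrr addr0 lnV ?posrE// => H.
  have {}H : - ln (1 + y) <= (1 + y)^-1 - 1 by apply: H; lra.
  have -> : y / (1 + y) = 1 - (1 + y)^-1 by field; exact: lt0r_neq0.
  by lra.
rewrite /powR gt_eqF//; apply: le_trans (expR_ge1Dx _).
by rewrite lerD2l -mulrA ler_wpM2l// mulrC.
Qed.

(** The increments give linear growth B >= c e k up to about K/2. From there on
    k is comparable to M = K/2, and the recursion is
    B(k+1) >= B(k) (1 + b B(k)^(p-1)) with b of order M^(1-p). The quantity
    y = b B^(p-1), bounded because B grows at most linearly, satisfies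
    1/y(k+1) <= 1/y(k) - d', so that M steps are possible only if
    M d' <= 1/y(M), which is at most a multiple of e^(1-p) by the linear growth;
    the powers of M cancel. *)
Lemma discrete_blow_up (p c1 C3 C4 : R) : 1 < p -> 0 < c1 -> 0 < C3 -> 0 < C4 ->
  exists2 B0 : R, 0 < B0 & forall (e : R) (K : nat) (B a : nat -> R),
    0 < e <= 1 ->
    (forall k, (1 <= k <= K)%N -> [/\ c1 * e <= a k, 0 <= B k,
      B k.+1 = B k + a k, B k `^ p <= C3 * k%:R `^ (p - 1) * a k &
      B k <= C4 * k%:R]) ->
    K%:R <= B0 * e `^ (- (p - 1)).
Proof.
move=> p1 c10 C30 C40.
have q0 : 0 < p - 1 by lra.
pose Y := C4 `^ (p - 1) / C3.
have Y0 : 0 < Y by rewrite divr_gt0 ?powR_gt0.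
pose d := (p - 1) / (1 + Y).
have d0 : 0 < d by rewrite divr_gt0//; lra.
pose d' := d / (1 + d * Y).
have dY0 : 0 < d * Y by rewrite mulr_gt0.
have d'0 : 0 < d' by rewrite divr_gt0//; lra.
pose kap := (c1 / 4) `^ (p - 1) / C3.
have kap0 : 0 < kap by rewrite divr_gt0 ?powR_gt0// divr_gt0.
exists (4 + 3 / (d' * kap)) => [|e K B a /andP[e0 e1] H].
  by rewrite addr_gt0// divr_gt0// mulr_gt0.
have ep1 : 1 <= e `^ (- (p - 1)).
  rewrite powRN invf_ge1 ?powR_gt0//.
  have := @ge0_ler_powR R (p - 1) (ltW q0) e 1.
  by rewrite powR1; apply; rewrite ?nnegrE ?ler01// ltW.
pose M := (K %/ 2)%N.
have [K4|K4] := leqP K 4.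
  apply: (@le_trans _ _ (4 * 1)).
    by rewrite mulr1 (ler_nat _ _ 4).
  apply: ler_pM => //.
  by rewrite lerDl ltW// divr_gt0// mulr_gt0.
have [M2 KM MK] : [/\ (2 <= M)%N, (K <= 3 * M)%N & (2 * M <= K)%N].
  by rewrite /M; clear -K4; split; lia.
clearbody M.
have M0 : 0 < M%:R :> R by rewrite ltr0n; clear -M2; lia.
(* linear growth, from the lower bound on the increments *)
have lin k : (1 <= k <= K)%N -> c1 * e * (k%:R - 1) <= B k.
  elim: k => [//|k IH] kK.
  have [k0|k0] := eqVneq k 0%N.
    by rewrite k0 in kK *; rewrite subrr mulr0; have [] := H 1%N kK.
  have kK' : (1 <= k <= K)%N by clear -kK k0; lia.
  have [ak _ -> _ _] := H k kK'; have := IH kK'.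
  rewrite -natr1; clear -ak; nra.
have BM : c1 * e * M%:R / 2 <= B M.
  apply: le_trans (lin M _); last by clear -M2 MK; lia.
  rewrite -mulrA ler_wpM2l ?mulr_ge0 ?(ltW c10) ?(ltW e0)//.
  have : 2 <= M%:R :> R by rewrite ler_nat.
  lra.
have ce0 : 0 < c1 * e * M%:R / 2 by rewrite divr_gt0// !mulr_gt0.
pose b := (C3 * (2 * M%:R) `^ (p - 1))^-1.
have MM0 : 0 < 2 * M%:R :> R by rewrite mulr_gt0.
have b0 : 0 < b by rewrite invr_gt0 mulr_gt0 ?powR_gt0.
pose y k := b * B k `^ (p - 1).
have step k : (M <= k < 2 * M)%N -> 0 < B k -> [/\ 0 < B k.+1, 0 < y k,
    y k <= Y & (y k.+1)^-1 <= (y k)^-1 - d'].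
  move=> kM Bk0; have kK : (1 <= k <= K)%N by clear -kM M2 MK; lia.
  have [ak _ BS BpC BC] := H k kK.
  have yk0 : 0 < y k by rewrite mulr_gt0 ?powR_gt0.
  have k2 : k%:R <= 2 * M%:R :> R by rewrite -natrM ler_nat; clear -kM; lia.
  have k0 : 0 < k%:R :> R by rewrite ltr0n; clear -kK; lia.
  have ykY : y k <= Y.
    rewrite /y /b /Y mulrC ler_pdivrMr ?mulr_gt0 ?powR_gt0//.
    rewrite mulrA divfK ?gt_eqF// -powRM ?(ltW C40) ?(ltW MM0)//.
    apply: ge0_ler_powR; rewrite ?nnegrE ?(ltW q0) ?(ltW Bk0)//.
      by rewrite mulr_ge0 ?(ltW C40) ?(ltW MM0).
    by apply: le_trans BC _; rewrite ler_wpM2l// ltW.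
  have Bge : B k * (1 + y k) <= B k.+1.
    rewrite BS mulrDr mulr1 lerD2l /y mulrCA mulr_powRB1 ?(ltW Bk0)//; last by lra.
    rewrite /b mulrC ler_pdivrMr ?mulr_gt0 ?powR_gt0//.
    apply: le_trans BpC _; rewrite mulrC ler_wpM2l//.
      by apply: le_trans ak; rewrite mulr_ge0 ?ltW.
    rewrite ler_wpM2l ?(ltW C30)//.
    by apply: ge0_ler_powR; rewrite ?nnegrE ?(ltW q0) ?(ltW k0) ?(ltW MM0).
  have BS0 : 0 < B k.+1 by apply: lt_le_trans Bge; rewrite mulr_gt0//; lra.
  split => //.
  have yS : y k * (1 + d * y k) <= y k.+1.
    apply: (@le_trans _ _ (b * (B k * (1 + y k)) `^ (p - 1))); last first.
      rewrite ler_wpM2l ?(ltW b0)//; apply: ge0_ler_powR; rewrite ?nnegrE ?(ltW q0) ?(ltW BS0)//.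
      by rewrite mulr_ge0 ?(ltW Bk0)// addr_ge0 ?(ltW yk0).
    rewrite powRM ?(ltW Bk0)//; last by lra.
    rewrite [leRHS]mulrA -/(y k) ler_wpM2l ?(ltW yk0)//.
    apply: powR_1Dx_ge; first exact: ltW.
    by rewrite (ltW yk0).
  have z0 : 0 < 1 + d * y k by rewrite ltr_wpDr// mulr_ge0 ?ltW.
  have z1 : 0 < 1 + d * Y by lra.
  apply: (@le_trans _ _ (y k * (1 + d * y k))^-1).
    have yz0 : 0 < y k * (1 + d * y k) by exact: mulr_gt0.
    by rewrite lef_pV2 ?posrE//; exact: lt_le_trans yS.
  have -> : (y k * (1 + d * y k))^-1 = (y k)^-1 - d / (1 + d * y k).
    by field; rewrite !gt_eqF.
  rewrite lerD2l lerN2 /d' ler_wpM2l ?(ltW d0)// lef_pV2 ?posrE//.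
  by rewrite lerD2l ler_wpM2l// ltW.
have yM0 : 0 < B M by exact: lt_le_trans BM.
have iter j : (j <= M)%N -> 0 < B (M + j)%N /\ (y (M + j)%N)^-1 <= (y M)^-1 - j%:R * d'.
  elim: j => [|j IH] jM; first by rewrite addn0 mul0r subr0.
  have [Bj yj] := IH (ltnW jM).
  have jr : (M <= M + j < 2 * M)%N by clear -jM; lia.
  have [BS0 _ _ yS] := step _ jr Bj.
  rewrite addnS; split => //; apply: le_trans yS _.
  by rewrite -natr1; lra.
have [Bl yl] := iter M (leqnn M).
have yl0 : 0 < (y (M + M)%N)^-1 by rewrite invr_gt0 mulr_gt0 ?powR_gt0.
have yM : kap * e `^ (p - 1) <= y M.
  apply: (@le_trans _ _ (b * (c1 * e * M%:R / 2) `^ (p - 1))); last first.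
    by rewrite ler_wpM2l ?(ltW b0)//; apply: ge0_ler_powR; rewrite ?nnegrE ?(ltW q0) ?(ltW ce0) ?(ltW yM0).
  have -> : c1 * e * M%:R / 2 = c1 / 4 * e * (2 * M%:R) by field.
  have c14 : 0 <= c1 / 4 by rewrite divr_ge0// ltW.
  have c14e : 0 <= c1 / 4 * e by rewrite mulr_ge0// ltW.
  rewrite (powRM _ c14e (ltW MM0)) (powRM _ c14 (ltW e0)) /kap /b le_eqVlt; apply/orP; left; apply/eqP.
  by field; rewrite !gt_eqF ?powR_gt0.
have ke0 : 0 < kap * e `^ (p - 1) by rewrite mulr_gt0 ?powR_gt0.
have y0M : 0 < y M := lt_le_trans ke0 yM.
have yM1 : (y M)^-1 <= (kap * e `^ (p - 1))^-1 by rewrite lef_pV2 ?posrE.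
have Mle : M%:R <= (d' * kap)^-1 * e `^ (- (p - 1)).
  have Md : M%:R * d' <= (kap * e `^ (p - 1))^-1.
    by apply: le_trans yM1; clear -yl yl0; lra.
  rewrite powRN -invfM -mulrA invfM mulrC.
  by rewrite ler_pdivlMr.
apply: (@le_trans _ _ (3 * M%:R)); first by rewrite -natrM ler_nat.
apply: (@le_trans _ _ (3 / (d' * kap) * e `^ (- (p - 1)))).
  by rewrite -mulrA ler_wpM2l.
by rewrite ler_wpM2r ?powR_ge0// lerDr.
Qed.

End discrete_blow_up.

(** * Dyadic sums and powers of the time cutoff *)

Section power_sums.
Context (R : realType).
Implicit Types (x y z a q : R).

Lemma powRN_le x z a : 0 < x -> x <= z -> 0 <= a -> z `^ (- a) <= x `^ (- a).
Proof.
move=> x0 xz a0; have z0 := lt_le_trans x0 xz.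
rewrite !powRN lef_pV2 ?posrE ?powR_gt0//.
by apply: ge0_ler_powR; rewrite ?nnegrE ?(ltW x0) ?(ltW z0).
Qed.

Lemma pow2_powR (j : nat) a : (2 ^+ j) `^ a = (2 `^ a) ^+ j :> R.
Proof.
by rewrite -[RHS]powR_mulrn ?powR_ge0// -powRrM mulrC powRrM powR_mulrn.
Qed.

Lemma geometric_incr_le q (J : nat) : 1 < q -> \sum_(j < J) q ^+ j <= q ^+ J / (q - 1).
Proof.
move=> q1; have q10 : 0 < q - 1 by lra.
rewrite ler_pdivlMr// mulrC -subrX1 lerBlDr lerDl ler01//.
Qed.

Lemma geometric_decr_le q (J : nat) : 0 <= q < 1 -> \sum_(j < J) q ^+ j <= (1 - q)^-1.
Proof.
move=> /andP[q0 q1]; have q10 : 0 < 1 - q by lra.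
rewrite -[leRHS]mul1r ler_pdivlMr//.
have -> : (\sum_(j < J) q ^+ j) * (1 - q) = 1 - q ^+ J.
  by rewrite -[1 - q ^+ J]opprB subrX1; ring.
by rewrite gerBl exprn_ge0.
Qed.

(** The terms increase geometrically while 2^j <= y and decrease geometrically
    afterwards, so the sum is at most a multiple of the term with 2^j about y. *)
Lemma dyadic_sum_le (al de : R) : 0 < al -> 0 < de ->
  exists2 C : R, 0 < C & forall (y : R) (J : nat), 1 <= y ->
    \sum_(j < J) (2 ^+ j) `^ al * (y + 2 ^+ j) `^ (- (al + de)) <=
    C * y `^ (- de).
Proof.
move=> al0 de0; pose A : R := 2 `^ al; pose B : R := 2 `^ (- de).
have ln2 : 0 < ln 2 :> R by rewrite ln_gt0// ltr1n.
have A1 : 1 < A by rewrite /A /powR pnatr_eq0/= expR_gt1 mulr_gt0.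
have B0 : 0 < B by rewrite powR_gt0.
have B1 : B < 1.
  by rewrite /B /powR pnatr_eq0/= expR_lt1 mulNr oppr_lt0 mulr_gt0.
have A10 : 0 < A - 1 by lra.
have B10 : 0 < 1 - B by lra.
exists ((A / (A - 1) + (1 - B)^-1) * 2 `^ de).
  by rewrite mulr_gt0 ?powR_gt0// addr_gt0 ?invr_gt0// divr_gt0//; lra.
move=> y J y1; have [i /andP[iy yi]] := dyadic_bracket y1.
pose f (j : nat) : R := (2 ^+ j) `^ al * (y + 2 ^+ j) `^ (- (al + de)).
have f0 j : 0 <= f j by rewrite mulr_ge0 ?powR_ge0.
have p0 j : 0 < 2 ^+ j :> R by rewrite exprn_gt0.
have ad0 : 0 <= al + de by rewrite addr_ge0 ?ltW.
have f1 j : f j <= (2 ^+ i) `^ (- (al + de)) * A ^+ j.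
  rewrite /f pow2_powR mulrC ler_wpM2r ?exprn_ge0 ?powR_ge0//.
  apply: powRN_le => //; apply: le_trans iy _; by rewrite lerDl ltW.
have f2 j : f j <= B ^+ j.
  apply: (@le_trans _ _ ((2 ^+ j) `^ al * (2 ^+ j) `^ (- (al + de)))).
    rewrite ler_wpM2l ?powR_ge0//; apply: powRN_le => //.
    by rewrite lerDr; lra.
  rewrite -powRD; last by rewrite (gt_eqF (p0 j)) implybT.
  by rewrite opprD addrA subrr add0r pow2_powR.
have -> : \sum_(j < J) (2 ^+ j) `^ al * (y + 2 ^+ j) `^ (- (al + de)) =
    \sum_(0 <= j < J) f j by rewrite big_mkord.
apply: (@le_trans _ _ (\sum_(0 <= j < i.+1 + J) f j)).
  rewrite (@big_cat_nat _ _ _ J 0 (i.+1 + J)) ?leq_addl//= lerDl.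
  by apply: sumr_ge0.
rewrite (@big_cat_nat _ _ _ i.+1 0 (i.+1 + J)) ?leq_addr//=.
have iB : (2 ^+ i) `^ (- de) <= 2 `^ de * y `^ (- de).
  have -> : 2 `^ de * y `^ (- de) = (y / 2) `^ (- de) :> R.
    have y0 : 0 <= y by lra.
    have i2 : 0 <= (2 : R)^-1 by rewrite invr_ge0.
    rewrite (powRM _ y0 i2) mulrC; congr (_ * _).
    by rewrite -powR_inv1// -powRrM mulrN mulN1r opprK.
  apply: powRN_le; [by rewrite divr_gt0//; lra| |exact: ltW].
  by rewrite ler_pdivrMr// mulrC -exprS ltW.
rewrite mulrDl; rewrite mulrDl; apply: lerD.
  apply: (@le_trans _ _ ((2 ^+ i) `^ (- (al + de)) * \sum_(0 <= j < i.+1) A ^+ j)).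
    by rewrite mulr_sumr ler_sum.
  rewrite big_mkord.
  apply: (@le_trans _ _ ((2 ^+ i) `^ (- (al + de)) * (A ^+ i.+1 / (A - 1)))).
    by rewrite ler_wpM2l ?powR_ge0// geometric_incr_le.
  rewrite exprS -[A ^+ i]pow2_powR.
  have -> : (2 ^+ i) `^ (- (al + de)) * (A * (2 ^+ i) `^ al / (A - 1)) =
      A / (A - 1) * ((2 ^+ i) `^ al * (2 ^+ i) `^ (- (al + de))) by ring.
  rewrite -powRD; last by rewrite (gt_eqF (p0 i)) implybT.
  rewrite opprD addrA subrr add0r -[leRHS]mulrA ler_wpM2l ?divr_ge0 ?powR_ge0//.
  exact: ltW.
have -> : (i.+1 + J = J + i.+1)%N by rewrite addnC.
rewrite -{1}[i.+1]add0n big_addn addnK.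
apply: (@le_trans _ _ (B ^+ i.+1 * \sum_(0 <= j < J) B ^+ j)).
  by rewrite mulr_sumr ler_sum// => j _; rewrite -exprD addnC; exact: f2.
rewrite big_mkord.
apply: (@le_trans _ _ (B ^+ i.+1 * (1 - B)^-1)).
  by rewrite ler_wpM2l ?exprn_ge0 ?(ltW B0)// geometric_decr_le// (ltW B0).
rewrite mulrC -mulrA ler_wpM2l ?invr_ge0 ?(ltW B10)//.
apply: le_trans iB; rewrite pow2_powR exprS -[leRHS]mul1r ler_wpM2r ?(ltW B1)//.
by rewrite exprn_ge0 ?ltW.
Qed.

End power_sums.

Section time_cutoff_power.
Context (R : realType).

(** Raising the cutoff to a large power makes its derivatives bounded by a power
    less than 1 of the function itself. *)
Definition time_cutoff (N : nat) (r t : R) : R := cutoff (t * (2 / r) - 1) ^+ N.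

Lemma normM_le (x y X Y : R) : `|x| <= X -> `|y| <= Y -> `|x * y| <= X * Y.
Proof. by move=> xX yY; rewrite normrM ler_pM. Qed.

Lemma smooth_time_cutoff N r : smooth (time_cutoff N r).
Proof.
move=> k; apply: Ck_exp.
apply: (@Ck_comp _ _ _ (fun t : R => t * (2 / r) - 1)); first exact: smooth_cutoff.
apply: Ck_add; last exact: Ck_cst.
by apply: Ck_mul; [exact: Ck_id|exact: Ck_cst].
Qed.

Lemma time_cutoff01 N r t : 0 <= time_cutoff N r t <= 1.
Proof.
by rewrite exprn_ge0 ?cutoff_ge0//= exprn_ile1 ?cutoff_ge0 ?cutoff_le1.
Qed.

Lemma time_cutoff1 N r t : 0 < r -> t <= r / 2 -> time_cutoff N r t = 1.
Proof.
move=> r0 tr; rewrite /time_cutoff cutoff1 ?expr1n// subr_le0.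
by rewrite mulrA ler_pdivrMr// mul1r -ler_pdivlMr.
Qed.

Lemma time_cutoff0 N r t : (0 < N)%N -> 0 < r -> r <= t -> time_cutoff N r t = 0.
Proof.
move=> N0 r0 rt; rewrite /time_cutoff cutoff0 ?expr0n ?gtn_eqF//.
rewrite lerBrDr mulrA ler_pdivlMr//; lra.
Qed.

(** The first two derivatives of the power [N] of the cutoff keep a factor equal
    to its power N - 2, which is at most its power N / p as soon as
    N >= 2 p / (p - 1). *)
Lemma time_cutoff_derivatives (p : R) : 1 < p -> exists (N : nat) (C : R),
  [/\ (0 < N)%N, 0 < C & forall r t : R, 0 < r ->
  `|'D_1 (time_cutoff N r) t| <= C / r * time_cutoff N r t `^ p^-1 /\
  `|'D_1 ('D_1 (time_cutoff N r)) t| <= C / r ^+ 2 * time_cutoff N r t `^ p^-1].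
Proof.
move=> p1; have [M1 [M2 [M10 M20 hM1 hM2]]] := @cutoff_derivative_bounds R.
pose m := (Num.bound (2 / (p - 1))).+1.
have m2 : 2 / (p - 1) <= m%:R.
  have h : 0 <= 2 / (p - 1) by rewrite divr_ge0//; lra.
  apply: ltW; apply: lt_trans (archi_boundP h) _.
  by rewrite ltr_nat.
have mp : (m.+2%:R) * p^-1 <= m%:R :> R.
  rewrite ler_pdivrMr; last by lra.
  move: m2; rewrite ler_pdivrMr; last by lra.
  by rewrite -[m.+2]addn2 natrD mulrBr mulr1; lra.
pose N := m.+2; pose NR : R := N%:R.
pose C := 4 * (NR * NR * M1 ^+ 2 + NR * M2 + NR * M1 + 1).
have NR0 : 0 <= NR by exact: ler0n.
have C0 : 0 < C.
  by rewrite /C mulr_gt0// ltr_wpDl// !addr_ge0 ?mulr_ge0 ?exprn_ge0.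
exists N, C; split => // r t r0.
have [l lE] : exists l : R, l = 2 / r by exists (2 / r).
have l0 : 0 < l by rewrite lE divr_gt0.
have tcE x : time_cutoff N r x = cutoff (x * l - 1) ^+ N by rewrite lE.
pose th (t : R) := cutoff (t * l - 1).
pose th1 (t : R) := 'D_1 (@cutoff R) (t * l - 1) * l.
pose th2 (t : R) := 'D_1 ('D_1 (@cutoff R)) (t * l - 1) * l * l.
have dth t' : is_derive t' (1 : R) th (th1 t').
  exact: (is_derive_comp_real (is_derive_affine l (- 1) t')
    (Ck_is_derive (1 : R) _ (@smooth_cutoff R 1))).
have dth1 t' : is_derive t' (1 : R) th1 (th2 t').
  have s1 : Ck 1 ('D_1 (@cutoff R)) by apply: Ck_derive; exact: (@smooth_cutoff R 2).
  have h := is_derive_comp_real (is_derive_affine l (- 1) t') (Ck_is_derive (1 : R) _ s1).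
  have h2 := is_derive_Mfun h (is_derive_cstfun l t' (1 : R)).
  by apply: (is_derive_cast h2); rewrite /th2 /=; ring.
have dpow k t' : is_derive t' (1 : R) (fun x => th x ^+ k.+1)
    (k.+1%:R * th t' ^+ k * th1 t').
  have h := @is_deriveX _ _ th k.+1 t' (1 : R) (th1 t') (dth t').
  by rewrite exprfctE in h; apply: (is_derive_cast h); rewrite -[_ *: _]/(_ * _) /=.
pose g1 (x : R) : R := NR * th x ^+ m.+1 * th1 x.
have D1 : 'D_1 (time_cutoff N r) = g1.
  rewrite (_ : time_cutoff N r = (fun x => th x ^+ N)).
    by apply/funext => x; have [] := dpow m.+1 x.
  by apply/funext => x; rewrite tcE.
have dD1 : is_derive t (1 : R) g1
    (NR * th t ^+ m.+1 * th2 t + th1 t * (NR * (m.+1%:R * th t ^+ m * th1 t))).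
  exact: (@is_derive_Mfun R R (fun x => NR * th x ^+ m.+1) th1 _ _ _ _
    (is_derive_Zfun NR (dpow m t)) (dth1 t)).
have tht0 : 0 <= th t by exact: cutoff_ge0.
have tht1 : th t <= 1 by exact: cutoff_le1.
have thm : th t ^+ m <= time_cutoff N r t `^ p^-1.
  rewrite tcE -/(th t) -[X in _ <= X `^ _]powR_mulrn// -powRrM.
  have [->|th0] := eqVneq (th t) 0.
    by rewrite expr0n /= powR_ge0.
  have thp : 0 < th t <= 1 by rewrite lt_neqAle eq_sym th0 tht0.
  by rewrite -powR_mulrn//; apply: ger_powR.
have thm1 : th t ^+ m.+1 <= time_cutoff N r t `^ p^-1.
  apply: le_trans thm; rewrite exprS -[leRHS]mul1r ler_wpM2r ?exprn_ge0//.
have th1le : `|th1 t| <= M1 * l by rewrite /th1 normrM (gtr0_norm l0) ler_wpM2r// ltW.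
have th2le : `|th2 t| <= M2 * l * l.
  by rewrite /th2 !normrM (gtr0_norm l0) !ler_wpM2r// ltW.
set E := time_cutoff N r t `^ p^-1 in thm thm1 *.
have E0 : 0 <= E by exact: powR_ge0.
have hN : `|NR * th t ^+ m.+1| <= NR * E.
  apply: normM_le; rewrite ger0_norm//; exact: exprn_ge0.
split.
  rewrite [X in `|X| <= _](_ : _ = g1 t); last exact: (congr1 (@^~ t) D1).
  apply: (@le_trans _ _ (NR * E * (M1 * l))).
    by rewrite /g1; exact: normM_le.
  have -> : NR * E * (M1 * l) = (2 * (NR * M1)) / r * E by rewrite lE; ring.
  rewrite ler_wpM2r// ler_wpM2r ?invr_ge0 ?(ltW r0)// /C.
  have h1 : 0 <= NR * M1 by exact: mulr_ge0.
  have h2 : 0 <= NR * NR * M1 ^+ 2 + NR * M2.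
    by rewrite addr_ge0 ?mulr_ge0 ?exprn_ge0.
  by clear -h1 h2; lra.
have D2 : 'D_1 ('D_1 (time_cutoff N r)) t =
    NR * th t ^+ m.+1 * th2 t + th1 t * (NR * (m.+1%:R * th t ^+ m * th1 t)).
  by rewrite D1; have [] := dD1.
rewrite [X in `|X| <= _](_ : _ =
    NR * th t ^+ m.+1 * th2 t + th1 t * (NR * (m.+1%:R * th t ^+ m * th1 t))) //.
apply: le_trans (ler_normD _ _) _.
apply: (@le_trans _ _ (NR * E * (M2 * l * l) + (M1 * l) * (NR * (NR * E * (M1 * l))))).
  apply: lerD.
    exact: normM_le.
  apply: normM_le => //; apply: normM_le; first by rewrite ger0_norm.
  apply: normM_le => //; apply: normM_le.
    by rewrite ger0_norm ?ler0n// /NR ler_nat /N.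
  by rewrite ger0_norm// exprn_ge0.
have -> : NR * E * (M2 * l * l) + M1 * l * (NR * (NR * E * (M1 * l))) =
   4 * (NR * NR * M1 ^+ 2 + NR * M2) / r ^+ 2 * E.
  by rewrite lE; field; exact: lt0r_neq0.
rewrite ler_wpM2r// ler_wpM2r ?invr_ge0 ?exprn_ge0 ?(ltW r0)// /C.
have h1 : 0 <= NR * M1 by exact: mulr_ge0.
by clear -h1; lra.
Qed.

End time_cutoff_power.

(** * Bounds for the test functions on the cone *)

Section psi_on_the_cone.
Context (R : realType) (n : nat).
Implicit Types (a b t r y z : R) (x : 'rV[R]_n) (J j : nat) (c s : nat -> R).

Lemma sqdist_le b t x : sqdist b (t, x) <= (t + 2 + b) * (t + 2 + b).
Proof. by rewrite /sqdist /= -sqr_enorm; have := sqr_ge0 (enorm x); lra. Qed.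

Lemma reg_powN_cone a b t x : 0 <= a -> 0 <= b -> 0 <= t -> enorm x <= t + 1 ->
  reg_powN a (sqdist b (t, x)) <= (t + 2 - enorm x + b) `^ (- a) * (t + 2 + b) `^ (- a).
Proof.
move=> a0 b0 t0 xt; have [s1 s2] := sqdist_cone b0 t0 xt.
have e0 := enorm_ge0 x; rewrite reg_powNE; last exact: ltW.
have y0 : 0 <= t + 2 - enorm x + b by lra.
have z0 : 0 <= t + 2 + b by lra.
rewrite -powRM//; apply: powRN_le => //; first by nra.
by apply: le_trans s1; rewrite addrAC.
Qed.

Lemma reg_powN_cone_ge a b t x : 0 <= a -> 0 <= b -> 0 <= t -> enorm x <= t + 1 ->
  (t + 2 + b) `^ (- (2 * a)) <= reg_powN a (sqdist b (t, x)).
Proof.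
move=> a0 b0 t0 xt; have [s1 s2] := sqdist_cone b0 t0 xt.
rewrite reg_powNE; last exact: ltW.
have z0 : 0 < t + 2 + b by lra.
have -> : (t + 2 + b) `^ (- (2 * a)) = ((t + 2 + b) * (t + 2 + b)) `^ (- a).
  rewrite (powRM _ (ltW z0) (ltW z0)) -powRD; last by rewrite (gt_eqF z0) implybT.
  by congr (_ `^ _); ring.
by apply: powRN_le => //; [lra|exact: sqdist_le].
Qed.

Lemma derive_reg_powN_cone a b t x : 0 <= a -> 0 <= b -> 0 <= t -> enorm x <= t + 1 ->
  - (2 * a * ((t + 2 - enorm x + b) `^ (- (a + 1)) * (t + 2 + b) `^ (- a))) <=
    'D_1 (reg_powN a) (sqdist b (t, x)) * (2 * (t + 2 + b)) <= 0.
Proof.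
move=> a0 b0 t0 xt; have [s1 s2] := sqdist_cone b0 t0 xt.
have e0 := enorm_ge0 x; rewrite derive_reg_powN//.
have y0 : 0 < t + 2 - enorm x + b by lra.
have z0 : 0 < t + 2 + b by lra.
have -> : - a - 1 = - (a + 1) by ring.
set S := sqdist b (t, x) in s1 s2 *.
have p0 : 0 <= S `^ (- (a + 1)) by exact: powR_ge0.
have pS : S `^ (- (a + 1)) <=
    (t + 2 - enorm x + b) `^ (- (a + 1)) * (t + 2 + b) `^ (- (a + 1)).
  rewrite -(powRM _ (ltW y0) (ltW z0)); apply: powRN_le; first exact: mulr_gt0.
    by apply: le_trans s1; rewrite addrAC.
  by rewrite addr_ge0.
have zE : (t + 2 + b) `^ (- a) = (t + 2 + b) `^ (- (a + 1)) * (t + 2 + b).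
  rewrite -[X in _ * X]powRr1 ?(ltW z0)// -powRD; last by rewrite (gt_eqF z0) implybT.
  by congr (_ `^ _); ring.
rewrite zE.
move: p0 pS; set A := S `^ _; set Y := _ `^ (- (a + 1)); set Z := (t + 2 + b) `^ _.
move=> p0 pS; move: z0; set z := t + 2 + b => z0.
have az : 0 <= 2 * a * z by rewrite mulr_ge0 ?(ltW z0)// mulr_ge0.
have e1 : - a * A * (2 * z) = - (2 * a * z * A) by ring.
have e2 : 2 * a * (Y * (Z * z)) = 2 * a * z * (Y * Z) by ring.
by rewrite e1 e2 lerN2 oppr_le0 ler_wpM2l//= mulr_ge0.
Qed.

Context (a : R) (J : nat) (c s : nat -> R).
Hypotheses (a0 : 0 <= a) (s0 : forall j : 'I_J, 0 <= s j).
Hypothesis c0 : forall j : 'I_J, 0 <= c j.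

Lemma psi_t_le0 t x : 0 <= t -> enorm x <= t + 1 -> psi_t a J c s t x <= 0.
Proof.
move=> t0 xt; rewrite -oppr_ge0 -sumrN; apply: sumr_ge0 => j _.
rewrite -mulrN mulr_ge0 ?c0// oppr_ge0.
by have /andP[] := derive_reg_powN_cone a0 (s0 j) t0 xt.
Qed.

(** All terms are nonnegative, and [sqdist] is at most the square of
    [t + 2 + s i]. *)
Lemma psi_ge_term (i : 'I_J) t x : 0 <= t -> enorm x <= t + 1 ->
  c i * (t + 2 + s i) `^ (- (2 * a)) <= psi a J c s t x.
Proof.
move=> t0 xt; rewrite /psi /wavef (bigD1 i)//=.
rewrite -[leLHS]addr0; apply: lerD.
  by rewrite ler_wpM2l ?c0// reg_powN_cone_ge.
by apply: sumr_ge0 => j _; rewrite mulr_ge0 ?c0 ?reg_powN_ge0.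
Qed.

(** Each term of [psi] is a product of powers of t + 2 + s and of
    t + 2 - |x| + s. At late times the former is controlled by [r], and in the
    latter one more negative power is gained at the cost of a factor [r], so
    that [psi] and [r] times its time derivative are bounded by the same sum. *)
Lemma psi_late_bounds (D ga r t : R) x : 2 <= r -> r / 2 <= t <= r ->
  enorm x <= t + 1 -> (forall j : 'I_J, s j <= 2 * r) ->
  \sum_(j < J) c j * (t + 2 - enorm x + s j) `^ (- (a + 1)) <=
    D * (t + 2 - enorm x) `^ (- ga) ->
  psi a J c s t x <=
    4 * r * (r / 2) `^ (- a) * (D * (t + 2 - enorm x) `^ (- ga)) /\
  `|psi_t a J c s t x| <=
    2 * a * (r / 2) `^ (- a) * (D * (t + 2 - enorm x) `^ (- ga)).
Proof.
move=> r2 /andP[rt tr] xt sr HD; have e0 := enorm_ge0 x.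
have t0 : 0 <= t by lra.
have ra0 : 0 <= (r / 2) `^ (- a) by exact: powR_ge0.
have tau b : 0 <= b -> (t + 2 + b) `^ (- a) <= (r / 2) `^ (- a).
  by move=> b0; apply: powRN_le => //; lra.
split.
  apply: (@le_trans _ _ (4 * r * (r / 2) `^ (- a) *
      \sum_(j < J) c j * (t + 2 - enorm x + s j) `^ (- (a + 1)))); last first.
    by rewrite ler_wpM2l// mulr_ge0//; lra.
  rewrite mulr_sumr; apply: ler_sum => j _.
  have -> : 4 * r * (r / 2) `^ (- a) * (c j * (t + 2 - enorm x + s j) `^ (- (a + 1))) =
     c j * ((4 * r * (t + 2 - enorm x + s j) `^ (- (a + 1))) * (r / 2) `^ (- a)) by ring.
  rewrite ler_wpM2l ?c0//; apply: le_trans (reg_powN_cone a0 (s0 j) t0 xt) _.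
  have sj := s0 j; have sj2 := sr j.
  apply: ler_pM; rewrite ?powR_ge0//; last exact: tau.
  have y0 : 0 < t + 2 - enorm x + s j by lra.
  have -> : (t + 2 - enorm x + s j) `^ (- a) =
      (t + 2 - enorm x + s j) * (t + 2 - enorm x + s j) `^ (- (a + 1)).
    rewrite -[X in X * _]powRr1 ?(ltW y0)// -powRD; last by rewrite (gt_eqF y0) implybT.
    by congr (_ `^ _); ring.
  by rewrite ler_wpM2r ?powR_ge0//; lra.
apply: (@le_trans _ _ (2 * a * (r / 2) `^ (- a) *
    \sum_(j < J) c j * (t + 2 - enorm x + s j) `^ (- (a + 1)))); last first.
  by rewrite ler_wpM2l// mulr_ge0// mulr_ge0.
rewrite ler0_norm; last exact: psi_t_le0.
rewrite -sumrN mulr_sumr; apply: ler_sum => j _.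
have -> : 2 * a * (r / 2) `^ (- a) * (c j * (t + 2 - enorm x + s j) `^ (- (a + 1))) =
   c j * (2 * a * ((t + 2 - enorm x + s j) `^ (- (a + 1)) * (r / 2) `^ (- a))) by ring.
rewrite -mulrN ler_wpM2l ?c0// lerNl.
have /andP[h _] := derive_reg_powN_cone a0 (s0 j) t0 xt.
apply: le_trans h; rewrite lerN2 ler_wpM2l ?mulr_ge0//.
by rewrite ler_wpM2l ?powR_ge0// tau.
Qed.

End psi_on_the_cone.

(** * Hoelder inequality in time and positivity of the data pairing *)

Section hoelder_in_time.
Context (R : realType).
Notation leb := (@lebesgue_measure R).

Lemma continuous_norm_powR (q : R) : 0 < q ->
  continuous (fun x : R => `|x| `^ q).
Proof.
move=> q0 x; have [->|x0] := eqVneq x 0; last first.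
  have h : derivable (fun y : R => y `^ q) `|x| 1.
    by apply: derivable_powR; rewrite in_itv/= andbT normr_gt0.
  have hc : {for `|x|, continuous (fun y : R => y `^ q)}.
    by apply: differentiable_continuous; exact/derivable1_diffP.
  exact: (@continuous_comp _ _ _ (@normr R R) (fun y : R => y `^ q) x (@norm_continuous _ _ x) hc).
rewrite /continuous_at normr0 powR0 ?gt_eqF//.
apply/cvgrPdist_lt => e e0.
have d0 : 0 < e `^ q^-1 by exact: powR_gt0.
near=> y; rewrite sub0r normrN ger0_norm ?powR_ge0//.
have -> : e = (e `^ q^-1) `^ q.
  by rewrite -powRrM mulVf ?gt_eqF// powRr1// ltW.
apply: gt0_ltr_powR; rewrite ?nnegrE ?normr_ge0 ?powR_ge0//.
Unshelve. all: by end_near. Qed.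

Lemma within_continuous_powR (A : set R) (phi : R -> R) (q : R) : 0 < q ->
  {within A, continuous phi} -> (forall t, A t -> 0 <= phi t) ->
  {within A, continuous (fun t => phi t `^ q)}.
Proof.
move=> q0 /subspace_continuousP cphi phi0.
apply/subspace_continuousP => t At.
have h := @cvg_comp _ _ _ phi (fun x => `|x| `^ q) _ _ _ (cphi t At)
  (@continuous_norm_powR q q0 (phi t)).
rewrite [X in _ --> X](_ : _ = `|phi t| `^ q); last by rewrite /= ger0_norm ?phi0.
apply: cvg_trans h; apply: near_eq_cvg; near=> s => /=.
by rewrite ger0_norm// phi0//; near: s; exact: withinT.
Unshelve. all: by end_near. Qed.

Lemma hoelder_interval (p p' al be : R) (phi : R -> R) : 1 < p -> 1 < p' ->
  p^-1 + p'^-1 = 1 -> al <= be -> {within `[al, be], continuous phi} ->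
  (forall t, al <= t <= be -> 0 <= phi t) ->
  \int[leb]_(t in `[al, be]) phi t <=
  (\int[leb]_(t in `[al, be]) (phi t `^ p)) `^ p^-1 * (be - al) `^ p'^-1.
Proof.
move=> p1 p'1 pp ab cphi phi0.
have p0 : 0 < p by exact: lt_trans p1.
have p'0 : 0 < p' by exact: lt_trans p'1.
pose A : set R := `[al, be]%classic.
have mA : measurable A by exact: measurable_itv.
have muA : leb A = (be - al)%:E.
  rewrite /A lebesgue_measure_itv/= lte_fin; case: ltP => [_|ba]; first exact: EFinB.
  by have -> : al = be; [apply/le_anti; rewrite ab ba|rewrite subrr].
have Ain t : (t \in A) = (al <= t <= be).
  by apply/idP/idP; rewrite inE /A /= in_itv.
have mphi : measurable_fun setT (phi \_ A : R -> R).
  apply/(measurable_restrictT _ mA); apply/measurable_EFinP.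
  by case/integrableP: (cc_integrable cphi).
have [t0 _ ht0] := EVT_max ab cphi.
have [fL _] : phi \_ A \in Lfun leb p%:E /\ lnorm leb p (phi \_ A) <= `|phi t0| * (be - al) `^ p^-1.
  apply: (@lnorm_bounded _ _ _ leb p (phi \_ A) A) => //; first exact: ltW.
    move=> t At; rewrite patchE mem_set//.
    have tab : al <= t <= be by rewrite -Ain inE.
    rewrite ger0_norm ?phi0//; apply: le_trans (ler_norm _); apply: ht0.
    by rewrite in_itv/=.
  by move=> t At; rewrite patchE memNset.
have [gL gle] : (\1_A : R -> R) \in Lfun leb p'%:E /\
    lnorm leb p' (\1_A : R -> R) <= 1 * (be - al) `^ p'^-1.
  apply: (@lnorm_bounded _ _ _ leb p' (\1_A : R -> R) A) => //; first exact: ltW.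
    by move=> t At; rewrite indicE mem_set// normr1.
  by move=> t At; rewrite indicE memNset.
have [_ H] := hoelder_Rintegral p0 p'0 pp fL gL.
have E1 : \int[leb]_x ((phi \_ A) x * \1_A x) = \int[leb]_(t in `[al, be]) phi t.
  rewrite [RHS]Rintegral_mkcond; congr (Rintegral _ _ _); apply/funext => t.
  by rewrite !patchE indicE; case: ifPn; rewrite ?mul0r ?mulr1.
have E2 : lnorm leb p (phi \_ A) = (\int[leb]_(t in `[al, be]) (phi t `^ p)) `^ p^-1.
  have e := lnorm_powRE p0 fL.
  have -> : \int[leb]_(t in `[al, be]) (phi t `^ p) = lnorm leb p (phi \_ A) `^ p.
    rewrite -[RHS]/(fine (lnorm leb p (phi \_ A) `^ p)%:E) -e.
    rewrite Rintegral_mkcond; congr fine; congr (integral _ _ _).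
    apply/funext => t; rewrite !patchE; case: ifPn => [|_].
      by rewrite Ain => /phi0 /ger0_norm ->.
    by rewrite normr0 powR0 ?gt_eqF.
  by rewrite -powRrM divff ?gt_eqF// powRr1 ?lnorm_ge0.
apply: le_trans (ler_norm _) _; rewrite -E1; apply: le_trans H _.
by rewrite -E2 ler_wpM2l ?lnorm_ge0//; apply: le_trans gle _; rewrite mul1r.
Qed.

End hoelder_in_time.

Section initial_data_pairing.
Context (R : realType) (n : nat).
Notation mu := (lebesgue_rV R n).
Implicit Types (x : 'rV[R]_n).

Lemma Rintegral_gt0 (h : 'rV[R]_n -> R) (x0 : 'rV[R]_n) : continuous h ->
  (forall x, 0 <= h x) -> mu.-integrable setT (EFin \o h) -> 0 < h x0 ->
  0 < \int[mu]_x h x.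
Proof.
move=> ch h0 hi hx0; have mh := continuous_rV_measurable ch.
have nb : nbhs x0 [set x | h x0 / 2 < h x].
  have hh : h x0 / 2 < h x0 by lra.
  exact: (ch x0 _ (lt_nbhsr hh)).
have /nbhs_ballP[e /= e0 He] := nb.
pose A (i : 'I_n) : set (measurableTypeR R) := `]x0 ord0 i - e, x0 ord0 i + e[%classic.
have mA i : measurable (A i) by exact: measurable_itv.
pose B : set 'rV[R]_n := [set x | forall i, A i (x ord0 i)].
have muB : mu B = ((e + e) ^+ n)%:E.
  rewrite /B lebesgue_rV_box//.
  rewrite (eq_bigr (fun _ => (e + e)%:E)); last first.
    move=> i _; rewrite /A lebesgue_measure_itv/= lte_fin.
    have -> : x0 ord0 i - e < x0 ord0 i + e by lra.
    by rewrite -EFinD; congr EFin; ring.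
  by rewrite prodEFin prodr_const card_ord.
have mB : measurable B by exact: measurable_box.
have : (((h x0 / 2) * (e + e) ^+ n)%:E <= \int[mu]_x (h x)%:E)%E.
  rewrite EFinM -muB -(integral_cst mu mB) [leLHS]integral_mkcond.
  apply: ge0_le_integral => //.
  - by move=> x _; rewrite patchE; case: ifP => //; rewrite lee_fin; lra.
  - by apply/(measurable_restrictT _ mB).
  - exact/measurable_EFinP.
  - move=> x _; rewrite patchE; case: ifPn => [|_]; last by rewrite lee_fin.
    rewrite inE lee_fin => Bx; apply: ltW; apply: He; split => // i j.
    rewrite [i]ord1; change (`|x0 ord0 j - x ord0 j| < e); have := Bx j; rewrite /A /= in_itv/= => /andP[b1 b2].
    by rewrite ltr_distl; apply/andP; split; lra.
rewrite -(@fineK _ (\int[mu]_x (h x)%:E)%E); last exact: integrable_fin_num.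
rewrite lee_fin; apply: lt_le_trans.
by rewrite mulr_gt0 ?exprn_gt0//; lra.
Qed.

Lemma fsupport_out (h : 'rV[R]_n -> R) x :
  fsupport h `<=` [set x | enorm x <= 1] -> 1 < enorm x -> h x = 0.
Proof.
move=> sh x1; apply/eqP/negPn/negP => hx.
have : fsupport h x by apply: subset_closure.
by move=> /sh /=; rewrite leNgt x1.
Qed.

End initial_data_pairing.

(** * The inequality for a general wave test function *)

Section weighted_inequality.
Context (R : realType) (n : nat) (T : \bar R) (u w : R -> 'rV[R]_n -> R).
Context (p p' eps : R) (f g : 'rV[R]_n -> R).
Notation mu := (lebesgue_rV R n).
Notation leb := (@lebesgue_measure R).
Hypotheses (p1 : 1 < p) (p'1 : 1 < p') (pp : p^-1 + p'^-1 = 1).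
Hypotheses (T0 : (0 < T)%E) (cuw : C1_L2 T u w) (cup : continuous_Lp T p u).
Hypothesis su : ssupport T u `<=` light_cone (R := R) (n := n).
Hypothesis wu : weak_wave_equation p T u.
Hypotheses (eps0 : 0 < eps) (u0 : {ae mu, forall x, u 0 x = eps * f x})
  (w0 : {ae mu, forall x, w 0 x = eps * g x}).
Hypotheses (cf : continuous f) (gsm : smooth_compact g).
Hypotheses (f_supp : fsupport f `<=` [set x | enorm x <= 1])
  (g_supp : fsupport g `<=` [set x | enorm x <= 1]).
Hypothesis f_ge0 : forall x, 0 <= f x.
Context (a : R) (J : nat) (c s : nat -> R).
Hypotheses (aE : a = (n%:R - 1) / 2) (a0 : 0 <= a).
Hypotheses (s0 : forall j : 'I_J, 0 <= s j) (c0 : forall j : 'I_J, 0 <= c j).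

Notation psi := (psi (n := n) a J c s).
Notation psi_t := (psi_t (n := n) a J c s).

Let cu2 : continuous_Lp T 2 u. Proof. by case: cuw. Qed.
Let cw2 : continuous_Lp T 2 w. Proof. by case: cuw. Qed.
Let tpsi : tame psi. Proof. exact: tame_wavef. Qed.
Let tpsi_t : tame psi_t. Proof. exact: tame_wavef_t. Qed.
Let T00 : time_co T 0. Proof. by split. Qed.

Let U t := \int[mu]_x (u t x * psi t x).
Let V t := \int[mu]_x (u t x * psi_t t x).
Let U1 := \int[mu]_x (w 0 x * psi 0 x) + \int[mu]_x (u 0 x * psi_t 0 x).

Lemma data_pairing_integrable :
  mu.-integrable setT (EFin \o (fun x => g x * psi 0 x)).
Proof.
have [gs gc] := gsm.
have cg : continuous g by exact: (@Ck_cont _ _ _ _ (gs 0%N)).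
have [C C0 HC] : exists2 C : R, 0 <= C & forall x, `|g x| <= C.
  have [M M0 HM] := continuous_bounded_on gc cg.
  exists M => // x; have [->|gx] := eqVneq (g x) 0; first by rewrite normr0.
  by apply: HM; apply: subset_closure.
have gout x : ~ eball 1 x -> g x = 0.
  by move=> /negP; rewrite -ltNge; exact: fsupport_out.
have one2 : 1 <= 2 :> R by rewrite ler1n.
have [gL _] := @lnorm_bounded _ _ _ mu 2 g (eball 1) C _ one2
  (continuous_rV_measurable cg) (measurable_eball 1) (mu_eball n ltr01) C0
  (fun x _ => HC x) gout.
have r0 : (0 : R) <= 0 <= (0 : R) by apply/andP.
have [h _] := hoelder_Rintegral (ltr0n _ 2) (ltr0n _ 2) (inv2D R) gL
  (tame_Lfun tpsi r0 one2).
exact: h.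
Qed.

(** The waves decrease in time on the support of the data. *)
Lemma data_sign x : 0 <= eps * (f x * - psi_t 0 x).
Proof.
rewrite mulr_ge0 ?(ltW eps0)// ; have [x1|x1] := leP (enorm x) 1.
  rewrite mulr_ge0 ?f_ge0// oppr_ge0; apply: (psi_t_le0 a0 s0 c0 (lexx 0)).
  by rewrite add0r.
by rewrite (fsupport_out f_supp x1) mul0r.
Qed.

(** The pairing U1 contains the integral of u(0) against the time derivative of
    the wave once; subtracting it twice turns its negative sign into a
    favourable one, and only the data [g] remains. *)
Lemma initial_gap : eps * \int[mu]_x (g x * psi 0 x) <= U1 - 2 * V 0.
Proof.
have cg : continuous g by case: gsm => gs _; exact: (@Ck_cont _ _ _ _ (gs 0%N)).
have mg := continuous_rV_measurable cg; have mf := continuous_rV_measurable cf.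
have mpsi := tame_measurable tpsi (lexx 0).
have mpsit := tame_measurable tpsi_t (lexx 0).
have [/Lfun_measurable mu0 _] := cu2 T00; have [/Lfun_measurable mw0 _] := cw2 T00.
have E1 : \int[mu]_x (w 0 x * psi 0 x) = eps * \int[mu]_x (g x * psi 0 x).
  rewrite -RintegralZl//; last exact: data_pairing_integrable.
  apply: eq_Rintegral_ae.
  - exact: measurable_funM.
  - by apply: measurable_funM => //; exact: measurable_funM.
  - by apply: filterS w0 => x ->; rewrite mulrA.
have E2 : V 0 <= 0.
  have -> : V 0 = \int[mu]_x (- (eps * (f x * - psi_t 0 x))).
    apply: eq_Rintegral_ae.
    - exact: measurable_funM.
    - apply: measurableT_comp => //; apply: measurable_funM => //.
      by apply: measurable_funM => //; exact: measurableT_comp.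
    - by apply: filterS u0 => x ->; rewrite !mulrN opprK mulrA.
  rewrite /Rintegral; under eq_integral do rewrite EFinN.
  rewrite integral_ge0N.
    rewrite fineN oppr_le0; apply: fine_ge0; apply: integral_ge0 => x _.
    by rewrite lee_fin; exact: (data_sign x).
  by move=> x _; rewrite lee_fin; exact: (data_sign x).
rewrite /U1 E1 -/(V 0) -addrA lerDl.
have -> : V 0 - 2 * V 0 = - V 0 by ring.
by rewrite oppr_ge0.
Qed.

Context (r : R).
Hypotheses (r2 : 2 <= r) (rT : (r%:E < T)%E).

Let I_co : `[0, r]%classic `<=` time_co T.
Proof.
move=> t /=; rewrite in_itv/= => /andP[t0 tr]; split => //.
by apply: le_lt_trans rT; rewrite lee_fin.
Qed.

Let within_I (h : R -> R) :
  (forall t, time_co T t -> h s @[s --> within (time_co T) (nbhs t)] --> h t) ->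
  {within `[0, r], continuous h}.
Proof.
move=> ch; apply/subspace_continuousP => t tI.
apply: cvg_trans (ch t (I_co tI)).
by apply: cvg_app; exact: within_subset I_co.
Qed.

Let cU : {within `[0, r], continuous U}.
Proof. by apply: within_I => t tT; exact: pairing_cvg. Qed.

Let cV : {within `[0, r], continuous V}.
Proof. by apply: within_I => t tT; exact: pairing_cvg. Qed.

Let cN : {within `[0, r], continuous (fun t => lnorm mu p (u t))}.
Proof. by apply: within_I => t tT; apply: lnorm_cvg => //; exact: ltW. Qed.

Let p0 : 0 < p. Proof. exact: lt_trans p1. Qed.

Lemma continuous_lnorm_powR :
  {within `[0, r], continuous (fun t => lnorm mu p (u t) `^ p)}.
Proof. by apply: within_continuous_powR => // t _; exact: lnorm_ge0. Qed.

Let slopeU (kappa : R) : 0 < kappa -> exists2 d0 : R, 0 < d0 &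
  forall t, t <= r -> 0 < t < d0 -> `|U t - U 0 - t * U1| <= kappa * t.
Proof.
move=> k0.
have dq (t : R) x : is_derive t (1 : R) (psi ^~ x) (psi_t t x).
  exact: is_derive_slice (is_derive_wavef_time _ _ _ _ (t, x)).
have [d d0 Hd] := initial_slope T0 cuw tpsi tpsi_t dq k0.
exists d => // t tr td; apply: Hd => //; apply: I_co; rewrite /= in_itv/= tr andbT.
by case/andP: td => /ltW.
Qed.

Let limV (kappa : R) : 0 < kappa -> exists2 d0 : R, 0 < d0 &
  forall t, t <= r -> 0 < t < d0 -> `|V t - V 0| <= kappa.
Proof.
move=> k0; have /cvgrPdist_le /(_ _ k0) := pairing_cvg cu2 tpsi_t T00.
rewrite near_withinE => /nbhs_ballP[d /= d0 Hd]; exists d => // t tr /andP[t0 td].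
rewrite distrC; apply: (Hd t).
  by rewrite /ball /= sub0r normrN gtr0_norm.
by apply: I_co; rewrite /= in_itv/= tr (ltW t0).
Qed.

Let pairing_split (x1 x2 t : R) : time_co T t ->
  \int[mu]_x (u t x * (x1 * psi t x + 2 * (x2 * psi_t t x))) =
  x1 * U t + 2 * (x2 * V t).
Proof.
move=> tT; have iU := pairing_integrable cu2 tpsi tT.
have iV := pairing_integrable cu2 tpsi_t tT.
rewrite /U /V -(RintegralZl _ _ iU)// mulrA -(RintegralZl _ _ iV)//.
rewrite -RintegralD//; first by apply: eq_Rintegral => x _; ring.
- by apply: eq_integrable (integrableZl measurableT x1 iU) => // x _ /=; rewrite EFinM.
- by apply: eq_integrable (integrableZl measurableT (2 * x2) iV) => // x _ /=; rewrite EFinM.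
Qed.

Let P t := \int[mu]_x (`|u t x| `^ p * psi t x).

Let weak (zeta : R -> R) (b : R) : smooth zeta -> 0 < b ->
  (forall t, t < b -> zeta t = 0) -> (forall t, r < t -> zeta t = 0) ->
  \int[leb]_(t in `[b, r])
    ('D_1 ('D_1 zeta) t * U t + 2 * ('D_1 zeta t * V t)) =
  \int[leb]_(t in `[b, r]) (zeta t * P t).
Proof.
move=> sz b0 zb zr; rewrite -(weak_separated p1 cu2 cup su wu c aE s0 sz b0 rT zb zr).
apply: eq_Rintegral => t; rewrite inE /= in_itv/= => /andP[bt tr].
rewrite pairing_split//; apply: I_co; rewrite /= in_itv/= tr andbT.
by apply: le_trans bt; exact: ltW.
Qed.

Let mass_integrable t : time_co T t ->
  mu.-integrable setT (EFin \o (fun x => `|u t x| `^ p)).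
Proof. by move=> tT; have [ut _] := cup tT; exact: Lfun_integrable (ltW p1) ut. Qed.

Let mass_lnorm t : time_co T t ->
  \int[mu]_x (`|u t x| `^ p) = lnorm mu p (u t) `^ p.
Proof. by move=> tT; have [ut _] := cup tT; rewrite /Rintegral (lnorm_powRE p0 ut). Qed.

Let PQ : exists C : R, forall t, 0 <= t <= r ->
  0 <= P t <= C * lnorm mu p (u t) `^ p.
Proof.
have [C [L [rho [C0 _ _ HC]]]] := tpsi r; exists C => t tr.
have tT : time_co T t by apply: I_co; rewrite /= in_itv/=.
have [_ hC _ _] := HC t tr; apply/andP; split.
  by apply: Rintegral_ge0 => x _; rewrite mulr_ge0 ?powR_ge0// psi_ge0.
rewrite -(mass_lnorm tT) -(RintegralZl _ _ (mass_integrable tT))//.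
apply: le_Rintegral => //.
- exact: (mass_psi_integrable p1 cup a c s0 tT).
- exact: eq_integrable (integrableZl measurableT C (mass_integrable tT)).
- move=> x _; rewrite mulrC ler_wpM2r ?powR_ge0//.
  exact: le_trans (ler_norm _) (hC x).
Qed.

(** The lower bound for [psi] holds on the cone only, so [psi] is replaced by its
    maximum with [m], which agrees with it almost everywhere where [u t] does not
    vanish. *)
Let mass_lower (m t : R) : 0 <= t <= r -> 0 <= m ->
  (forall x, enorm x <= t + 1 -> m <= psi t x) ->
  0 <= m * lnorm mu p (u t) `^ p <= P t.
Proof.
move=> tr m0 Hm; rewrite mulr_ge0 ?powR_ge0//=.
have tT : time_co T t by apply: I_co; rewrite /= in_itv/=.
have [ut _] := cup tT; have mut := Lfun_measurable ut.
have mpsi : measurable_fun setT (psi t).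
  by apply: tame_measurable => //; case/andP: tr.
have mup : measurable_fun setT (fun x => `|u t x| `^ p).
  by apply: (measurableT_comp (measurable_powR _)); exact: measurableT_comp.
rewrite -(mass_lnorm tT) -(RintegralZl _ _ (mass_integrable tT))//.
have -> : P t = \int[mu]_x (`|u t x| `^ p * Num.max m (psi t x)).
  apply: eq_Rintegral_ae; [exact: measurable_funM| |].
    by apply: measurable_funM => //; exact: measurable_maxr.
  apply: filterS (ssupport_slice su tT) => x ux.
  have [xt|xt] := leP (enorm x) (t + 1); first by rewrite max_r// Hm.
  by rewrite (ux xt) normr0 powR0 ?mul0r// gt_eqF.
have ih : mu.-integrable setT (EFin \o (fun x => m * `|u t x| `^ p + `|u t x| `^ p * psi t x)).
  have i1 := integrableZl measurableT m (mass_integrable tT).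
  have i2 := mass_psi_integrable p1 cup a c s0 tT.
  by apply: eq_integrable (integrableD measurableT i1 i2) => // x _ /=; rewrite EFinD EFinM.
apply: (le_Rintegral_nonmeasurable _ _ _ _ ih) => //.
- by move=> x _; rewrite mulr_ge0 ?powR_ge0.
- by move=> x _; rewrite mulrC ler_wpM2l ?powR_ge0// le_max lexx.
- move=> x _; rewrite [m * _]mulrC -mulrDr ler_wpM2l ?powR_ge0//.
  by rewrite ge_max lerDl psi_ge0//= lerDr.
Qed.

Context (N : nat) (C : R) (D ga K : R) (m : R -> R).
Hypotheses (N0 : (0 < N)%N) (C0 : 0 < C) (D0 : 0 <= D) (K0 : 0 <= K).
Let eta := time_cutoff N r.
Hypothesis eta_bounds : forall t : R, `|'D_1 eta t| <= C / r * eta t `^ p^-1 /\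
  `|'D_1 ('D_1 eta) t| <= C / r ^+ 2 * eta t `^ p^-1.
Hypothesis s_le : forall j : 'I_J, s j <= 2 * r.
Hypothesis psi_sum : forall (t : R) (x : 'rV[R]_n), 0 <= t <= r -> enorm x <= t + 1 ->
  \sum_(j < J) c j * (t + 2 - enorm x + s j) `^ (- (a + 1)) <=
    D * (t + 2 - enorm x) `^ (- ga).
Hypothesis weight_integral : forall t : R, 0 <= t <= r ->
  (\int[mu]_(x in eball (t + 1)) ((t + 2 - enorm x) `^ (- (ga * p')))%:E <=
    K%:E)%E.
Hypothesis m_le : forall (t : R) (x : 'rV[R]_n), 0 <= t <= r -> enorm x <= t + 1 ->
  0 <= m t <= psi t x.

Let G t := 'D_1 ('D_1 eta) t * U t + 2 * ('D_1 eta t * V t).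
Let M := 4 * (1 + a) * C * D * (r / 2) `^ (- a) / r.

Let eta01 t : 0 <= eta t <= 1. Proof. exact: time_cutoff01. Qed.

Let ceta : continuous eta.
Proof. by move=> t; exact: (@Ck_cont _ _ _ _ (@smooth_time_cutoff R N r 0) t). Qed.

Let G_le t : r / 2 <= t <= r ->
  G t <= M * K `^ p'^-1 * (lnorm mu p (u t) * eta t `^ p^-1).
Proof.
move=> tr; have tI : 0 <= t <= r.
  by case/andP: tr => t1 ->; rewrite andbT; apply: le_trans t1; have := r2; lra.
have tT : time_co T t by apply: I_co; rewrite /= in_itv/=.
have t0 : 0 <= t by case/andP: tI.
have r0 : 0 < r by apply: lt_le_trans r2.
rewrite /G -pairing_split//.
have [u2 _] := cu2 tT; have [up _] := cup tT.
have mh : measurable_fun setT (fun x => 'D_1 ('D_1 eta) t * psi t x +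
    2 * ('D_1 eta t * psi_t t x)).
  by apply: measurable_funD; apply: measurable_funM => //;
    [|apply: measurable_funM => //]; exact: tame_measurable.
have E0 : 0 <= eta t `^ p^-1 by exact: powR_ge0.
have M0 : 0 <= M * eta t `^ p^-1.
  by rewrite mulr_ge0// !mulr_ge0 ?powR_ge0 ?invr_ge0 ?addr_ge0 ?(ltW C0) ?(ltW r0).
have hle x : enorm x <= t + 1 ->
  `|'D_1 ('D_1 eta) t * psi t x + 2 * ('D_1 eta t * psi_t t x)| <=
    M * eta t `^ p^-1 * (t + 2 - enorm x) `^ (- ga).
  move=> xt; have [b1 b2] := psi_late_bounds a0 s0 c0 r2 tr xt s_le (psi_sum tI xt).
  have [e1 e2] := eta_bounds t.
  have ps0 : 0 <= psi t x by exact: psi_ge0.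
  apply: le_trans (ler_normD _ _) _.
  have b1' : `|psi t x| <=
      4 * r * (r / 2) `^ (- a) * (D * (t + 2 - enorm x) `^ (- ga)).
    by rewrite ger0_norm.
  have n2 : `|2 : R| <= 2 by rewrite ger0_norm.
  apply: le_trans (lerD (normM_le e2 b1') (normM_le n2 (normM_le e1 b2))) _.
  rewrite le_eqVlt; apply/orP; left; apply/eqP; rewrite /M.
  by field; exact: lt0r_neq0.
apply: le_trans (ler_norm _) _.
apply: le_trans (pairing_le p1 p'1 pp su tT u2 up mh M0 K0 hle (weight_integral tI)) _.
rewrite le_eqVlt; apply/orP; left; apply/eqP; ring.
Qed.

(** [time_inequality], with its right-hand side estimated by Hoelder's inequality
    first in space ([pairing_le], with [psi_late_bounds]) and then in time. *)
Theorem weighted_inequality : 0 < U1 - 2 * V 0 ->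
  \int[leb]_(t in `[1, r]) (eta t * (m t * lnorm mu p (u t) `^ p)) +
    (U1 - 2 * V 0) / 2 <=
  M * K `^ p'^-1 * (r / 2) `^ p'^-1 *
    (\int[leb]_(t in `[(r / 2), r]) (lnorm mu p (u t) `^ p * eta t)) `^ p^-1.
Proof.
move=> gap; have r0 : 0 < r by apply: lt_le_trans r2.
have [CQ hPQ] := PQ.
have half : r / 2 <= r by lra.
have half0 : 0 <= r / 2 by rewrite divr_ge0 ?ltW.
have cQ : {within `[0, r], continuous (fun t => CQ * lnorm mu p (u t) `^ p)}.
  apply: within_continuousM; last exact: continuous_lnorm_powR.
  by apply: continuous_subspaceT; exact: cst_continuous.
have kP t : 1 <= t <= r -> 0 <= m t * lnorm mu p (u t) `^ p <= P t.
  move=> /andP[t1 tr]; have tI : 0 <= t <= r by rewrite tr (le_trans ler01).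
  apply: mass_lower => //; last by move=> x xt; case/andP: (m_le tI xt).
  have z0 : enorm (0 : 'rV[R]_n) <= t + 1.
    have -> : enorm (0 : 'rV[R]_n) = 0.
      by have := enorm_scale (0 : 'rV[R]_n) (lexx 0); rewrite scale0r mul0r.
    by apply: addr_ge0 => //; case/andP: tI.
  by case/andP: (m_le tI z0).
have eta1 t : t <= r / 2 -> eta t = 1 by exact: time_cutoff1.
have eta0 t : r < t -> eta t = 0 by move=> rt; apply: time_cutoff0 => //; exact: ltW.
have H := time_inequality r2 cU cV slopeU limV (@smooth_time_cutoff R N r) eta1 eta0
  eta01 weak hPQ cQ kP gap.
apply: le_trans H _.
have sub : `[(r / 2), r]%classic `<=` `[0, r]%classic.
  by move=> t /=; rewrite !in_itv/= => /andP[t1 ->]; rewrite andbT (le_trans half0).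
have D1c : continuous ('D_1 eta).
  by have k := Ck_derive (1 : R) (@smooth_time_cutoff R N r 1) => t; exact: (@Ck_cont _ _ _ _ k t).
have D2c : continuous ('D_1 ('D_1 eta)).
  have k := Ck_derive (1 : R) (Ck_derive (1 : R) (@smooth_time_cutoff R N r 2)).
  by move=> t; exact: (@Ck_cont _ _ _ _ k t).
have cG : {within `[(r / 2), r], continuous G}.
  apply: within_continuousD.
    apply: within_continuousM; first exact: continuous_subspaceT.
    exact: within_continuousS sub cU.
  apply: within_continuousM; first by apply: continuous_subspaceT; exact: cst_continuous.
  apply: within_continuousM; first exact: continuous_subspaceT.
  exact: within_continuousS sub cV.
have cphi : {within `[(r / 2), r],
    continuous (fun t => lnorm mu p (u t) * eta t `^ p^-1)}.
  apply: within_continuousM; first exact: within_continuousS sub cN.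
  apply: within_continuous_powR; rewrite ?invr_gt0//; first exact: continuous_subspaceT.
  by move=> t _; case/andP: (eta01 t).
pose A := M * K `^ p'^-1.
apply: (@le_trans _ _ (\int[leb]_(t in `[(r / 2), r])
    (A * (lnorm mu p (u t) * eta t `^ p^-1)))).
  have iA : leb.-integrable `[(r / 2), r]
      (EFin \o (fun t => A * (lnorm mu p (u t) * eta t `^ p^-1))).
    apply: cc_integrable.
    by apply: within_continuousM => //; apply: continuous_subspaceT; exact: cst_continuous.
  by apply: (le_Rintegral _ (cc_integrable cG) iA) => // t; rewrite /= in_itv/=; exact: G_le.
rewrite RintegralZl//; last exact: cc_integrable.
have A0 : 0 <= A.
  by rewrite mulr_ge0 ?powR_ge0// !mulr_ge0 ?powR_ge0 ?invr_ge0 ?addr_ge0 ?(ltW C0) ?(ltW r0).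
rewrite -/A -mulrA ler_wpM2l//.
have phi0 t : r / 2 <= t <= r -> 0 <= lnorm mu p (u t) * eta t `^ p^-1.
  by move=> _; rewrite mulr_ge0 ?lnorm_ge0 ?powR_ge0.
apply: le_trans (hoelder_interval p1 p'1 pp half cphi phi0) _.
have -> : r - r / 2 = r / 2 by lra.
rewrite mulrC ler_wpM2l ?powR_ge0//.
rewrite le_eqVlt; apply/orP; left; apply/eqP; congr (_ `^ _).
apply: eq_Rintegral => t _; have /andP[e0 _] := eta01 t.
rewrite powRM ?lnorm_ge0 ?powR_ge0//; congr (_ * _).
by rewrite -powRrM mulVf ?gt_eqF// powRr1.
Qed.

End weighted_inequality.

(** * Scaling at the critical exponent *)

Section scaling.
Context (R : realType) (n : nat).
Notation mu := (lebesgue_rV R n).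

Lemma weight_integral_gt1 (q : R) : 1 < q -> exists2 kappa : R, 0 < kappa &
  forall r t : R, 2 <= r -> 0 <= t <= r ->
  (\int[mu]_(x in eball (t + 1)) ((t + 2 - enorm x) `^ (- q))%:E <=
    (kappa * r ^+ n.-1)%:E)%E.
Proof.
move=> q1; pose B : R := 2 `^ (1 - q).
have ln2 : 0 < ln 2 :> R by rewrite ln_gt0// ltr1n.
have B0 : 0 < B by exact: powR_gt0.
have B1 : B < 1.
  by rewrite /B /powR pnatr_eq0/= expR_lt1 -opprB mulNr oppr_lt0 mulr_gt0// subr_gt0.
have V0 := eball_vol_ge0 R n.
have B10 : 0 < (1 - B)^-1 by rewrite invr_gt0 subr_gt0.
pose ka := 2 * eball_vol R n * n.+1%:R * 2 ^+ n.-1 * (1 - B)^-1.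
have ka0 : 0 <= ka by rewrite /ka !mulr_ge0 ?exprn_ge0 ?ler0n ?(ltW B10).
exists (ka + 1); first by rewrite ltr_wpDl.
move=> r t r2 /andP[t0 tr].
have t2 : 0 <= t + 2 by rewrite addr_ge0.
have [I tI] : exists I : nat, t + 2 < 2 ^+ I.
  have t21 : 1 <= t + 2 by lra.
  have [i /andP[_ h]] := dyadic_bracket t21.
  by exists i.+1.
apply: le_trans (powR_dist_integral_le n t0 (ltW (lt_trans ltr01 q1)) tI) _.
rewrite lee_fin.
apply: (@le_trans _ _ (2 * eball_vol R n * n.+1%:R * (2 * r) ^+ n.-1 * (1 - B)^-1)).
  apply: ler_pM; rewrite ?mulr_ge0 ?exprn_ge0 ?ler0n//.
  - by apply: sumr_ge0 => i _; rewrite exprn_ge0// powR_ge0.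
  - rewrite ler_wpM2l ?mulr_ge0 ?ler0n//; apply: lerXn2r; rewrite ?nnegrE//; lra.
  - by apply: geometric_decr_le; rewrite (ltW B0).
have r0 : 0 <= r ^+ n.-1 by rewrite exprn_ge0//; lra.
apply: (@le_trans _ _ (ka * r ^+ n.-1)); last by rewrite ler_wpM2r// lerDl.
by rewrite exprMn le_eqVlt; apply/orP; left; apply/eqP; rewrite /ka; ring.
Qed.

Lemma weight_integral_eq1 : exists2 kappa : R, 0 < kappa &
  forall (k : nat) (t : R), (1 <= k)%N -> 0 <= t <= 2 ^+ k ->
  (\int[mu]_(x in eball (t + 1)) ((t + 2 - enorm x) `^ (- 1))%:E <=
    (kappa * k%:R * (2 ^+ k) ^+ n.-1)%:E)%E.
Proof.
have V0 := eball_vol_ge0 R n.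
pose ka := 2 * eball_vol R n * n.+1%:R * 2 ^+ n.-1 * 3.
have ka0 : 0 <= ka by rewrite /ka !mulr_ge0 ?exprn_ge0 ?ler0n.
exists (ka + 1); first by rewrite ltr_wpDl.
move=> k t k1 /andP[t0 tr].
have r2 : 2 <= 2 ^+ k :> R.
  by rewrite -[leLHS]expr1; apply: ler_weXn2l; rewrite ?ler1n.
set r : R := 2 ^+ k in tr r2 *.
have t2 : 0 <= t + 2 by rewrite addr_ge0.
have tI : t + 2 < 2 ^+ (k.+2) by rewrite !exprS -/r; lra.
apply: le_trans (powR_dist_integral_le n t0 ler01 tI) _.
rewrite lee_fin subrr powRr0.
have -> : \sum_(i < k.+2) (1 : R) ^+ i = k.+2%:R.
  by under eq_bigr do rewrite expr1n; rewrite sumr_const card_ord.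
have k3 : k.+2%:R <= 3 * k%:R :> R by rewrite -natrM ler_nat; lia.
apply: (@le_trans _ _ (2 * eball_vol R n * n.+1%:R * (2 * r) ^+ n.-1 * (3 * k%:R))).
  apply: ler_pM; rewrite ?mulr_ge0 ?exprn_ge0 ?ler0n//.
  rewrite ler_wpM2l ?mulr_ge0 ?ler0n//; apply: lerXn2r; rewrite ?nnegrE//; lra.
have r0 : 0 <= k%:R * r ^+ n.-1 by rewrite mulr_ge0 ?ler0n// exprn_ge0//; lra.
apply: (@le_trans _ _ (ka * (k%:R * r ^+ n.-1))).
  by rewrite exprMn le_eqVlt; apply/orP; left; apply/eqP; rewrite /ka; ring.
by rewrite -mulrA ler_wpM2r// lerDl.
Qed.

Context (p p' a be : R).
Hypotheses (n2 : (2 <= n)%N) (p1 : 1 < p) (pp : p'^-1 = 1 - p^-1).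
Hypotheses (aE : a = (n%:R - 1) / 2) (beE : be = a - p^-1).
Hypothesis p_root : (n%:R - 1) * p ^+ 2 - (n%:R + 1) * p - 2 = 0.

(** This is where p must be the positive root of the quadratic equation: the
    left-hand side times 2 p^2 is the quadratic polynomial. *)
Lemma critical_exponent :
  - a - 1 + (n%:R - 1) * p'^-1 + p'^-1 + be * p^-1 = 0.
Proof.
have p0 : p != 0 by rewrite gt_eqF//; exact: lt_trans p1.
have e : (- a - 1 + (n%:R - 1) * p'^-1 + p'^-1 + be * p^-1) * (2 * p ^+ 2) =
    (n%:R - 1) * p ^+ 2 - (n%:R + 1) * p - 2.
  by rewrite beE pp aE; field.
apply/eqP; have := e; rewrite p_root => /eqP; rewrite mulf_eq0.
by rewrite [X in _ || X]gt_eqF ?orbF// mulr_gt0// exprn_gt0// (lt_trans ltr01).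
Qed.

(** The constant in [weighted_inequality] does not depend on [r] when the mass is
    weighted by the power [- be] of time. *)
Lemma critical_scaling (A kappa r : R) : 0 <= kappa -> 0 < r ->
  A * (r / 2) `^ (- a) / r * (kappa * r ^+ n.-1) `^ p'^-1 * (r / 2) `^ p'^-1 *
    ((2 * r) `^ be) `^ p^-1 =
  A * (2^-1 `^ (- a) * 2^-1 `^ p'^-1 * 2 `^ (be * p^-1)) * kappa `^ p'^-1.
Proof.
move=> k0 r0; have rn0 : r != 0 by rewrite gt_eqF.
have h0 : 0 <= (2 : R)^-1 by rewrite invr_ge0.
have rE : r ^+ n.-1 = r `^ (n%:R - 1).
  rewrite -powR_mulrn ?(ltW r0)//; congr (_ `^ _).
  by rewrite -[in RHS](ltn_predK n2) -natr1 addrK.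
rewrite rE -!powRrM !(powRM _ (ltW r0) h0) (powRM _ (ler0n _ 2) (ltW r0)).
rewrite (powRM _ k0 (powR_ge0 _ _)) -!powRrM.
have E : r `^ (- a) * r^-1 * r `^ ((n%:R - 1) * p'^-1) * r `^ p'^-1 *
    r `^ (be * p^-1) = 1.
  rewrite -[r^-1]powR_inv1 ?(ltW r0)// -!powRD ?rn0 ?implybT//.
  by rewrite critical_exponent powRr0.
rewrite -[RHS]mulr1 -[X in _ = _ * X]E; ring.
Qed.

End scaling.

(** * Growth of the mass on dyadic time intervals *)

Section cone_arithmetic.
Context (R : realType).
Implicit Types (t e y r : R).

Lemma cone_distance_ge1 t e : e <= t + 1 -> 1 <= t + 2 - e.
Proof. lra. Qed.

Lemma shifted_time_ge1 t : 0 <= t -> 1 <= t + 2.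
Proof. lra. Qed.

Lemma shifted_time_lt t y : t <= y -> 2 <= y -> 2 * (2 * y) <= t + 2 -> False.
Proof. lra. Qed.

Lemma halve_le t y : t < 2 * y -> 2^-1 * t <= y.
Proof. lra. Qed.

Lemma half_interval r : 2 <= r -> 1 <= r / 2 <= r.
Proof. by move=> r2; apply/andP; split; lra. Qed.

End cone_arithmetic.

Section critical_estimates.
Context (R : realType) (n : nat) (p : R) (f g : 'rV[R]_n -> R).
Notation mu := (lebesgue_rV R n).
Notation leb := (@lebesgue_measure R).
Hypotheses (n2 : (2 <= n)%N) (p1 : 1 < p).
Hypothesis p_root : (n%:R - 1) * p ^+ 2 - (n%:R + 1) * p - 2 = 0.
Hypotheses (f_smooth : smooth_compact f) (g_smooth : smooth_compact g).
Hypotheses (f_supp : fsupport f `<=` [set x | enorm x <= 1])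
  (g_supp : fsupport g `<=` [set x | enorm x <= 1]).
Hypotheses (f_ge0 : forall x, 0 <= f x) (g_ge0 : forall x, 0 <= g x).
Hypothesis g_neq0 : exists x, g x != 0.
Context (N : nat) (C : R).
Hypotheses (N0 : (0 < N)%N) (C0 : 0 < C).
Hypothesis cutoffN : forall r t : R, 0 < r ->
  `|'D_1 (time_cutoff N r) t| <= C / r * time_cutoff N r t `^ p^-1 /\
  `|'D_1 ('D_1 (time_cutoff N r)) t| <= C / r ^+ 2 * time_cutoff N r t `^ p^-1.

Let a : R := (n%:R - 1) / 2.
Let be : R := a - p^-1.
Let p' : R := p / (p - 1).

Let p0 : 0 < p. Proof. exact: lt_trans p1. Qed.
Let pp : p'^-1 = 1 - p^-1.
Proof.
rewrite /p' invf_div mulrBl divff ?mul1r// gt_eqF//.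
Qed.
Let ppD : p^-1 + p'^-1 = 1. Proof. by rewrite pp addrC subrK. Qed.
Let p'1 : 1 < p'.
Proof. by rewrite /p' ltr_pdivlMr ?subr_gt0// mul1r gtrBl. Qed.
Let p'0 : 0 < p'. Proof. exact: lt_trans p'1. Qed.
Let a0 : 0 < a.
Proof. by rewrite divr_gt0// subr_gt0 ltr1n. Qed.
Let be0 : 0 < be.
Proof.
have h : be * (2 * p ^+ 2) = (n%:R + 1) * p - 2 * p + 2.
  have -> : be * (2 * p ^+ 2) = (n%:R - 1) * p ^+ 2 - 2 * p.
    by rewrite /be /a; field; rewrite gt_eqF.
  by have := p_root; lra.
have h2 : 0 < be * (2 * p ^+ 2).
  have nn : 2 <= n%:R :> R by rewrite ler_nat.
  by rewrite h -mulrBl; apply: addr_gt0 => //; apply: mulr_gt0 => //; lra.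
by rewrite -(pmulr_lgt0 _ (x := 2 * p ^+ 2))// mulr_gt0// exprn_gt0.
Qed.

Lemma data_pairing_gt0 (J : nat) (c s : nat -> R) (i : 'I_J) :
  (forall j : 'I_J, 0 <= s j) -> (forall j : 'I_J, 0 <= c j) -> 0 < c i ->
  0 < \int[mu]_x (g x * psi a J c s 0 x).
Proof.
move=> s0 c0 ci; have [x0 gx0] := g_neq0.
have [gs _] := g_smooth.
have cg : continuous g by exact: (@Ck_cont _ _ _ _ (gs 0%N)).
have tpsi : tame (psi (n := n) a J c s) by exact: tame_wavef.
have cpsi := tame_continuous tpsi (lexx 0).
have x1 : enorm x0 <= 0 + 1.
  rewrite add0r leNgt; apply/negP => h; move: gx0.
  by rewrite (fsupport_out g_supp h) eqxx.
apply: (@Rintegral_gt0 _ _ _ x0) => //.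
- by move=> x; exact: (cvgM (cg x) (cpsi x)).
- by move=> x; rewrite mulr_ge0// psi_ge0.
- exact: data_pairing_integrable.
- apply: mulr_gt0; first by rewrite lt_neqAle eq_sym gx0 g_ge0.
  apply: lt_le_trans (psi_ge_term (ltW a0) s0 c0 i (lexx 0) x1).
  by rewrite mulr_gt0// powR_gt0// add0r ltr_wpDr.
Qed.

(** The p-th power of the L^p norm, with the weight that frees the estimates
    below from powers of the time scale. *)
Definition wave_mass (u : R -> 'rV[R]_n -> R) (t : R) : R :=
  (t + 2) `^ (- be) * lnorm mu p (u t) `^ p.

Lemma continuous_wave_mass T u r : continuous_Lp T p u -> (r%:E < T)%E ->
  {within `[0, r], continuous (wave_mass u)}.
Proof.
move=> cup rT; apply: within_continuousM; last exact: (continuous_lnorm_powR p1 cup rT).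
have h : {within `[0, r], continuous (fun t : R => t + 2)}.
  apply: continuous_subspaceT => t; apply: cvgD; [exact: cvg_id|exact: cvg_cst].
have h0 t : `[0, r]%classic t -> 0 < t + 2.
  by rewrite /= in_itv/= => /andP[t0 _]; rewrite ltr_wpDl.
have hi : {within `[0, r], continuous (fun t : R => (t + 2) `^ be)}.
  by apply: within_continuous_powR => // t /h0 /ltW.
rewrite (_ : (fun t => _) = (fun t : R => ((t + 2) `^ be)^-1)); last first.
  by apply/funext => t; rewrite powRN.
move/subspace_continuousP: hi => hi; apply/subspace_continuousP => t tI.
by apply: cvgV; [rewrite gt_eqF// powR_gt0// h0|exact: hi].
Qed.

Lemma wave_mass_ge0 u t : 0 <= wave_mass u t.
Proof. by rewrite mulr_ge0 ?powR_ge0. Qed.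

Definition late_mass u r : R :=
  \int[leb]_(t in `[(r / 2), r]) (wave_mass u t * time_cutoff N r t).

Let A D := 4 * (1 + a) * C * D * (2^-1 `^ (- a) * 2^-1 `^ p'^-1 * 2 `^ (be * p^-1)).

Lemma critical_inequality (T : \bar R) (u : R -> 'rV[R]_n -> R) (eps : R)
    (J : nat) (c s : nat -> R) (r D ga kappa cm : R) :
  0 < eps -> solution p f g eps T u ->
  (forall j : 'I_J, 0 <= s j) -> (forall j : 'I_J, 0 <= c j) ->
  0 < \int[mu]_x (g x * psi a J c s 0 x) ->
  2 <= r -> (r%:E < T)%E -> 0 <= D -> 0 <= kappa -> 0 <= cm ->
  (forall j : 'I_J, s j <= 2 * r) ->
  (forall (t : R) (x : 'rV[R]_n), 0 <= t <= r -> enorm x <= t + 1 ->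
    \sum_(j < J) c j * (t + 2 - enorm x + s j) `^ (- (a + 1)) <=
      D * (t + 2 - enorm x) `^ (- ga)) ->
  (forall t : R, 0 <= t <= r ->
    (\int[mu]_(x in eball (t + 1)) ((t + 2 - enorm x) `^ (- (ga * p')))%:E <=
      (kappa * r ^+ n.-1)%:E)%E) ->
  (forall (t : R) (x : 'rV[R]_n), 0 <= t <= r -> enorm x <= t + 1 ->
    cm * (t + 2) `^ (- be) <= psi a J c s t x) ->
  cm * \int[leb]_(t in `[1, r]) (wave_mass u t * time_cutoff N r t) +
    eps * (\int[mu]_x (g x * psi a J c s 0 x)) / 2 <=
  A D * kappa `^ p'^-1 * late_mass u r `^ p^-1.
Proof.
move=> eps0 [[T0 _ cup su wu] [u0 [w [cuw w0]]]] s0 c0 gpos r2 rT D0 k0 cm0 sle Hsum Hwt Hm.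
have r0 : 0 < r by exact: lt_le_trans r2.
have [fs _] := f_smooth.
have cf : continuous f by exact: (@Ck_cont _ _ _ _ (fs 0%N)).
have gap := initial_gap T0 cuw eps0 u0 w0 cf g_smooth f_supp g_supp f_ge0 (ltW a0) s0 c0.
have gap0 := lt_le_trans (mulr_gt0 eps0 gpos) gap.
have K0 : 0 <= kappa * r ^+ n.-1 by rewrite mulr_ge0// exprn_ge0// ltW.
have Hm' (t : R) (x : 'rV[R]_n) : 0 <= t <= r -> enorm x <= t + 1 ->
    0 <= cm * (t + 2) `^ (- be) <= psi a J c s t x.
  by move=> tr xt; rewrite (Hm _ _ tr xt) andbT mulr_ge0 ?powR_ge0.
have H := weighted_inequality p1 p'1 ppD T0 cuw cup su wu erefl (ltW a0) s0 c0 r2 rT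
  N0 C0 D0 K0 (fun t => cutoffN t r0) sle Hsum Hwt Hm' gap0.
have ceta : continuous (time_cutoff N r).
  by move=> t; exact: (@Ck_cont _ _ _ _ (@smooth_time_cutoff R N r 0) t).
have cnu := continuous_wave_mass cup rT.
have cF : {within `[0, r], continuous (fun t => wave_mass u t * time_cutoff N r t)}.
  by apply: within_continuousM => //; exact: continuous_subspaceT.
have sub1 : `[1, r]%classic `<=` `[0, r]%classic.
  by move=> t /=; rewrite !in_itv/= => /andP[t1 ->]; rewrite andbT (le_trans ler01).
have half0 : 0 <= r / 2 by rewrite divr_ge0 ?ltW.
have sub2 : `[(r / 2), r]%classic `<=` `[0, r]%classic.
  by move=> t /=; rewrite !in_itv/= => /andP[t1 ->]; rewrite andbT (le_trans half0).
have i1 := cc_integrable (within_continuousS sub1 cF).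
have i2 := cc_integrable (within_continuousS sub2 cF).
have E1 : \int[leb]_(t in `[1, r])
      (time_cutoff N r t * (cm * (t + 2) `^ (- be) * lnorm mu p (u t) `^ p)) =
    cm * \int[leb]_(t in `[1, r]) (wave_mass u t * time_cutoff N r t).
  by rewrite -RintegralZl//; apply: eq_Rintegral => t _; rewrite /wave_mass; ring.
have eta01 t : 0 <= time_cutoff N r t <= 1 by exact: time_cutoff01.
have E2 : \int[leb]_(t in `[(r / 2), r]) (lnorm mu p (u t) `^ p * time_cutoff N r t) <=
    (2 * r) `^ be * late_mass u r.
  have j1 : leb.-integrable `[(r / 2), r]
      (EFin \o (fun t => lnorm mu p (u t) `^ p * time_cutoff N r t)).
    apply: cc_integrable; apply: within_continuousM; last exact: continuous_subspaceT.
    exact: within_continuousS sub2 (continuous_lnorm_powR p1 cup rT).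
  have j2 : leb.-integrable `[(r / 2), r]
      (EFin \o (fun t => (2 * r) `^ be * (wave_mass u t * time_cutoff N r t))).
    apply: cc_integrable; apply: within_continuousM; last exact: within_continuousS sub2 cF.
    by apply: continuous_subspaceT; exact: cst_continuous.
  rewrite /late_mass -RintegralZl//; apply: (le_Rintegral _ j1 j2) => //.
    move=> t; rewrite /= in_itv/= => /andP[rt tr].
    have /andP[e0 _] := eta01 t.
    have t2 : 0 < t + 2 by rewrite ltr_wpDl// (le_trans half0).
    have h : 1 <= (2 * r) `^ be * (t + 2) `^ (- be).
      rewrite powRN ler_pdivlMr ?powR_gt0// mul1r.
      apply: ge0_ler_powR; rewrite ?nnegrE ?(ltW be0) ?(ltW t2)//.
        by rewrite mulr_ge0// ltW.
      by rewrite mulr_natl mulr2n lerD.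
    by rewrite /wave_mass !mulrA ler_wpM2r// ler_peMl ?powR_ge0.
have L0 : 0 <= late_mass u r.
  by apply: Rintegral_ge0 => t _; rewrite mulr_ge0 ?wave_mass_ge0//; case/andP: (eta01 t).
have X0 : 0 <= \int[leb]_(t in `[(r / 2), r]) (lnorm mu p (u t) `^ p * time_cutoff N r t).
  by apply: Rintegral_ge0 => t _; rewrite mulr_ge0 ?powR_ge0//; case/andP: (eta01 t).
have pV0 : 0 <= p^-1 by rewrite invr_ge0 ltW.
rewrite -E1; apply: (@le_trans _ _ _ _ _ (le_trans _ H)).
  by rewrite lerD2l ler_wpM2r ?invr_ge0.
have E3 : (\int[leb]_(t in `[(r / 2), r]) (lnorm mu p (u t) `^ p * time_cutoff N r t)) `^ p^-1
    <= ((2 * r) `^ be) `^ p^-1 * late_mass u r `^ p^-1.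
  rewrite -powRM ?powR_ge0//; apply: ge0_ler_powR => //.
  by rewrite nnegrE mulr_ge0 ?powR_ge0.
have /(_ (4 * (1 + a) * C * D)) S :=
  critical_scaling n2 p1 pp erefl erefl p_root _ k0 r0.
rewrite /A -S.
rewrite -[leRHS]mulrA; apply: ler_wpM2l => //.
by rewrite !mulr_ge0 ?powR_ge0 ?invr_ge0 ?addr_ge0 ?(ltW C0) ?(ltW r0) ?(ltW a0).
Qed.

Let A_gt0 D : 0 < D -> 0 < A D.
Proof.
move=> D0; rewrite /A !mulr_gt0 ?powR_gt0 ?invr_gt0//.
by rewrite addr_gt0.
Qed.

Lemma late_mass_ge0 u r : 0 <= late_mass u r.
Proof.
apply: Rintegral_ge0 => t _; rewrite mulr_ge0 ?wave_mass_ge0//.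
by case/andP: (time_cutoff01 N r t).
Qed.

(** On late slices the single wave without shift is bounded by a power of time
    times the inverse of the distance to the cone, whose integral to the dual
    power p' > 1 has no logarithm; only the contribution of the data is kept. *)
Lemma late_mass_lower_bound : exists2 c1 : R, 0 < c1 &
  forall (eps : R) (T : \bar R) (u : R -> 'rV[R]_n -> R) (r : R), 0 < eps ->
  solution p f g eps T u -> 2 <= r -> (r%:E < T)%E ->
  c1 * eps `^ p <= late_mass u r.
Proof.
have [kappa k0 Hk] := @weight_integral_gt1 R n p' p'1.
pose c (j : nat) : R := 1; pose s (j : nat) : R := 0.
have s0 (j : 'I_1) : 0 <= s j by [].
have c0 (j : 'I_1) : 0 <= c j by [].
have gpos := data_pairing_gt0 (i := ord0) s0 c0 ltr01.
set G := \int[mu]_x _ in gpos.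
pose A' := A 1 * kappa `^ p'^-1.
have A'0 : 0 < A' by rewrite mulr_gt0 ?powR_gt0// A_gt0.
have GA : 0 < G / 2 / A' by rewrite !divr_gt0.
exists ((G / 2 / A') `^ p); first exact: powR_gt0.
move=> eps T u r eps0 sol r2 rT.
have r0 : 0 <= r by exact: le_trans r2.
have Hsum (t : R) (x : 'rV[R]_n) : 0 <= t <= r -> enorm x <= t + 1 ->
    \sum_(j < 1) c j * (t + 2 - enorm x + s j) `^ (- (a + 1)) <=
      1 * (t + 2 - enorm x) `^ (- 1).
  move=> _ xt; rewrite big_ord1 /c /s addr0 !mul1r; apply: ler_powR.
    exact: cone_distance_ge1.
  by rewrite lerN2 lerDr ltW.
have Hwt (t : R) : 0 <= t <= r ->
    (\int[mu]_(x in eball (t + 1)) ((t + 2 - enorm x) `^ (- (1 * p')))%:E <=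
      (kappa * r ^+ n.-1)%:E)%E.
  by move=> tr; rewrite mul1r; exact: Hk.
have Hm (t : R) (x : 'rV[R]_n) : 0 <= t <= r -> enorm x <= t + 1 ->
    0 * (t + 2) `^ (- be) <= psi a 1 c s t x.
  by move=> _ _; rewrite mul0r psi_ge0.
have sle (j : 'I_1) : s j <= 2 * r by rewrite mulr_ge0.
have H := critical_inequality eps0 sol s0 c0 gpos r2 rT ler01 (ltW k0) (lexx 0)
  sle Hsum Hwt Hm.
rewrite mul0r add0r -/G -/A' in H.
have {}H : G / 2 / A' * eps <= late_mass u r `^ p^-1.
  have -> : G / 2 / A' * eps = eps * G / 2 / A' by ring.
  by rewrite ler_pdivrMr// [leRHS]mulrC.
have L0 := late_mass_ge0 u r.
rewrite -(powRM _ (ltW GA) (ltW eps0)).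
have -> : late_mass u r = (late_mass u r `^ p^-1) `^ p.
  by rewrite -powRrM mulVf ?gt_eqF// powRr1.
by apply: ge0_ler_powR; rewrite ?nnegrE ?powR_ge0 ?(ltW p0)// mulr_ge0// ltW.
Qed.

Let dc (j : nat) : R := (2 ^+ j) `^ (a + p^-1).
Let ds (j : nat) : R := 2 ^+ j.

(** The shift 2^i comparable to t + 2 suffices; the number k + 2 of shifts makes
    it available up to time 2^k. *)
Lemma dyadic_wave_lower_bound : exists2 cm : R, 0 < cm &
  forall (k : nat) (t : R) (x : 'rV[R]_n), (1 <= k)%N -> 0 <= t <= 2 ^+ k ->
  enorm x <= t + 1 -> cm * (t + 2) `^ (- be) <= psi a k.+2 dc ds t x.
Proof.
have ap0 : 0 <= a + p^-1 by rewrite addr_ge0 ?invr_ge0 ?ltW.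
have a20 : 0 <= 2 * a by rewrite mulr_ge0// ltW.
have h0 : 0 <= (2 : R)^-1 by rewrite invr_ge0.
exists (2^-1 `^ (a + p^-1) * 2 `^ (- (2 * a))); first by rewrite mulr_gt0 ?powR_gt0.
move=> k t x k1 /andP[t0 tk] xt.
have t1 := shifted_time_ge1 t0.
have tp : 0 < t + 2 by apply: lt_le_trans t1.
have [i /andP[it ti]] := dyadic_bracket t1.
have ik : (i < k.+2)%N.
  rewrite ltnS leqNgt; apply/negP => ki.
  have h1 : 2 ^+ k.+2 <= 2 ^+ i :> R by apply: ler_weXn2l; rewrite ?ler1n.
  have h2 : 2 <= 2 ^+ k :> R.
    by rewrite -[leLHS]expr1; apply: ler_weXn2l; rewrite ?ler1n.
  by have := le_trans h1 it; rewrite !exprS; exact: shifted_time_lt.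
have ds0 (j : 'I_k.+2) : 0 <= ds j by rewrite exprn_ge0.
have dc0 (j : 'I_k.+2) : 0 <= dc j by rewrite powR_ge0.
apply: le_trans (psi_ge_term (ltW a0) ds0 dc0 (Ordinal ik) t0 xt).
have -> : 2^-1 `^ (a + p^-1) * 2 `^ (- (2 * a)) * (t + 2) `^ (- be) =
    (2^-1 * (t + 2)) `^ (a + p^-1) * (2 * (t + 2)) `^ (- (2 * a)).
  rewrite !powRM ?(ltW tp)//.
  have -> : (t + 2) `^ (- be) = (t + 2) `^ (a + p^-1) * (t + 2) `^ (- (2 * a)).
    rewrite -powRD; last by rewrite (gt_eqF tp) implybT.
    by congr (_ `^ _); rewrite /be; ring.
  ring.
apply: ler_pM; rewrite ?powR_ge0//.
  rewrite /dc /=; apply: ge0_ler_powR; rewrite ?nnegrE ?exprn_ge0//.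
    by rewrite mulr_ge0// ltW.
  by move: ti; rewrite exprS; exact: halve_le.
apply: powRN_le => //; rewrite /ds /=.
  by rewrite addr_gt0// exprn_gt0.
by rewrite [leRHS]mulr_natl mulr2n lerD2l.
Qed.

(** The superposition of dyadic shifts decays on late slices like the power
    - 1/p' of the distance to the cone, by [dyadic_sum_le]. Its dual power is the
    inverse of that distance, whose integral produces the factor [k]. *)
Lemma dyadic_growth : exists2 C3 : R, 0 < C3 &
  forall (eps : R) (T : \bar R) (u : R -> 'rV[R]_n -> R) (k : nat), 0 < eps ->
  solution p f g eps T u -> (1 <= k)%N -> ((2 ^+ k)%:E < T)%E ->
  \int[leb]_(t in `[1, 2 ^+ k]) (wave_mass u t * time_cutoff N (2 ^+ k) t) <=
  C3 * k%:R `^ p'^-1 * late_mass u (2 ^+ k) `^ p^-1.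
Proof.
have [kappa k0 Hk] := @weight_integral_eq1 R n.
have [cm cm0 Hcm] := dyadic_wave_lower_bound.
have ap0 : 0 < a + p^-1 by rewrite addr_gt0 ?invr_gt0.
have pV'0 : 0 < p'^-1 by rewrite invr_gt0.
have [D D0 HD] := @dyadic_sum_le R (a + p^-1) p'^-1 ap0 pV'0.
pose A' := A D * kappa `^ p'^-1.
have A'0 : 0 < A' by rewrite mulr_gt0 ?powR_gt0// A_gt0.
exists (A' / cm); first exact: divr_gt0.
move=> eps T u k eps0 sol k1 kT.
have r2 : 2 <= 2 ^+ k :> R.
  by rewrite -[leLHS]expr1; apply: ler_weXn2l; rewrite ?ler1n.
have ds0 (j : 'I_k.+2) : 0 <= ds j by rewrite exprn_ge0.
have dc0 (j : 'I_k.+2) : 0 <= dc j by rewrite powR_ge0.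
have dci : 0 < dc (ord0 : 'I_k.+2) by rewrite powR_gt0// exprn_gt0.
have gpos := data_pairing_gt0 ds0 dc0 dci.
have sle (j : 'I_k.+2) : ds j <= 2 * 2 ^+ k.
  by rewrite -exprS /ds; apply: ler_weXn2l; rewrite ?ler1n// -ltnS.
have kk0 : 0 <= kappa * k%:R by rewrite mulr_ge0 ?ler0n// ltW.
have Hsum (t : R) (x : 'rV[R]_n) : 0 <= t <= 2 ^+ k -> enorm x <= t + 1 ->
    \sum_(j < k.+2) dc j * (t + 2 - enorm x + ds j) `^ (- (a + 1)) <=
      D * (t + 2 - enorm x) `^ (- p'^-1).
  move=> _ xt; have y1 := cone_distance_ge1 xt.
  have := HD _ k.+2 y1.
  by have -> : a + p^-1 + p'^-1 = a + 1 by rewrite -addrA ppD.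
have Hwt (t : R) : 0 <= t <= 2 ^+ k ->
    (\int[mu]_(x in eball (t + 1)) ((t + 2 - enorm x) `^ (- (p'^-1 * p')))%:E <=
      (kappa * k%:R * (2 ^+ k) ^+ n.-1)%:E)%E.
  by move=> tr; rewrite mulVf ?gt_eqF//; exact: Hk.
have Hm (t : R) (x : 'rV[R]_n) : 0 <= t <= 2 ^+ k -> enorm x <= t + 1 ->
    cm * (t + 2) `^ (- be) <= psi a k.+2 dc ds t x by exact: Hcm.
have H := critical_inequality eps0 sol ds0 dc0 gpos r2 kT (ltW D0) kk0 (ltW cm0)
  sle Hsum Hwt Hm.
have egap := mulr_gt0 eps0 gpos.
set X := \int[leb]_(t in _) _ in H *.
have {}H : cm * X <= A D * (kappa * k%:R) `^ p'^-1 * late_mass u (2 ^+ k) `^ p^-1.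
  apply: le_trans H; rewrite lerDl; apply: ltW.
  by rewrite divr_gt0.
rewrite (powRM _ (ltW k0) (ler0n _ k)) in H.
have -> : A' / cm * k%:R `^ p'^-1 * late_mass u (2 ^+ k) `^ p^-1 =
  (A D * (kappa `^ p'^-1 * k%:R `^ p'^-1) * late_mass u (2 ^+ k) `^ p^-1) / cm.
  by rewrite /A'; ring.
by rewrite ler_pdivlMr// mulrC.
Qed.

(** The left-hand side bounds both [B] and [L]: the first gives the recursive
    inequality, and the second lets [L] be replaced by the left-hand side, which
    then can be absorbed. *)
Lemma self_improvement (C3 k B L : R) : 0 < C3 -> 0 <= k -> 0 <= B -> 0 <= L ->
  B + L <= C3 * k `^ p'^-1 * L `^ p^-1 ->
  B `^ p <= C3 `^ p * k `^ (p - 1) * L /\ B <= C3 `^ p' * k.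
Proof.
move=> C30 k0 B0 L0 H.
have pV0 : 0 <= p^-1 by rewrite invr_ge0 ltW.
have BL0 : 0 <= B + L by exact: addr_ge0.
have pp1 : p'^-1 * p = p - 1.
  by rewrite pp mulrBl mul1r mulVf// gt_eqF.
split.
  apply: (@le_trans _ _ ((C3 * k `^ p'^-1 * L `^ p^-1) `^ p)).
    apply: ge0_ler_powR; rewrite ?nnegrE ?(ltW p0)//.
      by rewrite !mulr_ge0 ?powR_ge0// ltW.
    by apply: le_trans H; rewrite lerDl.
  rewrite !powRM ?mulr_ge0 ?powR_ge0 ?(ltW C30)// -!powRrM pp1.
  by rewrite mulVf ?gt_eqF// powRr1.
apply: (@le_trans _ _ (B + L)); first by rewrite lerDl.
have [->|BL] := eqVneq (B + L) 0; first by rewrite mulr_ge0 ?powR_ge0.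
have BLp : 0 < B + L by rewrite lt_neqAle eq_sym BL.
have H2 : B + L <= C3 * k `^ p'^-1 * (B + L) `^ p^-1.
  apply: le_trans H _; rewrite ler_wpM2l ?mulr_ge0 ?powR_ge0 ?(ltW C30)//.
  by apply: ge0_ler_powR; rewrite ?nnegrE// lerDr.
have H3 : (B + L) `^ p'^-1 <= C3 * k `^ p'^-1.
  have e : B + L = (B + L) `^ p'^-1 * (B + L) `^ p^-1.
    rewrite -powRD; last by rewrite (gt_eqF BLp) implybT.
    by rewrite [p'^-1 + _]addrC ppD powRr1.
  by move: H2; rewrite {1}e ler_pM2r ?powR_gt0.
have -> : B + L = ((B + L) `^ p'^-1) `^ p'.
  by rewrite -powRrM mulVf ?gt_eqF// powRr1.
apply: (@le_trans _ _ ((C3 * k `^ p'^-1) `^ p')).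
  apply: ge0_ler_powR; rewrite ?nnegrE ?powR_ge0 ?(ltW p'0)//.
  by rewrite mulr_ge0 ?powR_ge0// ltW.
by rewrite powRM ?powR_ge0 ?(ltW C30)// -powRrM mulVf ?gt_eqF// powRr1.
Qed.

(** [discrete_blow_up] for the mass on the interval from 2^(k-1) to 2^k and its
    partial sums, with [e] equal to [eps `^ p]. *)
Lemma dyadic_lifespan : exists2 B0 : R, 0 < B0 &
  forall (eps : R) (T : \bar R) (u : R -> 'rV[R]_n -> R) (K : nat),
  0 < eps <= 1 -> solution p f g eps T u -> ((2 ^+ K)%:E < T)%E ->
  K%:R <= B0 * eps `^ (- (p * (p - 1))).
Proof.
have [c1 c10 H1] := late_mass_lower_bound.
have [C3 C30 H3] := dyadic_growth.
have [B0 B00 HB] := @discrete_blow_up R p c1 (C3 `^ p) (C3 `^ p') p1 c10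
  (powR_gt0 _ C30) (powR_gt0 _ C30).
exists B0 => // eps T u K /andP[eps0 eps1] sol KT.
pose av k := \int[leb]_(t in `[(2 ^+ k / 2), 2 ^+ k]) wave_mass u t.
pose Bv k := \int[leb]_(t in `[1, (2 ^+ k / 2)]) wave_mass u t.
rewrite -mulrN powRrM; apply: (HB _ K Bv av).
  rewrite powR_gt0//=; have -> : (1 : R) = 1 `^ p by rewrite powR1.
  by apply: ge0_ler_powR; rewrite ?nnegrE ?(ltW p0) ?(ltW eps0).
move=> k /andP[k1 kK].
have r2 : 2 <= 2 ^+ k :> R.
  by rewrite -[leLHS]expr1; apply: ler_weXn2l; rewrite ?ler1n.
have kT : ((2 ^+ k)%:E < T)%E.
  by apply: le_lt_trans KT; rewrite lee_fin; apply: ler_weXn2l; rewrite ?ler1n.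
have rS : 2 ^+ k.+1 / 2 = 2 ^+ k :> R by rewrite exprS mulrAC divff ?mul1r.
have [[_ _ cup _ _] _] := sol.
move: (H1 eps T u _ eps0 sol r2 kT) (H3 eps T u k eps0 sol k1 kT).
have cw := continuous_wave_mass cup kT.
rewrite /Bv /av rS.
move: r2 cw; move: (2 ^+ k : R) => r r2 cw l1 l3.
have ceta : continuous (time_cutoff N r).
  by move=> t; exact: (@Ck_cont _ _ _ _ (@smooth_time_cutoff R N r 0) t).
have hr := half_interval r2.
have r0 : 0 < r by exact: lt_le_trans r2.
have half0 : 0 <= r / 2 by rewrite divr_ge0 ?ltW.
have sub1 : `[1, r]%classic `<=` `[0, r]%classic.
  by move=> t /=; rewrite !in_itv/= => /andP[t1 ->]; rewrite andbT (le_trans ler01).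
have sub2 : `[(r / 2), r]%classic `<=` `[0, r]%classic.
  by move=> t /=; rewrite !in_itv/= => /andP[t1 ->]; rewrite andbT (le_trans half0).
have cF : {within `[0, r], continuous (fun t => wave_mass u t * time_cutoff N r t)}.
  by apply: within_continuousM => //; exact: continuous_subspaceT.
have i1 := cc_integrable (within_continuousS sub1 cw).
have i1F := cc_integrable (within_continuousS sub1 cF).
have i2 := cc_integrable (within_continuousS sub2 cw).
have i2F := cc_integrable (within_continuousS sub2 cF).
have La : late_mass u r <= \int[leb]_(t in `[(r / 2), r]) wave_mass u t.
  apply: (le_Rintegral _ i2F i2) => // t _.
  by rewrite ler_piMr ?wave_mass_ge0//; case/andP: (time_cutoff01 N r t).
rewrite (Rintegral_cc_split hr i1F) in l3.
have e1 : \int[leb]_(t in `[1, (r / 2)]) (wave_mass u t * time_cutoff N r t) =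
    \int[leb]_(t in `[1, (r / 2)]) wave_mass u t.
  apply: eq_Rintegral => t; rewrite inE /= in_itv/= => /andP[_ tr].
  by rewrite time_cutoff1// mulr1.
rewrite e1 in l3.
have B0' : 0 <= \int[leb]_(t in `[1, (r / 2)]) wave_mass u t.
  by apply: Rintegral_ge0 => t _; exact: wave_mass_ge0.
have [s1 s2] := self_improvement C30 (ler0n _ k) B0' (late_mass_ge0 u r) l3.
split => //.
- exact: le_trans l1 La.
- by rewrite (Rintegral_cc_split hr i1).
- apply: le_trans s1 _; rewrite ler_wpM2l//.
  by rewrite mulr_ge0 ?powR_ge0.
Qed.

End critical_estimates.

(** * From dyadic times to the lifespan *)

Section lifespan_bound.
Context (R : realType) (n : nat) (p : R).
Hypotheses (n2 : (2 <= n)%N) (p0 : 0 < p).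
Hypothesis p_root : (n%:R - 1) * p ^+ 2 - (n%:R + 1) * p - 2 = 0.

Lemma critical_power_gt1 : 1 < p.
Proof.
rewrite ltNge; apply/negP => p1.
have nn : 2 <= n%:R :> R by rewrite ler_nat.
have h : p ^+ 2 <= p by rewrite expr2 -[leRHS]mulr1 ler_wpM2l// ltW.
have : (n%:R - 1) * p ^+ 2 <= (n%:R - 1) * p by rewrite ler_wpM2l//; lra.
by move: p_root p0; lra.
Qed.

(** The quadratic polynomial is (3 p + 1) (p - 2) when n = 4. *)
Lemma critical_power4 : n = 4%N -> p = 2.
Proof.
move=> n4; have : (3 * p + 1) * (p - 2) = 0.
  by rewrite -p_root n4; ring.
move=> /eqP; rewrite mulf_eq0 => /orP[/eqP h|]; last by rewrite subr_eq0 => /eqP.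
by move: p0; lra.
Qed.

Lemma dyadic_time_le (B0 L : R) (T : \bar R) : 0 <= B0 -> 1 <= L ->
  (forall K : nat, ((2 ^+ K)%:E < T)%E -> K%:R <= B0 * L) ->
  (T <= (expR ((B0 + 1) * L))%:E)%E.
Proof.
move=> B00 L1 H; rewrite leNgt; apply/negP => LT.
have BL0 : 0 <= B0 * L by rewrite mulr_ge0// (le_trans ler01).
have /andP[k1 k2] := truncn_itv BL0.
have := H (trunc (B0 * L)).+1; rewrite leNgt k2/= => /(_ _)/notF; apply.
apply: le_lt_trans LT; rewrite lee_fin.
apply: (@le_trans _ _ (expR 1 ^+ (trunc (B0 * L)).+1)).
  apply: lerXn2r; rewrite ?nnegrE ?expR_ge0//.
  by have := expR_ge1Dx (1 : R); rewrite -[1 + 1]/(2 : R).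
rewrite -expRM_natl mulr1 ler_expR -natr1 mulrDl mul1r.
exact: lerD.
Qed.

End lifespan_bound.

Theorem theorem1p1 (R : realType) (n : nat) (p : R) (f g : 'rV[R]_n -> R)
  (n_ge2 : (2 <= n)%N)
  (p_gt0 : 0 < p)
  (p_root : (n%:R - 1) * p ^+ 2 - (n%:R + 1) * p - 2 = 0)
  (f_smooth : smooth_compact f) (g_smooth : smooth_compact g)
  (f_supp : fsupport f `<=` [set x | enorm x <= 1])
  (g_supp : fsupport g `<=` [set x | enorm x <= 1])
  (f_ge0 : forall x, 0 <= f x) (g_ge0 : forall x, 0 <= g x)
  (g_neq0 : exists x, g x != 0) :
  (n = 4%N -> p = 2) /\
  exists eps0 B : R, 0 < eps0 /\ 0 < B /\
    forall eps : R, 0 < eps -> eps <= eps0 ->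
    forall (T : \bar R) (u : R -> 'rV[R]_n -> R), solution p f g eps T u ->
    [/\ (T < +oo)%E,
        (lifespan p f g eps <= (expR (B * eps `^ (- (p * (p - 1)))))%:E)%E &
        n = 4%N -> (lifespan p f g eps <= (expR (B * eps ^- 2))%:E)%E].
Proof.
have n4 := critical_power4 p_gt0 p_root.
have p1 := critical_power_gt1 n_ge2 p_gt0 p_root.
have [N [C [N0 C0 HN]]] := time_cutoff_derivatives p1.
have [B0 B00 HB] := dyadic_lifespan n_ge2 p1 p_root f_smooth g_smooth f_supp g_supp
  f_ge0 g_ge0 g_neq0 N0 C0 HN.
split => //; exists 1, (B0 + 1); split => //; split; first exact: addr_gt0.
move=> eps eps0 eps1 T u sol.
have eps01 : 0 < eps <= 1 by rewrite eps0.
have L1 : 1 <= eps `^ (- (p * (p - 1))).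
  rewrite powRN -[leLHS]invr1 lef_pV2 ?posrE ?powR_gt0//.
  rewrite -[leRHS](_ : 1 `^ (p * (p - 1)) = 1); last by rewrite powR1.
  apply: ge0_ler_powR; rewrite ?nnegrE ?(ltW eps0)//.
  by rewrite mulr_ge0 ?(ltW p_gt0)// subr_ge0 ltW.
have Tle (T' : \bar R) (u' : R -> 'rV[R]_n -> R) : solution p f g eps T' u' ->
    (T' <= (expR ((B0 + 1) * eps `^ (- (p * (p - 1)))))%:E)%E.
  move=> sol'; apply: (dyadic_time_le (ltW B00) L1) => K KT.
  exact: HB eps01 sol' KT.
have bound : (lifespan p f g eps <= (expR ((B0 + 1) * eps `^ (- (p * (p - 1)))))%:E)%E.
  by apply: ge_ereal_sup => T' [u' /Tle].
split => //; first exact: le_lt_trans (Tle _ _ sol) (ltry _).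
move=> /n4 p2; move: bound; rewrite p2.
have -> : 2 * (2 - 1) = 2%:R :> R by ring.
by rewrite powRN powR_mulrn// ltW.
Qed.
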